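(* There exist two smooth approximate solutions $\phi_N^{*,s,\pm}$ to the adjoint Orr-Sommerfeld equation $\mathrm{Orr}^*_{c,\nu}\phi=0$, with $\phi_N^{*,s,\pm}\in W^\infty_{n,\mp\alpha}$ for all $n\in\mathbb{N}$, in the form $$\partial_y^j\phi_N^{*,s,\pm}=\partial_y^j\phi_c^{*,\pm}+\sum_{k=1}^N\partial_y^j\psi_c^{k,\pm}\,\nu^k,\qquad\text{as }\nu\to0,\ j\in\mathbb{N},$$ where $\|\partial_y^j\psi_c^{k,\pm}\|_{\mp\alpha}\le C_j$ for some $C_j>0$ independent of $k$ and $\nu>0$.
   Context: Parameters: $\alpha\in\mathbb{Z}\setminus\{0\}$ with $|\alpha|\ll\nu^{-1/2}$, $\nu>0$, $c\in\mathbb{C}$ with $\Im c>0$, and an integer $N\ge1$. $U_s:[0,\infty)\to\mathbb{R}$ is smooth and bounded, $U_s(0)=U_s'(0)=U_s''(0)=0$, $U_s$ has a finite limit at $+\infty$, and there are $\eta_0>0$, $C_k>0$ with $|U_s^{(k)}(y)|\le C_ke^{-\eta_0y}$ for all $k\ge1$, $y\ge0$. With $\Delta_\alpha:=\partial_{yy}-\alpha^2$, $\mathrm{Ray}^*_c\phi:=\Delta_\alpha((U_s-\bar c)\phi)-U_s''\phi$ and $\mathrm{Orr}^*_{c,\nu}\phi:=\mathrm{Ray}^*_c\phi+\frac{\nu}{i\alpha}\Delta_\alpha^2\phi$. $\phi_c^{*,\pm}$ are the two smooth fundamental solutions of $\mathrm{Ray}^*_c\phi=0$ on $[0,\infty)$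 with $\partial_y^n\phi_c^{*,\pm}(y)\sim C_ne^{\pm\alpha y}$ as $y\to\infty$ for all $n\in\mathbb{N}$. ''Approximate solution'' is meant in the following sense: for some $D_N>0$, $|\mathrm{Orr}^*_{c,\nu}\phi_N^{*,s,\pm}(y)|\le D_N\nu^{N+1}|\phi_N^{*,s,\pm}(y)|$ for $y\in\mathbb{R}_+$. For $\eta\in\mathbb{R}$, $n\in\mathbb{N}$: $W^\infty_{n,\eta}:=\{\phi\in C^n(\mathbb{R}_+):\max_{0\le j\le n}\sup_{y\ge0}e^{\eta y}|\partial^j\phi(y)|<\infty\}$ and $\|\phi\|_\eta:=\sup_{y\ge0}e^{\eta y}|\phi(y)|$.
   Formalization: The coefficients ψ_c^k may depend on ν, but differ from fixed ν-independent ones by at most C_j ν^{N+1-k} in the weighted norms; with exactly fixed coefficients the pointwise bound can fail where φ_c vanishes. *)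

(* Defs.v *)
From Stdlib Require Export Reals ZArith.
From Coquelicot Require Export Coquelicot.
Open Scope R_scope.

(* Functions on [0,oo) are maps R -> V of which only the values at y >= 0 are
   used: limits and derivatives are taken along [0,oo), so they are one-sided
   at 0. *)

Definition near_Rplus (y : R) : (R -> Prop) -> Prop :=
  within (fun z => 0 <= z) (locally y).

Section Calculus.
Context {V : CompleteNormedModule R_AbsRing}.

Definition is_derive_Rplus (f : R -> V) (y : R) (l : V) : Prop :=
  filterdiff f (near_Rplus y) (fun h : R => scal h l).

Definition ex_derive_Rplus (f : R -> V) (y : R) : Prop :=
  exists l : V, is_derive_Rplus f y l.

(* Meaningful at y >= 0 whenever [ex_derive_Rplus f y]. *)
Definition derive_Rplus (f : R -> V) (y : R) : V :=
  iota (is_derive_Rplus f y).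

Definition derive_Rplus_n (n : nat) (f : R -> V) : R -> V :=
  Nat.iter n derive_Rplus f.

Definition continuous_Rplus (f : R -> V) : Prop :=
  forall y, 0 <= y -> filterlim f (near_Rplus y) (locally (f y)).

Definition Cn_Rplus (n : nat) (f : R -> V) : Prop :=
  (forall j y, (j < n)%nat -> 0 <= y -> ex_derive_Rplus (derive_Rplus_n j f) y)
  /\ continuous_Rplus (derive_Rplus_n n f).

Definition smooth_Rplus (f : R -> V) : Prop := forall n, Cn_Rplus n f.

End Calculus.

(* C carries several normed-module structures; derivatives in the real variable
   y use the one over R. *)
Notation dyR n f := (@derive_Rplus_n R_CompleteNormedModule n f).
Notation dyC n f := (@derive_Rplus_n C_R_CompleteNormedModule n f).
Notation smoothR f := (@smooth_Rplus R_CompleteNormedModule f).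
Notation smoothC f := (@smooth_Rplus C_R_CompleteNormedModule f).

Definition weighted_norm (eta : R) (phi : R -> C) : Rbar :=
  Lub_Rbar (fun r => exists y, 0 <= y /\ r = exp (eta * y) * Cmod (phi y)).

Definition W_infty (n : nat) (eta : R) (phi : R -> C) : Prop :=
  @Cn_Rplus C_R_CompleteNormedModule n phi /\
  forall j, (j <= n)%nat -> Rbar_lt (weighted_norm eta (dyC j phi)) p_infty.

Record shear_profile (Us : R -> R) : Prop := {
  shear_smooth : smoothR Us;
  shear_bounded : exists M, forall y, 0 <= y -> Rabs (Us y) <= M;
  shear_0 : Us 0 = 0;
  shear_1 : dyR 1 Us 0 = 0;
  shear_2 : dyR 2 Us 0 = 0;
  shear_lim : ex_finite_lim Us p_infty;
  shear_decay : exists (eta0 : R) (K : nat -> R), 0 < eta0 /\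
    forall k, (1 <= k)%nat -> 0 < K k /\
      forall y, 0 <= y -> Rabs (dyR k Us y) <= K k * exp (- eta0 * y)
}.

Definition Laplace (alpha : Z) (phi : R -> C) : R -> C :=
  fun y => (dyC 2 phi y - RtoC (IZR alpha ^ 2) * phi y)%C.

Definition Ray_adj (Us : R -> R) (alpha : Z) (c : C) (phi : R -> C) : R -> C :=
  fun y =>
    (Laplace alpha (fun z => (RtoC (Us z) - Cconj c) * phi z) y
       - RtoC (dyR 2 Us y) * phi y)%C.

Definition Orr_adj (Us : R -> R) (alpha : Z) (c : C) (nu : R) (phi : R -> C) :
  R -> C :=
  fun y =>
    (Ray_adj Us alpha c phi y
       + RtoC nu / (Ci * RtoC (IZR alpha)) * Laplace alpha (Laplace alpha phi) y)%C.

Variant branch := Plus | Minus.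

Definition rate (alpha : Z) (s : branch) : R :=
  match s with Plus => IZR alpha | Minus => - IZR alpha end.

Record rayleigh_fundamental (Us : R -> R) (alpha : Z) (c : C)
    (phi : branch -> R -> C) : Prop := {
  rf_smooth : forall s, smoothC (phi s);
  rf_solution : forall s y, 0 <= y -> Ray_adj Us alpha c (phi s) y = RtoC 0;
  rf_asymptotic : forall s n, exists K : C, K <> RtoC 0 /\
    filterlim (fun y => (dyC n (phi s) y / RtoC (exp (rate alpha s * y)))%C)
      (Rbar_locally p_infty) (locally K);
  rf_independent : forall a b : C,
    (forall y, 0 <= y -> (a * phi Plus y + b * phi Minus y)%C = RtoC 0) ->
    a = RtoC 0 /\ b = RtoC 0
}.

Definition approximate_solution (Us : R -> R) (alpha : Z) (c : C) (nu : R)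
    (N : nat) (D : R) (phi : R -> C) : Prop :=
  forall y, 0 <= y ->
    Cmod (Orr_adj Us alpha c nu phi y) <= D * nu ^ (N + 1) * Cmod (phi y).

(* Main.v *)
Require Import Defs.
From Stdlib Require Import Lra Lia Psatz Classical ClassicalEpsilon FunctionalExtensionality.

(** With [w := Us - conj c], which stays away from [0], the equation
    [Ray phi = h] becomes [u'' = (alpha^2 + Us''/w) u + h] for [u := w phi], and
    variation of constants solves it in the class [O(exp (r y))], [r = rate alpha s],
    as soon as [h] decays faster than [exp (r y)] by a factor [exp (- eta y)].
    This yields coefficients [psi_(k+1)] with
    [Ray psi_(k+1) = - Laplace (Laplace psi_k) / (i alpha)], because [Laplace psi_k]
    gains that factor.  The partial sum [g] of order [N+1] satisfies
    [Orr g = nu^(N+2) f].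

    This is not yet [O(nu^(N+1) |g|)], since [phi_c] may vanish (its value at [0]
    does when [c] is an unstable eigenvalue).  Its zeros are finitely many and
    simple, because the Wronskian does not vanish.  Near each zero let [t] be a
    minimiser of [|g|], so that [|g(y)| >= const |y - t|] there.  Adding
    [nu^(N+1) X], where [X] has fourth-order zeros at the nodes [t] and a fourth
    derivative there chosen by Newton interpolation, makes [Orr] vanish exactly at
    the nodes; a Lipschitz bound then controls it by [nu^(N+1) |y - t|].  Terms of
    order beyond [N] are absorbed into the last coefficient. *)

(** * One-sided derivatives of complex-valued functions *)

Local Notation CR := C_R_CompleteNormedModule.
Local Notation RR := R_CompleteNormedModule.

(** The factor [exp (- eta * y)] demanded of a source excludes resonance: a source of size
    [exp (r * y)] in general produces a solution of size [y * exp (r * y)], outside the class. The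
    required estimate is relative and pointwise, so [Orr] has to vanish exactly wherever the
    approximate solution does, and no absolute bound can replace this. A zero of the complex-valued
    [phi_c] on the half-line need not persist under perturbation, hence nodes that minimise [|g|] in
    place of zeros of [g]. Such nodes depend on [nu] without any regularity, which dictates the
    calculus: families indexed by [nu], with all [y]-derivatives bounded uniformly over
    [0 < nu <= 1] and nothing assumed in [nu]. The sum is carried one order beyond [N] because the
    viscous term of [nu^(N+1) X] has order [nu^(N+2)]: only a defect of that same order can be
    cancelled through the fourth derivative of [X] with bounds uniform in [nu]. The Rayleigh part of
    the correction, of order [nu^(N+1)], disappears at the nodes by the order of vanishing. *)

Lemma norm_C_R (x : C) : @norm _ CR x = Cmod x.
Proof.
  change (sqrt (Rabs (fst x) ^ 2 + Rabs (snd x) ^ 2) = sqrt (fst x ^ 2 + snd x ^ 2)).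
  now rewrite !pow2_abs.
Qed.

Lemma scal_C_R (h : R) (x : C) : @scal _ CR h x = (RtoC h * x)%C.
Proof.
  destruct x as [a b]; apply injective_projections;
    unfold scal; simpl; unfold prod_scal, scal; simpl; unfold mult; simpl; ring.
Qed.

Lemma near_Rplus_intro (P : R -> Prop) (y d : R) :
  0 < d -> (forall z, 0 <= z -> Rabs (z - y) < d -> P z) -> near_Rplus y P.
Proof.
  intros Hd H. exists (mkposreal d Hd). intros z Hz Hz0. now apply H.
Qed.

Lemma near_Rplus_elim (P : R -> Prop) (y : R) :
  near_Rplus y P ->
  exists d, 0 < d /\ forall z, 0 <= z -> Rabs (z - y) < d -> P z.
Proof.
  intros [d H]. exists d. split. apply cond_pos. intros z Hz Hzd. now apply H.
Qed.

Lemma is_derive_Rplus_iff {V : CompleteNormedModule R_AbsRing} (f : R -> V)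
    (y : R) (l : V) (hy : 0 <= y) :
  is_derive_Rplus f y l <->
  forall eps, 0 < eps -> exists d, 0 < d /\
    forall z, 0 <= z -> Rabs (z - y) < d ->
      norm (minus (minus (f z) (f y)) (scal (z - y) l)) <= eps * Rabs (z - y).
Proof.
  split.
  - intros [_ H] eps Heps.
    apply near_Rplus_elim.
    refine (H y _ (mkposreal eps Heps)).
    intros P HP. unfold near_Rplus, within.
    apply (filter_imp P); auto.
  - intros H. split. exact (is_linear_scal_l l).
    intros x Hx eps.
    (* [filterdiff] quantifies over every limit of the filter. A limit other than [y] would have a
       neighbourhood that misses [y], while [y] itself lies in the half-line. *)
    assert (x = y) as ->.
    { apply NNPP; intros Hne.
      assert (Hp : 0 < Rabs (x - y)) by (apply Rabs_pos_lt; lra).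
      assert (Hb : locally x (fun z => Rabs (z - x) < Rabs (x - y))).
      { exists (mkposreal _ Hp). intros z Hz. exact Hz. }
      apply Hx in Hb. apply locally_singleton in Hb.
      specialize (Hb hy). rewrite (Rabs_minus_sym y x) in Hb. lra. }
    destruct (H eps (cond_pos eps)) as [d [Hd H']].
    now apply (near_Rplus_intro _ _ d).
Qed.

Definition CDer (f : R -> C) (y : R) (l : C) : Prop :=
  @is_derive_Rplus CR f y l.

Lemma CDer_iff (f : R -> C) (y : R) (l : C) (hy : 0 <= y) :
  CDer f y l <->
  forall eps, 0 < eps -> exists d, 0 < d /\
    forall z, 0 <= z -> Rabs (z - y) < d ->
      Cmod (f z - f y - RtoC (z - y) * l) <= eps * Rabs (z - y).
Proof.
  unfold CDer. rewrite (is_derive_Rplus_iff (V := CR) f y l hy).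
  split; intros H eps Heps; destruct (H eps Heps) as [d [Hd H']]; exists d; split; auto;
    intros z Hz Hzd; specialize (H' z Hz Hzd);
    rewrite norm_C_R in *; rewrite scal_C_R in *; exact H'.
Qed.

Lemma minus_minus_minus {G : AbelianGroup} (x a b : G) :
  minus (minus x b) (minus x a) = minus a b.
Proof.
  change (plus (plus x (opp b)) (opp (plus x (opp a))) = plus a (opp b)).
  rewrite opp_plus, opp_opp, (plus_comm x (opp b)), <- plus_assoc.
  now rewrite (plus_assoc x), plus_opp_r, plus_zero_l, plus_comm.
Qed.

(** The module axiom bounds [norm (scal e x)] only from above; applied to the scalar [/ e] it gives
    the reverse inequality. *)
Lemma norm_scal_ge {V : NormedModule R_AbsRing} (e : R) (x : V) (he : 0 < e) :
  e * norm x <= norm (scal e x).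
Proof.
  assert (hi : 0 < / e) by now apply Rinv_0_lt_compat.
  assert (H : norm (scal (/ e) (scal e x)) <= Rabs (/ e) * norm (scal e x))
    by exact (norm_scal (/ e) (scal e x)).
  assert (E : scal (/ e) (scal e x) = x).
  { eapply eq_trans. apply (scal_assoc (/ e) e x).
    change (mult (/ e) e) with (/ e * e). rewrite Rinv_l by lra. exact (scal_one x). }
  rewrite E in H.
  rewrite Rabs_pos_eq in H by lra.
  apply (Rmult_le_compat_l e) in H; [|lra].
  rewrite <- Rmult_assoc, Rinv_r, Rmult_1_l in H by lra. exact H.
Qed.

Lemma norm_minus_le {V : NormedModule R_AbsRing} (x y : V) :
  norm (minus x y) <= norm x + norm y.
Proof. rewrite <- (norm_opp y). apply norm_triangle. Qed.

(** Increments are taken to the right of [y], where they stay in the half-line even for [y = 0]. Two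
    errors of a quarter of the gap between [l] and [l'] cannot add up to the gap. *)
Lemma is_derive_Rplus_unique {V : CompleteNormedModule R_AbsRing} (f : R -> V)
    (y : R) (l l' : V) (hy : 0 <= y) :
  is_derive_Rplus f y l -> is_derive_Rplus f y l' -> l = l'.
Proof.
  intros H H'. rewrite is_derive_Rplus_iff in H, H' by assumption.
  apply NNPP; intros Hne.
  set (m := norm (minus l l')).
  assert (Hm : 0 < m).
  { destruct (Rle_lt_or_eq_dec 0 m (norm_ge_0 _)) as [h | h]; auto.
    exfalso; apply Hne. symmetry in h. apply norm_eq_zero in h.
    apply (plus_reg_r (opp l')). rewrite plus_opp_r. exact h. }
  destruct (H (m / 4)) as [d [Hd Hf]]. lra.
  destruct (H' (m / 4)) as [d' [Hd' Hf']]. lra.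
  set (e := Rmin d d' / 2).
  assert (He : 0 < e /\ e < d /\ e < d').
  { unfold e. assert (0 < Rmin d d') by now apply Rmin_glb_lt.
    pose proof (Rmin_l d d'); pose proof (Rmin_r d d'). lra. }
  specialize (Hf (y + e)). specialize (Hf' (y + e)).
  replace (y + e - y) with e in * by ring.
  rewrite Rabs_pos_eq in * by lra.
  specialize (Hf ltac:(lra) ltac:(lra)). specialize (Hf' ltac:(lra) ltac:(lra)).
  set (D := minus (f (y + e)) (f y)) in *.
  assert (Hs : scal e (minus l l') = minus (minus D (scal e l')) (minus D (scal e l))).
  { eapply eq_trans; [apply (scal_minus_distr_l (V := V))|]. symmetry. apply minus_minus_minus. }
  assert (Hn : e * m <= norm (scal e (minus l l'))).
  { apply (norm_scal_ge (V := V)). lra. }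
  assert (Ht : norm (scal e (minus l l')) <= m / 4 * e + m / 4 * e).
  { rewrite Hs. eapply Rle_trans. apply (norm_minus_le (V := V)). now apply Rplus_le_compat. }
  nra.
Qed.

Lemma is_derive_derive_Rplus {V : CompleteNormedModule R_AbsRing} (f : R -> V)
    (y : R) (hy : 0 <= y) :
  ex_derive_Rplus f y -> is_derive_Rplus f y (derive_Rplus f y).
Proof.
  intros [l Hl]. unfold derive_Rplus.
  apply (iota_correct (is_derive_Rplus f y)).
  exists l. split; auto. intros l' Hl'. now apply (is_derive_Rplus_unique f y).
Qed.

Lemma derive_Rplus_eq {V : CompleteNormedModule R_AbsRing} (f : R -> V)
    (y : R) (l : V) (hy : 0 <= y) :
  is_derive_Rplus f y l -> derive_Rplus f y = l.
Proof.
  intros H. apply (is_derive_Rplus_unique f y); auto.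
  apply is_derive_derive_Rplus; auto. now exists l.
Qed.

Lemma is_derive_Rplus_ext {V : CompleteNormedModule R_AbsRing} (f g : R -> V)
    (y : R) (l : V) (hy : 0 <= y) (h : forall z, 0 <= z -> f z = g z) :
  is_derive_Rplus f y l -> is_derive_Rplus g y l.
Proof.
  intros H. rewrite is_derive_Rplus_iff in * by assumption.
  intros eps Heps. destruct (H eps Heps) as [d [Hd H']]. exists d; split; auto.
  intros z Hz Hzd. rewrite <- !h by assumption. now apply H'.
Qed.

Notation Cderive := (@derive_Rplus CR).
Notation Cex_derive := (@ex_derive_Rplus CR).

Lemma CDer_derive (f : R -> C) (y : R) (hy : 0 <= y) :
  Cex_derive f y -> CDer f y (Cderive f y).
Proof. now apply (is_derive_derive_Rplus (V := CR)). Qed.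

Lemma CDer_eq (f : R -> C) (y : R) (l : C) (hy : 0 <= y) :
  CDer f y l -> Cderive f y = l.
Proof. now apply (derive_Rplus_eq (V := CR)). Qed.

Lemma CDer_ext (f g : R -> C) (y : R) (l : C) (hy : 0 <= y)
    (h : forall z, 0 <= z -> f z = g z) :
  CDer f y l -> CDer g y l.
Proof. now apply (is_derive_Rplus_ext (V := CR)). Qed.

Lemma Cex_derive_intro (f : R -> C) (y : R) (l : C) : CDer f y l -> Cex_derive f y.
Proof. intros H. now exists l. Qed.

Lemma Cex_derive_ext (f g : R -> C) (y : R) (hy : 0 <= y)
    (h : forall z, 0 <= z -> f z = g z) : Cex_derive f y -> Cex_derive g y.
Proof. intros [l Hl]. exists l. now apply (CDer_ext f g y l hy h). Qed.

Lemma Cderive_ext (f g : R -> C) (y : R) (hy : 0 <= y)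
    (h : forall z, 0 <= z -> f z = g z) : Cex_derive f y -> Cderive f y = Cderive g y.
Proof.
  intros H. symmetry. apply CDer_eq; auto. apply (CDer_ext f g); auto. now apply CDer_derive.
Qed.

Lemma CDer_const (a : C) (y : R) (hy : 0 <= y) : CDer (fun _ => a) y (RtoC 0).
Proof.
  apply CDer_iff; auto. intros eps Heps. exists 1. split. lra. intros z _ _.
  replace (a - a - RtoC (z - y) * RtoC 0)%C with (RtoC 0) by ring.
  rewrite Cmod_0. apply Rmult_le_pos. lra. apply Rabs_pos.
Qed.

Lemma CDer_plus (f g : R -> C) (y : R) (l m : C) (hy : 0 <= y) :
  CDer f y l -> CDer g y m -> CDer (fun z => f z + g z)%C y (l + m)%C.
Proof.
  rewrite !CDer_iff by assumption. intros Hf Hg eps Heps.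
  destruct (Hf (eps / 2)) as [d [Hd Hf']]. lra.
  destruct (Hg (eps / 2)) as [e [He Hg']]. lra.
  exists (Rmin d e). split. now apply Rmin_glb_lt.
  intros z Hz Hzd.
  specialize (Hf' z Hz (Rlt_le_trans _ _ _ Hzd (Rmin_l _ _))).
  specialize (Hg' z Hz (Rlt_le_trans _ _ _ Hzd (Rmin_r _ _))).
  replace (f z + g z - (f y + g y) - RtoC (z - y) * (l + m))%C with
    ((f z - f y - RtoC (z - y) * l) + (g z - g y - RtoC (z - y) * m))%C by ring.
  eapply Rle_trans. apply Cmod_triangle. lra.
Qed.

Lemma CDer_lipschitz (f : R -> C) (y : R) (l : C) (hy : 0 <= y) :
  CDer f y l -> exists d, 0 < d /\ forall z, 0 <= z -> Rabs (z - y) < d ->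
    Cmod (f z - f y) <= (1 + Cmod l) * Rabs (z - y).
Proof.
  rewrite CDer_iff by assumption. intros Hf.
  destruct (Hf 1 Rlt_0_1) as [d [Hd H]]. exists d; split; auto. intros z Hz Hzd.
  specialize (H z Hz Hzd).
  replace (f z - f y)%C with ((f z - f y - RtoC (z - y) * l) + RtoC (z - y) * l)%C by ring.
  eapply Rle_trans. apply Cmod_triangle. rewrite Cmod_mult, Cmod_R. lra.
Qed.

Lemma CDer_mult (f g : R -> C) (y : R) (l m : C) (hy : 0 <= y) :
  CDer f y l -> CDer g y m -> CDer (fun z => f z * g z)%C y (l * g y + f y * m)%C.
Proof.
  intros Df Dg.
  destruct (CDer_lipschitz g y m hy Dg) as [d0 [Hd0 Hg0]].
  revert Df Dg.
  rewrite !CDer_iff by assumption. intros Hf Hg eps Heps.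
  assert (P1 := Cmod_ge_0 l). assert (P2 := Cmod_ge_0 m).
  assert (P3 := Cmod_ge_0 (f y)). assert (P4 := Cmod_ge_0 (g y)).
  (* [A] bounds [Cmod (g z)] once [Rabs (z - y) < 1], and [B] dominates the coefficient of the
     quadratic remainder [l * (z - y) * (g z - g y)]. Each of the three terms of the decomposition
     below receives [eps / 3]. *)
  set (A := Cmod (g y) + 1 + Cmod m).
  set (B := 1 + Cmod l * (1 + Cmod m)).
  assert (HB : 1 <= B). { unfold B. nra. }
  destruct (Hf (eps / 3 / A)) as [d [Hd Hf']].
  { apply Rdiv_lt_0_compat; unfold A; lra. }
  destruct (Hg (eps / 3 / (1 + Cmod (f y)))) as [e [He Hg']].
  { apply Rdiv_lt_0_compat; lra. }
  assert (Hq : 0 < eps / 3 / B). { apply Rdiv_lt_0_compat; lra. }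
  exists (Rmin (Rmin d e) (Rmin d0 (Rmin 1 (eps / 3 / B)))).
  split. { repeat apply Rmin_glb_lt; lra. }
  intros z Hz Hzd.
  assert (K1 : Rabs (z - y) < d) by (eapply Rlt_le_trans; [exact Hzd|]; eapply Rle_trans; [apply Rmin_l|apply Rmin_l]).
  assert (K2 : Rabs (z - y) < e) by (eapply Rlt_le_trans; [exact Hzd|]; eapply Rle_trans; [apply Rmin_l|apply Rmin_r]).
  assert (K3' : Rabs (z - y) < Rmin d0 (Rmin 1 (eps / 3 / B))) by (eapply Rlt_le_trans; [exact Hzd| apply Rmin_r]).
  assert (K3 : Rabs (z - y) < d0) by (eapply Rlt_le_trans; [exact K3'| apply Rmin_l]).
  assert (K4' : Rabs (z - y) < Rmin 1 (eps / 3 / B)) by (eapply Rlt_le_trans; [exact K3'| apply Rmin_r]).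
  assert (K4 : Rabs (z - y) < 1) by (eapply Rlt_le_trans; [exact K4'| apply Rmin_l]).
  assert (K5 : Rabs (z - y) < eps / 3 / B) by (eapply Rlt_le_trans; [exact K4'| apply Rmin_r]).
  specialize (Hf' z Hz K1). specialize (Hg' z Hz K2). specialize (Hg0 z Hz K3).
  set (h := Rabs (z - y)) in *. assert (Hh : 0 <= h) by apply Rabs_pos.
  replace (f z * g z - f y * g y - RtoC (z - y) * (l * g y + f y * m))%C with
    ((f z - f y - RtoC (z - y) * l) * g z + RtoC (z - y) * l * (g z - g y)
     + f y * (g z - g y - RtoC (z - y) * m))%C by ring.
  eapply Rle_trans. apply Cmod_triangle.
  eapply Rle_trans. apply Rplus_le_compat_r. apply Cmod_triangle.
  rewrite !Cmod_mult, Cmod_R. fold h.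
  assert (Hgz : Cmod (g z) <= A).
  { replace (g z) with (g y + (g z - g y))%C by ring.
    eapply Rle_trans. apply Cmod_triangle. unfold A. nra. }
  assert (T1 : Cmod (f z - f y - RtoC (z - y) * l) * Cmod (g z) <= eps / 3 * h).
  { apply Rle_trans with ((eps / 3 / A * h) * A).
    - apply Rmult_le_compat; auto using Cmod_ge_0.
    - right. field. unfold A; lra. }
  assert (T3 : Cmod (f y) * Cmod (g z - g y - RtoC (z - y) * m) <= eps / 3 * h).
  { apply Rle_trans with ((1 + Cmod (f y)) * (eps / 3 / (1 + Cmod (f y)) * h)).
    - apply Rmult_le_compat; auto using Cmod_ge_0; lra.
    - right. field. lra. }
  assert (T2 : h * Cmod l * Cmod (g z - g y) <= eps / 3 * h).
  { apply Rle_trans with (h * Cmod l * ((1 + Cmod m) * (eps / 3 / B))).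
    - apply Rmult_le_compat_l. now apply Rmult_le_pos.
      eapply Rle_trans. apply Hg0. apply Rmult_le_compat_l; lra.
    - apply Rle_trans with (h * (B * (eps / 3 / B))).
      + rewrite Rmult_assoc. apply Rmult_le_compat_l; auto.
        rewrite <- Rmult_assoc. apply Rmult_le_compat_r. lra. unfold B. lra.
      + right. field. lra. }
  lra.
Qed.

Lemma CDer_scal (a : C) (f : R -> C) (y : R) (l : C) (hy : 0 <= y) :
  CDer f y l -> CDer (fun z => a * f z)%C y (a * l)%C.
Proof.
  intros H. replace (a * l)%C with (RtoC 0 * f y + a * l)%C by ring.
  apply (CDer_mult (fun _ => a) f); auto. now apply CDer_const.
Qed.

Lemma CDer_minus (f g : R -> C) (y : R) (l m : C) (hy : 0 <= y) :
  CDer f y l -> CDer g y m -> CDer (fun z => f z - g z)%C y (l - m)%C.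
Proof.
  intros Hf Hg. replace (l - m)%C with (l + - (1) * m)%C by ring.
  apply (CDer_ext (fun z => f z + - (1) * g z)%C); auto.
  - intros; ring.
  - apply CDer_plus; auto. now apply CDer_scal.
Qed.

Lemma CDer_RtoC (f : R -> R) (y l : R) (hy : 0 <= y) :
  @is_derive_Rplus R_CompleteNormedModule f y l ->
  CDer (fun z => RtoC (f z)) y (RtoC l).
Proof.
  rewrite CDer_iff by assumption.
  rewrite (is_derive_Rplus_iff (V := R_CompleteNormedModule) f y l hy).
  intros H eps Heps. destruct (H eps Heps) as [d [Hd H']]. exists d; split; auto.
  intros z Hz Hzd. specialize (H' z Hz Hzd).
  rewrite <- !RtoC_minus, <- RtoC_mult, <- RtoC_minus, Cmod_R. exact H'.
Qed.

Lemma near_Rplus_proper (y : R) (hy : 0 <= y) : ProperFilter (near_Rplus y).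
Proof.
  split; [|apply within_filter, locally_filter].
  intros P HP. exists y. apply locally_singleton in HP. now apply HP.
Qed.

Lemma CDer_RtoC_is_derive (f : R -> R) (y l : R) (hy : 0 <= y) :
  is_derive f y l -> CDer (fun z => RtoC (f z)) y (RtoC l).
Proof.
  intros H. apply CDer_RtoC; auto.
  refine (filterdiff_locally (FF := near_Rplus_proper y hy) _ y _ _ H).
  intros P HP. unfold near_Rplus, within. apply (filter_imp P); auto.
Qed.

Lemma CDer_inv (f : R -> C) (y : R) (l : C) (hy : 0 <= y) (hf : f y <> RtoC 0) :
  CDer f y l -> CDer (fun z => / f z)%C y (- l * (/ f y * / f y))%C.
Proof.
  intros Df.
  destruct (CDer_lipschitz f y l hy Df) as [d0 [Hd0 Hf0]].
  revert Df. rewrite !CDer_iff by assumption. intros Hf eps Heps.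
  assert (P1 := Cmod_ge_0 l).
  set (F := Cmod (f y)) in *. assert (HF : 0 < F) by now apply Cmod_gt_0.
  (* Close to [y] the modulus of [f] stays above [m], so [M] bounds the product of the three
     inverses that the common denominator produces. *)
  set (m := F / 2). assert (hm : 0 < m) by (unfold m; lra).
  assert (hmy : m <= Cmod (f y)) by (fold F; unfold m; lra).
  set (M := / m * / m * / m).
  assert (HM : 0 < M). { unfold M. assert (0 < / m) by now apply Rinv_0_lt_compat. repeat apply Rmult_lt_0_compat; auto. }
  destruct (Hf (eps / 2 / (M * F))) as [d [Hd Hf']].
  { apply Rdiv_lt_0_compat; nra. }
  set (B := M * (1 + Cmod l) * (1 + Cmod l)).
  assert (HB : 0 < B) by (unfold B; apply Rmult_lt_0_compat; [apply Rmult_lt_0_compat|]; lra).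
  exists (Rmin d (Rmin d0 (Rmin (m / (1 + Cmod l)) (eps / 2 / B)))).
  split. { repeat apply Rmin_glb_lt; auto; apply Rdiv_lt_0_compat; lra. }
  intros z Hz Hzd.
  assert (K1 : Rabs (z - y) < d) by (eapply Rlt_le_trans; [exact Hzd| apply Rmin_l]).
  assert (K' : Rabs (z - y) < Rmin d0 (Rmin (m / (1 + Cmod l)) (eps / 2 / B))) by (eapply Rlt_le_trans; [exact Hzd| apply Rmin_r]).
  assert (K2 : Rabs (z - y) < d0) by (eapply Rlt_le_trans; [exact K'| apply Rmin_l]).
  assert (K3' : Rabs (z - y) < Rmin (m / (1 + Cmod l)) (eps / 2 / B)) by (eapply Rlt_le_trans; [exact K'| apply Rmin_r]).
  assert (K3 : Rabs (z - y) < eps / 2 / B) by (eapply Rlt_le_trans; [exact K3'| apply Rmin_r]).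
  assert (K4 : Rabs (z - y) < m / (1 + Cmod l)) by (eapply Rlt_le_trans; [exact K3'| apply Rmin_l]).
  specialize (Hf' z Hz K1). specialize (Hf0 z Hz K2).
  set (h := Rabs (z - y)) in *. assert (Hh : 0 <= h) by apply Rabs_pos.
  assert (hmz : m <= Cmod (f z)).
  { assert (T := Cmod_triangle (f z) (- (f z - f y))).
    replace (f z + - (f z - f y))%C with (f y) in T by ring.
    rewrite Cmod_opp in T. fold F in T.
    assert ((1 + Cmod l) * h <= m).
    { apply Rle_trans with ((1 + Cmod l) * (m / (1 + Cmod l))).
      - apply Rmult_le_compat_l; lra.
      - right. field. lra. }
    unfold m in *. lra. }
  assert (hz0 : f z <> RtoC 0). { intros E. rewrite E, Cmod_0 in hmz. lra. }
  replace (/ f z - / f y - RtoC (z - y) * (- l * (/ f y * / f y)))%C with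
    ((- (f z - f y - RtoC (z - y) * l) * f y + RtoC (z - y) * l * (f z - f y))
       * (/ f z * / f y * / f y))%C by (field; split; auto).
  rewrite Cmod_mult.
  assert (HI : Cmod (/ f z * / f y * / f y) <= M).
  { rewrite !Cmod_mult, !Cmod_inv by auto. unfold M.
    assert (Hi : forall t, m <= t -> 0 <= / t <= / m).
    { intros t Ht. split. left; apply Rinv_0_lt_compat; lra.
      now apply Rinv_le_contravar. }
    destruct (Hi _ hmz), (Hi _ hmy). repeat apply Rmult_le_compat; auto.
    now apply Rmult_le_pos. }
  assert (HS : Cmod (- (f z - f y - RtoC (z - y) * l) * f y + RtoC (z - y) * l * (f z - f y))
    <= eps / 2 / (M * F) * h * F + h * (1 + Cmod l) * ((1 + Cmod l) * (eps / 2 / B))).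
  { eapply Rle_trans. apply Cmod_triangle. rewrite !Cmod_mult, Cmod_opp, Cmod_R. fold h F.
    apply Rplus_le_compat.
    - apply Rmult_le_compat_r; lra.
    - apply Rmult_le_compat; auto using Cmod_ge_0.
      + now apply Rmult_le_pos.
      + apply Rmult_le_compat_l; lra.
      + eapply Rle_trans. apply Hf0. apply Rmult_le_compat_l; lra. }
  eapply Rle_trans. apply Rmult_le_compat; [apply Cmod_ge_0|apply Cmod_ge_0|exact HS|exact HI].
  right. unfold B. field. repeat split; lra.
Qed.

Lemma dyC_S (n : nat) (f : R -> C) : dyC (S n) f = dyC n (Cderive f).
Proof. unfold derive_Rplus_n. now rewrite Nat.iter_succ_r. Qed.

(* Otherwise unification unfolds iterated derivatives down to [iota]. *)
Opaque derive_Rplus.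

(** * Exponentially weighted families of smooth functions *)

(** Differentiability and bounds are bundled along the recursion, so that closure under products,
    inverses and ODEs follows by induction on [n] from one differentiation rule each. The constant
    precedes [nu]; the range [0 < nu <= 1] keeps powers of [nu] bounded. *)
Fixpoint bounded_upto (n : nat) (eta : R) (F : R -> R -> C) : Prop :=
  (exists K, 0 < K /\ forall nu y, 0 < nu <= 1 -> 0 <= y ->
     Cmod (F nu y) <= K * exp (eta * y)) /\
  match n with
  | O => True
  | S m => (forall nu y, 0 < nu <= 1 -> 0 <= y -> Cex_derive (F nu) y) /\
           bounded_upto m eta (fun nu => Cderive (F nu))
  end.

Definition bounded_family (eta : R) (F : R -> R -> C) : Prop :=
  forall n, bounded_upto n eta F.

Lemma bounded_upto_bound n eta F : bounded_upto n eta F ->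
  exists K, 0 < K /\ forall nu y, 0 < nu <= 1 -> 0 <= y ->
     Cmod (F nu y) <= K * exp (eta * y).
Proof. destruct n; intros H; apply H. Qed.

Lemma bounded_upto_S n : forall eta F, bounded_upto (S n) eta F -> bounded_upto n eta F.
Proof.
  induction n; intros eta F H.
  - split. apply (bounded_upto_bound _ _ _ H). exact I.
  - destruct H as [Hb [Hd H]]. split; auto.
Qed.

Lemma bounded_upto_ext n : forall eta F G,
  (forall nu y, 0 < nu <= 1 -> 0 <= y -> F nu y = G nu y) ->
  bounded_upto n eta F -> bounded_upto n eta G.
Proof.
  induction n; intros eta F G HFG H; destruct H as [[K [HK Hb]] H]; (split; [|]).
  1, 3: exists K; split; auto; intros; rewrite <- HFG by assumption; auto.
  - exact I.
  - destruct H as [Hd H]. split.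
    + intros nu y Hnu Hy. apply (Cex_derive_ext (F nu)); auto.
    + apply (IHn _ (fun nu => Cderive (F nu))); auto.
      intros nu y Hnu Hy. apply Cderive_ext; auto.
Qed.

Lemma bounded_upto_weaken n : forall eta eta' F, eta <= eta' ->
  bounded_upto n eta F -> bounded_upto n eta' F.
Proof.
  assert (E : forall eta eta' y, eta <= eta' -> 0 <= y -> exp (eta * y) <= exp (eta' * y)).
  { intros eta eta' y H Hy. destruct (Rle_lt_or_eq_dec (eta * y) (eta' * y)) as [h | h].
    - now apply Rmult_le_compat_r.
    - left. now apply exp_increasing.
    - rewrite h; lra. }
  induction n; intros eta eta' F He H; destruct H as [[K [HK Hb]] H]; split.
  1, 3: exists K; split; auto; intros nu y Hnu Hy; eapply Rle_trans; [now apply Hb|];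
    apply Rmult_le_compat_l; [lra|now apply E].
  - exact I.
  - destruct H as [Hd H]. split; auto. now apply (IHn eta).
Qed.

Lemma bounded_upto_plus n : forall eta F G,
  bounded_upto n eta F -> bounded_upto n eta G ->
  bounded_upto n eta (fun nu y => F nu y + G nu y)%C.
Proof.
  induction n; intros eta F G HF HG;
    destruct HF as [[K [HK Fb]] HF]; destruct HG as [[L [HL Gb]] HG]; split.
  1, 3: exists (K + L); split; [lra|]; intros nu y Hnu Hy; eapply Rle_trans;
    [apply Cmod_triangle|]; rewrite Rmult_plus_distr_r; apply Rplus_le_compat; auto.
  - exact I.
  - destruct HF as [Fd HF]; destruct HG as [Gd HG].
    assert (HD : forall nu y, 0 < nu <= 1 -> 0 <= y ->
      CDer (fun z => F nu z + G nu z)%C y (Cderive (F nu) y + Cderive (G nu) y)%C).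
    { intros nu y Hnu Hy. apply CDer_plus; auto using CDer_derive. }
    split.
    + intros nu y Hnu Hy. eapply Cex_derive_intro. now apply HD.
    + apply (bounded_upto_ext _ _ (fun nu y => Cderive (F nu) y + Cderive (G nu) y)%C).
      * intros nu y Hnu Hy. symmetry. apply CDer_eq; auto.
      * now apply (IHn _ (fun nu => Cderive (F nu))).
Qed.

(** A single use of the product rule under induction replaces Leibniz' formula. In each of the two
    resulting products the undifferentiated factor is known to order [S n], hence to order [n]. *)
Lemma bounded_upto_mult n : forall eta eta' F G,
  bounded_upto n eta F -> bounded_upto n eta' G ->
  bounded_upto n (eta + eta') (fun nu y => F nu y * G nu y)%C.
Proof.
  induction n; intros eta eta' F G HF HG.
  - destruct HF as [[K [HK Fb]] HF]; destruct HG as [[L [HL Gb]] HG]; split; [|exact I].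
    exists (K * L); split; [nra|]; intros nu y Hnu Hy.
    rewrite Cmod_mult, Rmult_plus_distr_r, exp_plus.
    replace (K * L * (exp (eta * y) * exp (eta' * y))) with
      ((K * exp (eta * y)) * (L * exp (eta' * y))) by ring.
    apply Rmult_le_compat; auto using Cmod_ge_0.
  - assert (HF' := bounded_upto_S _ _ _ HF). assert (HG' := bounded_upto_S _ _ _ HG).
    split. { apply (bounded_upto_bound n). now apply IHn. }
    destruct HF as [_ [Fd HF]]; destruct HG as [_ [Gd HG]].
    assert (HD : forall nu y, 0 < nu <= 1 -> 0 <= y ->
      CDer (fun z => F nu z * G nu z)%C y
        (Cderive (F nu) y * G nu y + F nu y * Cderive (G nu) y)%C).
    { intros nu y Hnu Hy. apply CDer_mult; auto using CDer_derive. }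
    split.
    + intros nu y Hnu Hy. eapply Cex_derive_intro. now apply HD.
    + apply (bounded_upto_ext _ _
        (fun nu y => Cderive (F nu) y * G nu y + F nu y * Cderive (G nu) y)%C).
      * intros nu y Hnu Hy. symmetry. apply CDer_eq; auto.
      * apply (bounded_upto_plus _ _ (fun nu y => Cderive (F nu) y * G nu y)%C
                 (fun nu y => F nu y * Cderive (G nu) y)%C).
        -- now apply (IHn _ _ (fun nu => Cderive (F nu))).
        -- now apply (IHn _ _ F (fun nu => Cderive (G nu))).
Qed.

Lemma family_bound eta F : bounded_family eta F ->
  exists K, 0 < K /\ forall nu y, 0 < nu <= 1 -> 0 <= y ->
     Cmod (F nu y) <= K * exp (eta * y).
Proof. intros H. exact (bounded_upto_bound 0 _ _ (H 0%nat)). Qed.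

Lemma family_ex_derive eta F nu y : bounded_family eta F -> 0 < nu <= 1 -> 0 <= y ->
  Cex_derive (F nu) y.
Proof. intros H Hnu Hy. destruct (H 1%nat) as [_ [Hd _]]. auto. Qed.

Lemma family_CDer eta F nu y : bounded_family eta F -> 0 < nu <= 1 -> 0 <= y ->
  CDer (F nu) y (Cderive (F nu) y).
Proof. intros H Hnu Hy. apply CDer_derive; auto. now apply (family_ex_derive eta F). Qed.

Lemma family_derive eta F : bounded_family eta F ->
  bounded_family eta (fun nu => Cderive (F nu)).
Proof. intros H n. apply (H (S n)). Qed.

Lemma family_intro eta F F' :
  (exists K, 0 < K /\ forall nu y, 0 < nu <= 1 -> 0 <= y ->
     Cmod (F nu y) <= K * exp (eta * y)) ->
  (forall nu y, 0 < nu <= 1 -> 0 <= y -> CDer (F nu) y (F' nu y)) ->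
  bounded_family eta F' -> bounded_family eta F.
Proof.
  intros Hb Hd H [|n]; (split; [exact Hb|]).
  - exact I.
  - split.
    + intros nu y Hnu Hy. eapply Cex_derive_intro. now apply Hd.
    + apply (bounded_upto_ext _ _ F'); auto.
      intros nu y Hnu Hy. symmetry. apply CDer_eq; auto.
Qed.

Lemma family_ext eta F G :
  (forall nu y, 0 < nu <= 1 -> 0 <= y -> F nu y = G nu y) ->
  bounded_family eta F -> bounded_family eta G.
Proof. intros HE H n. now apply (bounded_upto_ext n eta F). Qed.

Lemma family_weaken eta eta' F : eta <= eta' ->
  bounded_family eta F -> bounded_family eta' F.
Proof. intros HE H n. now apply (bounded_upto_weaken n eta). Qed.

Lemma family_plus eta F G : bounded_family eta F -> bounded_family eta G ->
  bounded_family eta (fun nu y => F nu y + G nu y)%C.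
Proof. intros HF HG n. now apply bounded_upto_plus. Qed.

Lemma family_mult eta eta' F G : bounded_family eta F -> bounded_family eta' G ->
  bounded_family (eta + eta') (fun nu y => F nu y * G nu y)%C.
Proof. intros HF HG n. now apply bounded_upto_mult. Qed.

Lemma family_zero eta : bounded_family eta (fun _ _ => RtoC 0).
Proof.
  intros n; revert eta. induction n; intros eta; (split;
    [exists 1; split; [lra|]; intros; rewrite Cmod_0; assert (H1 := exp_pos (eta * y)); lra|]).
  - exact I.
  - split.
    + intros nu y _ Hy. eapply Cex_derive_intro. now apply CDer_const.
    + apply (bounded_upto_ext n eta (fun _ _ => RtoC 0)); auto.
      intros nu y _ Hy. symmetry. apply CDer_eq; auto. now apply CDer_const.
Qed.

Lemma family_const (a : R -> C) (A : R) :
  (forall nu, 0 < nu <= 1 -> Cmod (a nu) <= A) -> bounded_family 0 (fun nu _ => a nu).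
Proof.
  intros Ha. apply (family_intro _ _ (fun _ _ => RtoC 0)).
  - exists (Rabs A + 1). split. { assert (H := Rabs_pos A); lra. }
    intros nu y Hnu _. rewrite Rmult_0_l, exp_0.
    specialize (Ha nu Hnu). assert (H := Rle_abs A). lra.
  - intros nu y _ Hy. now apply CDer_const.
  - apply family_zero.
Qed.

Lemma family_scal eta F (a : R -> C) (A : R) :
  (forall nu, 0 < nu <= 1 -> Cmod (a nu) <= A) -> bounded_family eta F ->
  bounded_family eta (fun nu y => a nu * F nu y)%C.
Proof.
  intros Ha HF. rewrite <- (Rplus_0_l eta).
  apply (family_mult 0 eta (fun nu _ => a nu)); auto. now apply (family_const a A).
Qed.

Lemma family_scal_const eta F (a : C) : bounded_family eta F ->
  bounded_family eta (fun nu y => a * F nu y)%C.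
Proof. intros HF. apply (family_scal eta F (fun _ => a) (Cmod a)); auto. intros; lra. Qed.

Lemma family_minus eta F G : bounded_family eta F -> bounded_family eta G ->
  bounded_family eta (fun nu y => F nu y - G nu y)%C.
Proof.
  intros HF HG. apply (family_ext _ (fun nu y => F nu y + - (1) * G nu y)%C).
  - intros; ring.
  - apply family_plus; auto. now apply family_scal_const.
Qed.

Lemma CDer_exp (k y : R) (hy : 0 <= y) :
  CDer (fun z => RtoC (exp (k * z))) y (RtoC k * RtoC (exp (k * y)))%C.
Proof.
  rewrite <- RtoC_mult. apply (CDer_RtoC_is_derive (fun z => exp (k * z))); auto.
  auto_derive; auto. ring.
Qed.

Lemma family_exp (k : R) : bounded_family k (fun _ y => RtoC (exp (k * y))).
Proof.
  assert (Hb : exists K, 0 < K /\ forall nu y : R, 0 < nu <= 1 -> 0 <= y ->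
     Cmod (RtoC (exp (k * y))) <= K * exp (k * y)).
  { exists 1. split. lra. intros nu y _ _. rewrite Cmod_R, Rabs_pos_eq. lra.
    left; apply exp_pos. }
  intros n. induction n; (split; [exact Hb|]).
  - exact I.
  - split.
    + intros nu y _ Hy. eapply Cex_derive_intro. now apply CDer_exp.
    + apply (bounded_upto_ext n k (fun _ y => RtoC k * RtoC (exp (k * y)))%C).
      * intros nu y _ Hy. symmetry. apply CDer_eq; auto. now apply CDer_exp.
      * rewrite <- (Rplus_0_l k) at 1.
        apply (bounded_upto_mult n 0 k (fun _ _ => RtoC k) (fun _ y => RtoC (exp (k * y)))); auto.
        apply (family_const (fun _ => RtoC k) (Cmod k)). intros; lra.
Qed.

(** Rate 1 is a crude majorant of linear growth, by [y <= exp y]. A product of [k] such factors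
    costs rate [k], to be paid back later by a decaying exponential. *)
Lemma family_node (t : R -> R) (T : R) :
  (forall nu, 0 < nu <= 1 -> Rabs (t nu) <= T) ->
  bounded_family 1 (fun nu y => RtoC (y - t nu)).
Proof.
  intros Ht. apply (family_intro _ _ (fun _ _ => RtoC 1)).
  - exists (1 + Rabs T). split. { assert (H := Rabs_pos T); lra. }
    intros nu y Hnu Hy. rewrite Cmod_R, Rmult_1_l.
    specialize (Ht nu Hnu). assert (H := Rle_abs T). assert (H0 := Rabs_pos T).
    assert (Hz : y <= exp y /\ 1 <= exp y).
    { destruct (Req_dec y 0) as [-> | hn]. rewrite exp_0; lra.
      assert (h := exp_ineq1 y hn). lra. }
    unfold Rminus. eapply Rle_trans. apply Rabs_triang.
    rewrite Rabs_Ropp, (Rabs_pos_eq y) by lra. nra.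
  - intros nu y _ Hy. apply (CDer_RtoC_is_derive (fun z => z - t nu)); auto.
    auto_derive; auto.
  - apply (family_weaken 0). lra.
    apply (family_const (fun _ => RtoC 1) 1). intros; rewrite Cmod_1; lra.
Qed.

(** The derivative [- F' / F^2] contains only lower-order information on the inverse, so the
    induction closes. Rate 0 makes the products in this formula stay at rate 0. *)
Lemma family_inv (F : R -> R -> C) (m : R) (hm : 0 < m) :
  (forall nu y, 0 < nu <= 1 -> 0 <= y -> m <= Cmod (F nu y)) ->
  bounded_family 0 F -> bounded_family 0 (fun nu y => / F nu y)%C.
Proof.
  intros Hm HF.
  assert (Hb : exists K, 0 < K /\ forall nu y : R, 0 < nu <= 1 -> 0 <= y ->
     Cmod (/ F nu y) <= K * exp (0 * y)).
  { exists (/ m). split. now apply Rinv_0_lt_compat. intros nu y Hnu Hy.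
    specialize (Hm nu y Hnu Hy).
    rewrite Rmult_0_l, exp_0, Rmult_1_r, Cmod_inv.
    - now apply Rinv_le_contravar.
    - intros E. rewrite E, Cmod_0 in Hm. lra. }
  assert (HD : forall nu y, 0 < nu <= 1 -> 0 <= y ->
    CDer (fun z => / F nu z)%C y (- Cderive (F nu) y * (/ F nu y * / F nu y))%C).
  { intros nu y Hnu Hy. apply CDer_inv; auto.
    - intros E. specialize (Hm nu y Hnu Hy). rewrite E, Cmod_0 in Hm. lra.
    - now apply (family_CDer 0 F). }
  intros n. induction n; (split; [exact Hb|]).
  - exact I.
  - split.
    + intros nu y Hnu Hy. eapply Cex_derive_intro. now apply HD.
    + apply (bounded_upto_ext n 0
        (fun nu y => (- (1) * Cderive (F nu) y) * (/ F nu y * / F nu y))%C).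
      * intros nu y Hnu Hy. symmetry. apply CDer_eq; auto.
        replace (- (1) * Cderive (F nu) y)%C with (- Cderive (F nu) y)%C by ring. auto.
      * replace 0 with (0 + (0 + 0)) by ring.
        apply (bounded_upto_mult n 0 (0 + 0) (fun nu y => - (1) * Cderive (F nu) y)%C
                 (fun nu y => / F nu y * / F nu y)%C).
        -- apply (family_scal_const 0 (fun nu => Cderive (F nu))). now apply family_derive.
        -- now apply (bounded_upto_mult n 0 0 (fun nu y => / F nu y)%C).
Qed.

(** * Iterated derivatives and smoothness of families *)

Lemma family_dyC eta F j : bounded_family eta F -> bounded_family eta (fun nu => dyC j (F nu)).
Proof.
  revert F. induction j; intros F HF; auto.
  apply (family_ext _ (fun nu => dyC j (Cderive (F nu)))).
  - intros. now rewrite dyC_S.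
  - apply (IHj (fun nu => Cderive (F nu))). now apply family_derive.
Qed.

Lemma continuous_Rplus_C (f : R -> C) :
  (forall y, 0 <= y -> Cex_derive f y) -> @continuous_Rplus CR f.
Proof.
  intros H y Hy P [e HP].
  destruct (H y Hy) as [l Hl]. change (CDer f y l) in Hl.
  destruct (CDer_lipschitz f y l Hy Hl) as [d [Hd Hf]].
  assert (Pl := Cmod_ge_0 l).
  apply (near_Rplus_intro _ y (Rmin d (e / (1 + Cmod l)))).
  { apply Rmin_glb_lt; auto. apply Rdiv_lt_0_compat. apply cond_pos. lra. }
  intros z Hz Hzd. apply HP.
  assert (Hb : Cmod (f z - f y) < e).
  { eapply Rle_lt_trans. apply Hf; auto. eapply Rlt_le_trans; [exact Hzd|apply Rmin_l].
    apply Rlt_le_trans with ((1 + Cmod l) * (e / (1 + Cmod l))).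
    - apply Rmult_lt_compat_l. lra. eapply Rlt_le_trans; [exact Hzd|apply Rmin_r].
    - right. field. lra. }
  assert (Hm := Rmax_Cmod (f z - f y)%C).
  split; (eapply Rle_lt_trans; [|exact Hb]; eapply Rle_trans; [|exact Hm]).
  - apply Rmax_l.
  - apply Rmax_r.
Qed.

Lemma smooth_of_ex_derive (f : R -> C) :
  (forall j y, 0 <= y -> Cex_derive (dyC j f) y) -> smoothC f.
Proof.
  intros H n. split.
  - intros j y _ Hy. now apply H.
  - apply continuous_Rplus_C. intros y Hy. now apply H.
Qed.

Lemma family_smooth eta F nu : bounded_family eta F -> 0 < nu <= 1 -> smoothC (F nu).
Proof.
  intros HF Hnu. apply smooth_of_ex_derive. intros j y Hy.
  now apply (family_ex_derive eta (fun nu => dyC j (F nu)) nu y (family_dyC eta F j HF)).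
Qed.

Lemma smooth_ex_derive (f : R -> C) j y : smoothC f -> 0 <= y -> Cex_derive (dyC j f) y.
Proof. intros H Hy. destruct (H (S j)) as [Hd _]. apply Hd; auto. Qed.

Lemma smooth_derive (f : R -> C) : smoothC f -> smoothC (Cderive f).
Proof.
  intros H. apply smooth_of_ex_derive. intros j y Hy. rewrite <- dyC_S.
  now apply smooth_ex_derive.
Qed.

Lemma family_of_smooth eta (f : R -> C) : smoothC f ->
  (forall j, exists K, 0 < K /\ forall y, 0 <= y -> Cmod (dyC j f y) <= K * exp (eta * y)) ->
  bounded_family eta (fun _ => f).
Proof.
  intros Hs Hb n. revert f Hs Hb. induction n; intros f Hs Hb.
  - split; [|exact I]. destruct (Hb 0%nat) as [K [HK H]]. exists K; split; auto.
  - split; [|split].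
    + destruct (Hb 0%nat) as [K [HK H]]. exists K; split; auto.
    + intros _ y _ Hy. now apply (smooth_ex_derive f 0).
    + apply IHn. now apply smooth_derive.
      intros j. destruct (Hb (S j)) as [K [HK H]]. exists K; split; auto.
      intros y Hy. rewrite <- dyC_S. auto.
Qed.

(** * Mean value inequality, compactness and primitives *)

Definition Rplus_continuous_at (h : R -> R) (y : R) : Prop :=
  forall eps, 0 < eps -> exists d, 0 < d /\
    forall z, 0 <= z -> Rabs (z - y) < d -> Rabs (h z - h y) < eps.

(** Projection onto [[a, b]] is 1-Lipschitz, so composing with it turns continuity along the
    half-line into continuity on all of [R], the form in which the extreme value theorems apply. *)
Lemma clamp_continuity (h : R -> R) (a b : R) (hab : 0 <= a <= b)
    (hh : forall y, a <= y <= b -> Rplus_continuous_at h y) (x : R) :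
  continuity_pt (fun x => h (Rmax a (Rmin b x))) x.
Proof.
  apply continuity_pt_locally. intros eps.
  set (y := Rmax a (Rmin b x)).
  assert (Hcl : forall u, a <= Rmax a (Rmin b u) <= b).
  { intros u. split. apply Rmax_l. apply Rmax_lub. lra. apply Rmin_l. }
  destruct (hh y (Hcl x) eps (cond_pos eps)) as [d [Hd H]].
  exists (mkposreal d Hd). intros u Hu. change (Rabs (u - x) < d) in Hu.
  apply H. specialize (Hcl u). lra.
  eapply Rle_lt_trans; [|exact Hu]. unfold y.
  unfold Rmax, Rmin; repeat destruct Rle_dec; unfold Rabs; repeat destruct Rcase_abs; lra.
Qed.

Lemma clamp_id (a b x : R) : a <= x <= b -> Rmax a (Rmin b x) = x.
Proof. intros H. rewrite Rmin_right, Rmax_right; lra. Qed.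

Lemma compact_min (h : R -> R) (a b : R) (hab : 0 <= a <= b)
    (hh : forall y, a <= y <= b -> Rplus_continuous_at h y) :
  exists t, a <= t <= b /\ forall y, a <= y <= b -> h t <= h y.
Proof.
  destruct (continuity_ab_min (fun x => h (Rmax a (Rmin b x))) a b) as [t [Ht Htab]].
  - lra.
  - intros c _. now apply clamp_continuity.
  - exists t; split; auto. intros y Hy. specialize (Ht y Hy).
    now rewrite !clamp_id in Ht by assumption.
Qed.

Lemma compact_max (h : R -> R) (a b : R) (hab : 0 <= a <= b)
    (hh : forall y, a <= y <= b -> Rplus_continuous_at h y) :
  exists M, forall y, a <= y <= b -> h y <= M.
Proof.
  destruct (continuity_ab_maj (fun x => h (Rmax a (Rmin b x))) a b) as [t [Ht Htab]].
  - lra.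
  - intros c _. now apply clamp_continuity.
  - exists (h (Rmax a (Rmin b t))). intros y Hy. specialize (Ht y Hy).
    now rewrite (clamp_id a b y Hy) in Ht.
Qed.

Lemma Rplus_continuous_at_Cmod (f : R -> C) (y : R) (hy : 0 <= y) :
  Cex_derive f y -> Rplus_continuous_at (fun z => Cmod (f z)) y.
Proof.
  intros [l Hl] eps Heps. change (CDer f y l) in Hl.
  destruct (CDer_lipschitz f y l hy Hl) as [d [Hd Hf]].
  assert (Pl := Cmod_ge_0 l).
  exists (Rmin d (eps / (1 + Cmod l))). split.
  { apply Rmin_glb_lt; auto. apply Rdiv_lt_0_compat; lra. }
  intros z Hz Hzd.
  eapply Rle_lt_trans.
  { assert (T1 := Cmod_triangle (f z - f y) (f y)).
    assert (T2 := Cmod_triangle (f y - f z) (f z)).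
    replace (f z - f y + f y)%C with (f z) in T1 by ring.
    replace (f y - f z + f z)%C with (f y) in T2 by ring.
    replace (f y - f z)%C with (- (f z - f y))%C in T2 by ring.
    rewrite Cmod_opp in T2.
    apply (Rabs_le _ (Cmod (f z - f y))). lra. }
  eapply Rle_lt_trans. apply Hf; auto. eapply Rlt_le_trans; [exact Hzd|apply Rmin_l].
  apply Rlt_le_trans with ((1 + Cmod l) * (eps / (1 + Cmod l))).
  - apply Rmult_lt_compat_l. lra. eapply Rlt_le_trans; [exact Hzd|apply Rmin_r].
  - right. field. lra.
Qed.

Lemma Rabs_Re_le_Cmod (z : C) : Rabs (Re z) <= Cmod z.
Proof. eapply Rle_trans; [|apply Rmax_Cmod]. apply Rmax_l. Qed.

(* Test the increment against its own direction to reduce to a real function. *)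
Lemma CDer_mean_value (f f' : R -> C) (k k' : R -> R) (a b : R) (hab : 0 <= a <= b)
    (hf : forall y, a <= y <= b -> CDer f y (f' y))
    (hk : forall y, is_derive k y (k' y))
    (hle : forall y, a <= y <= b -> Cmod (f' y) <= k' y) :
  Cmod (f b - f a) <= k b - k a.
Proof.
  set (D := (f b - f a)%C).
  set (h := fun z => Re (Cconj D * f z) - Cmod D * k z).
  set (h' := fun z => Re (Cconj D * f' z) - Cmod D * k' z).
  assert (P := Cmod_ge_0 D).
  assert (Hh : forall y, a <= y <= b -> forall eps, 0 < eps -> exists d, 0 < d /\
    forall z, 0 <= z -> Rabs (z - y) < d ->
      Rabs (h z - h y - (z - y) * h' y) <= eps * Rabs (z - y)).
  { intros y Hy eps Heps.
    assert (H1 : CDer (fun z => Cconj D * f z - RtoC (Cmod D) * RtoC (k z))%C y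
                   (Cconj D * f' y - RtoC (Cmod D) * RtoC (k' y))%C).
    { apply CDer_minus; try lra; apply CDer_scal; try lra. auto.
      apply CDer_RtoC_is_derive; auto; lra. }
    rewrite CDer_iff in H1 by lra. destruct (H1 eps Heps) as [d [Hd H2]].
    exists d; split; auto. intros z Hz Hzd. specialize (H2 z Hz Hzd).
    eapply Rle_trans; [|exact H2]. eapply Rle_trans; [|apply Rabs_Re_le_Cmod].
    right. f_equal. unfold h, h', Re; simpl. ring. }
  assert (Hmono : h b <= h a).
  { destruct (MVT_gen (fun x => h (Rmax a (Rmin b x))) a b h') as [c [Hc E]].
    - rewrite Rmin_left, Rmax_right by lra. intros x Hx.
      apply is_derive_Reals. intros eps Heps.
      destruct (Hh x ltac:(lra) (eps / 2) ltac:(lra)) as [d [Hd H]].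
      assert (He : 0 < Rmin d (Rmin (x - a) (b - x))) by (repeat apply Rmin_glb_lt; lra).
      exists (mkposreal _ He). intros e He0 Hed. simpl in Hed.
      assert (E1 : Rabs e < d) by (eapply Rlt_le_trans; [exact Hed|apply Rmin_l]).
      assert (E2 : Rabs e < Rmin (x - a) (b - x)) by (eapply Rlt_le_trans; [exact Hed|apply Rmin_r]).
      assert (E3 : Rabs e < x - a) by (eapply Rlt_le_trans; [exact E2|apply Rmin_l]).
      assert (E4 : Rabs e < b - x) by (eapply Rlt_le_trans; [exact E2|apply Rmin_r]).
      assert (Hr : - Rabs e <= e <= Rabs e) by (split; [assert (hh := Rle_abs (- e)); rewrite Rabs_Ropp in hh; lra|apply Rle_abs]).
      rewrite !clamp_id by lra.
      specialize (H (x + e) ltac:(lra)). replace (x + e - x) with e in H by ring.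
      specialize (H E1).
      replace ((h (x + e) - h x) / e - h' x) with ((h (x + e) - h x - e * h' x) / e) by (field; auto).
      unfold Rdiv. rewrite Rabs_mult, Rabs_inv.
      assert (Hp : 0 < Rabs e) by now apply Rabs_pos_lt.
      apply Rle_lt_trans with (eps / 2 * Rabs e * / Rabs e).
      + apply Rmult_le_compat_r; auto. left; now apply Rinv_0_lt_compat.
      + rewrite Rmult_assoc, Rinv_r by lra. lra.
    - intros x _. apply clamp_continuity; auto.
      intros y Hy eps Heps. destruct (Hh y Hy 1 Rlt_0_1) as [d [Hd H]].
      assert (P' := Rabs_pos (h' y)).
      exists (Rmin d (eps / (2 + Rabs (h' y)))). split.
      { apply Rmin_glb_lt; auto. apply Rdiv_lt_0_compat; lra. }
      intros z Hz Hzd.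
      specialize (H z Hz (Rlt_le_trans _ _ _ Hzd (Rmin_l _ _))).
      assert (Hzd' := Rlt_le_trans _ _ _ Hzd (Rmin_r _ _)).
      replace (h z - h y) with ((h z - h y - (z - y) * h' y) + (z - y) * h' y) by ring.
      eapply Rle_lt_trans. apply Rabs_triang. rewrite Rabs_mult.
      apply Rle_lt_trans with ((2 + Rabs (h' y)) * Rabs (z - y)).
      { assert (Hq := Rabs_pos (z - y)). lra. }
      apply Rlt_le_trans with ((2 + Rabs (h' y)) * (eps / (2 + Rabs (h' y)))).
      + apply Rmult_lt_compat_l; lra.
      + right. field. lra.
    - rewrite Rmin_left, Rmax_right in Hc by lra.
      rewrite !clamp_id in E by lra.
      assert (Hc' : h' c <= 0).
      { unfold h'. assert (Q := Rle_trans _ _ _ (Rle_abs _) (Rabs_Re_le_Cmod (Cconj D * f' c))).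
        rewrite Cmod_mult, Cmod_conj in Q.
        assert (Q' := Rmult_le_compat_l (Cmod D) _ _ P (hle c Hc)). lra. }
      nra. }
  assert (E : Re (Cconj D * f b) - Re (Cconj D * f a) = Cmod D * Cmod D).
  { transitivity (Re (Cconj D * D)).
    - unfold D, Re, Cconj; simpl. ring.
    - rewrite Cmult_comm, <- Cmod2_conj. simpl; ring. }
  destruct (Req_dec (Cmod D) 0) as [E0 | E0].
  (* With zero increment there is no direction to test against; what remains is [k a <= k b], and
     [k] is nondecreasing because [k'] dominates a modulus. *)
  - rewrite E0.
    destruct (MVT_gen k a b k') as [c [Hc Ek]].
    + intros; auto.
    + intros x _. apply continuity_pt_filterlim. apply (ex_derive_continuous k). now exists (k' x).
    + rewrite Rmin_left, Rmax_right in Hc by lra. rewrite Ek.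
      apply Rmult_le_pos; [|lra]. eapply Rle_trans; [apply Cmod_ge_0|apply hle; lra].
  - unfold h in Hmono. nra.
Qed.

Lemma CDer_lipschitz_on (f f' : R -> C) (K a b : R) (ha : 0 <= a) (hb : 0 <= b)
    (hf : forall y, Rmin a b <= y <= Rmax a b -> CDer f y (f' y))
    (hK : forall y, Rmin a b <= y <= Rmax a b -> Cmod (f' y) <= K) :
  Cmod (f b - f a) <= K * Rabs (b - a).
Proof.
  destruct (Rle_dec a b) as [H | H].
  - rewrite Rmin_left, Rmax_right in * by lra. rewrite Rabs_pos_eq by lra.
    replace (K * (b - a)) with (K * b - K * a) by ring.
    apply (CDer_mean_value f f' (fun y => K * y) (fun _ => K)); auto.
    intros y. auto_derive; auto. ring.
  - rewrite Rmin_right, Rmax_left in * by lra. rewrite Rabs_minus_sym, Rabs_pos_eq by lra.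
    replace (f b - f a)%C with (- (f a - f b))%C by ring. rewrite Cmod_opp.
    replace (K * (a - b)) with (K * a - K * b) by ring.
    apply (CDer_mean_value f f' (fun y => K * y) (fun _ => K)); auto. lra.
    intros y. auto_derive; auto. ring.
Qed.

Lemma CDer_of_is_derive (f : R -> C) (y : R) (l : C) (hy : 0 <= y) :
  @is_derive R_AbsRing CR f y l -> CDer f y l.
Proof.
  intros H. refine (filterdiff_locally (FF := near_Rplus_proper y hy) _ y _ _ H).
  intros P HP. unfold near_Rplus, within. apply (filter_imp P); auto.
Qed.

Lemma primitive_exists (g : R -> C) (hg : forall y, 0 <= y -> Cex_derive g y) :
  exists F : R -> C, F 0 = RtoC 0 /\ forall y, 0 <= y -> CDer F y (g y).
Proof.
  (* Freezing [g] at its value at 0 on the negative axis gives a function continuous on the whole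
     line, to which the Riemann integral applies. *)
  set (G := fun x => g (Rmax 0 x)).
  assert (HG : forall x, @continuous R_UniformSpace CR G x).
  { intros x P HP.
    assert (Hm : 0 <= Rmax 0 x) by apply Rmax_l.
    specialize (continuous_Rplus_C g hg (Rmax 0 x) Hm P HP) as HN.
    apply near_Rplus_elim in HN. destruct HN as [d [Hd HN]].
    exists (mkposreal d Hd). intros z Hz. change (Rabs (z - x) < d) in Hz.
    apply HN. apply Rmax_l. eapply Rle_lt_trans; [|exact Hz].
    unfold Rmax; repeat destruct Rle_dec; unfold Rabs; repeat destruct Rcase_abs; lra. }
  exists (fun y => @RInt CR G 0 y). split.
  - apply (RInt_point (V := CR)).
  - intros y Hy. apply CDer_of_is_derive; auto.
    replace (g y) with (G y) by (unfold G; now rewrite Rmax_right).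
    apply (is_derive_RInt (V := CR) G _ 0 y); auto.
    exists (mkposreal 1 Rlt_0_1). intros z _.
    apply (RInt_correct (V := CR)). apply (ex_RInt_continuous (V := CR)). auto.
Qed.

Lemma Cmod_le_Rabs_plus (z : C) : Cmod z <= Rabs (Re z) + Rabs (Im z).
Proof.
  destruct z as [x y]. replace (x, y) with (RtoC x + Ci * RtoC y)%C.
  - eapply Rle_trans. apply Cmod_triangle. rewrite Cmod_mult, !Cmod_R, Cmod_Ci.
    simpl. rewrite !Rmult_0_l, Rmult_0_r, Rmult_1_l. right. f_equal; f_equal; ring.
  - apply injective_projections; simpl; ring.
Qed.

(** The hypothesis makes [F] Cauchy along the integers and completeness supplies [L]; sending the
    upper endpoint to infinity through integers gives the bound at every real [y]. *)
Lemma limit_of_exp_cauchy (F : R -> C) (A s : R) (hA : 0 < A) (hs : s < 0)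
    (hF : forall a b, 0 <= a <= b -> Cmod (F b - F a) <= A * exp (s * a)) :
  exists L : C, forall y, 0 <= y -> Cmod (F y - L) <= A * exp (s * y).
Proof.
  assert (Hsmall : forall eps, 0 < eps -> exists n0 : nat, forall n, (n0 <= n)%nat ->
    A * exp (s * INR n) < eps).
  { intros eps Heps.
    destruct (nfloor_ex (Rabs (ln (eps / A) / s))) as [n0 Hn0]. apply Rabs_pos.
    exists (S n0). intros n Hn. apply le_INR in Hn. rewrite S_INR in Hn.
    assert (Hl := Rle_abs (ln (eps / A) / s)).
    assert (Hlt : ln (eps / A) / s < INR n) by lra.
    assert (H1 : s * INR n < ln (eps / A)).
    { replace (ln (eps / A)) with (s * (ln (eps / A) / s)) by (field; lra). nra. }
    apply exp_increasing in H1. rewrite exp_ln in H1 by (now apply Rdiv_lt_0_compat).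
    replace eps with (A * (eps / A)) by (field; lra). now apply Rmult_lt_compat_l. }
  destruct (proj1 (filterlim_locally_cauchy (U := CR) (F := eventually) (fun n => F (INR n))))
    as [L HL].
  { intros eps. destruct (Hsmall eps (cond_pos eps)) as [n0 Hn0].
    exists (fun n => (n0 <= n)%nat). split. now exists n0.
    assert (Hc : forall u v, (n0 <= u)%nat -> (u <= v)%nat -> Cmod (F (INR v) - F (INR u)) < eps).
    { intros u v Hu Huv. eapply Rle_lt_trans; [|apply (Hn0 u Hu)].
      apply hF. split. apply pos_INR. now apply le_INR. }
    assert (Hc' : forall u v, (n0 <= u)%nat -> (n0 <= v)%nat -> Cmod (F (INR v) - F (INR u)) < eps).
    { intros u v Hu Hv. destruct (Nat.le_ge_cases u v). auto.
      replace (F (INR v) - F (INR u))%C with (- (F (INR u) - F (INR v)))%C by ring.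
      rewrite Cmod_opp. auto. }
    intros u v Hu Hv. specialize (Hc' u v Hu Hv).
    assert (Hm := Rmax_Cmod (F (INR v) - F (INR u))%C).
    split; (eapply Rle_lt_trans; [|exact Hc']; eapply Rle_trans; [|exact Hm]).
    apply Rmax_l. apply Rmax_r. }
  exists L. intros y Hy. apply le_epsilon. intros eps Heps.
  assert (Hb : locally (L : CR) (fun z => Cmod (z - L) < eps)).
  { exists (mkposreal (eps / 2) ltac:(lra)). intros z [H1 H2].
    eapply Rle_lt_trans. apply Cmod_le_Rabs_plus.
    change (Rabs (fst z - fst L) < eps / 2) in H1. change (Rabs (snd z - snd L) < eps / 2) in H2.
    unfold Re, Im; simpl. unfold Rminus in *. lra. }
  specialize (HL _ Hb). destruct HL as [n1 Hn1].
  destruct (nfloor_ex y Hy) as [n2 Hn2].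
  set (n := Nat.max n1 (S n2)).
  specialize (Hn1 n ltac:(unfold n; lia)). simpl in Hn1.
  assert (Hyn : y <= INR n).
  { apply Rle_trans with (INR (S n2)). rewrite S_INR; lra. apply le_INR. unfold n; lia. }
  replace (F y - L)%C with (- (F (INR n) - F y) + (F (INR n) - L))%C by ring.
  eapply Rle_trans. apply Cmod_triangle. rewrite Cmod_opp.
  apply Rplus_le_compat; [|lra]. now apply hF.
Qed.

(** The sign of [s] selects the base point: integration starts at infinity for [s < 0] and at 0 for
    [s > 0]. For [s = 0] a primitive may grow linearly, hence the exclusion. *)
Lemma primitive_exp_bound (g : R -> C) (K s : R) (hK : 0 < K) (hs : s <> 0)
    (hg : forall y, 0 <= y -> Cex_derive g y)
    (hb : forall y, 0 <= y -> Cmod (g y) <= K * exp (s * y)) :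
  exists (F : R -> C) (M : R), 0 < M /\ forall y, 0 <= y ->
    CDer F y (g y) /\ Cmod (F y) <= M * exp (s * y).
Proof.
  destruct (primitive_exists g hg) as [F [F0 HF]].
  assert (HD : forall a b, 0 <= a <= b ->
    Cmod (F b - F a) <= K / s * exp (s * b) - K / s * exp (s * a)).
  { intros a b Hab.
    apply (CDer_mean_value F g (fun y => K / s * exp (s * y)) (fun y => K * exp (s * y))); auto.
    - intros y Hy. apply HF. lra.
    - intros y. auto_derive; auto. field. auto.
    - intros y Hy. apply hb. lra. }
  destruct (Rle_dec s 0) as [Hs | Hs].
  - assert (Hs' : s < 0) by lra.
    assert (HM : 0 < K / - s) by (apply Rdiv_lt_0_compat; lra).
    assert (E : K / s = - (K / - s)) by (field; lra).
    destruct (limit_of_exp_cauchy F (K / - s) s) as [L HL]; auto.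
    { intros a b Hab. specialize (HD a b Hab). rewrite E in HD.
      assert (P := exp_pos (s * b)). nra. }
    exists (fun y => F y - L)%C, (K / - s). split; auto. intros y Hy. split; auto.
    replace (g y) with (g y - 0)%C by ring. apply CDer_minus; auto. now apply CDer_const.
  - assert (Hs' : 0 < s) by lra.
    assert (HM : 0 < K / s) by (apply Rdiv_lt_0_compat; lra).
    exists F, (K / s). split; auto. intros y Hy. split; auto.
    specialize (HD 0 y ltac:(lra)). rewrite F0 in HD.
    replace (F y - 0)%C with (F y) in HD by ring.
    rewrite Rmult_0_r, exp_0 in HD. lra.
Qed.

(** * Variation of constants *)

Lemma CDer_zero_constant (f : R -> C) (a : R) (ha : 0 <= a)
    (hf : forall y, a <= y -> CDer f y (RtoC 0)) (y : R) (hy : a <= y) : f y = f a.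
Proof.
  assert (H : Cmod (f y - f a) <= 0 * Rabs (y - a)).
  { apply (CDer_lipschitz_on f (fun _ => RtoC 0)); try lra;
      intros z Hz; rewrite Rmin_left in Hz by lra.
    - apply hf; lra.
    - rewrite Cmod_0; lra. }
  rewrite Rmult_0_l in H. assert (H0 := Cmod_ge_0 (f y - f a)).
  assert (E := Cmod_eq_0 _ (Rle_antisym _ _ H H0)).
  replace (f y) with (f y - f a + f a)%C by ring. rewrite E. ring.
Qed.

(* If the Wronskian vanished, [v2 / v1] would be constant near infinity,
   whereas it decays there. *)
Lemma wronskian_ne_0 (v1 v1' v2 v2' : R -> C) (r m M Y : R)
    (hr : 0 < r) (hm : 0 < m) (hM : 0 < M) (hY : 0 <= Y)
    (hv1 : forall y, 0 <= y -> CDer v1 y (v1' y))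
    (hv2 : forall y, 0 <= y -> CDer v2 y (v2' y))
    (h1 : forall y, Y <= y -> m * exp (r * y) <= Cmod (v1 y))
    (h2 : forall y, Y <= y -> Cmod (v2 y) <= M * exp (- r * y))
    (h2Y : v2 Y <> RtoC 0) :
  ~ (forall y, 0 <= y -> (v1 y * v2' y - v1' y * v2 y)%C = RtoC 0).
Proof.
  intros HW.
  assert (Hn : forall y, Y <= y -> v1 y <> RtoC 0).
  { intros y Hy E. specialize (h1 y Hy). rewrite E, Cmod_0 in h1.
    assert (P := exp_pos (r * y)). nra. }
  assert (Hc : forall y, Y <= y -> (v2 y * / v1 y)%C = (v2 Y * / v1 Y)%C).
  { apply (CDer_zero_constant (fun y => v2 y * / v1 y)%C Y hY). intros y Hy.
    assert (Hy0 : 0 <= y) by lra.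
    replace (RtoC 0) with (v2' y * / v1 y + v2 y * (- v1' y * (/ v1 y * / v1 y)))%C.
    - apply (CDer_mult v2 (fun z => / v1 z)%C); auto. apply CDer_inv; auto.
    - specialize (HW y Hy0).
      replace (v2' y * / v1 y + v2 y * (- v1' y * (/ v1 y * / v1 y)))%C with
        ((v1 y * v2' y - v1' y * v2 y) * (/ v1 y * / v1 y))%C by (field; auto).
      rewrite HW. ring. }
  set (rho := Cmod (v2 Y * / v1 Y)).
  assert (Hrho : 0 < rho).
  { apply Cmod_gt_0. intros E. apply h2Y.
    replace (v2 Y) with (v2 Y * / v1 Y * v1 Y)%C by (field; apply Hn; lra).
    rewrite E. ring. }
  assert (Hb : forall y, Y <= y -> rho * (1 + r * y) <= M / m).
  { intros y Hy. unfold rho. rewrite <- (Hc y Hy), Cmod_mult, Cmod_inv by auto.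
    specialize (h1 y Hy). specialize (h2 y Hy).
    assert (Hry : 0 <= r * y) by (apply Rmult_le_pos; lra).
    assert (E1 : 1 + r * y <= exp (r * y)).
    { destruct (Req_dec (r * y) 0) as [-> | hn]. rewrite exp_0; lra.
      left; now apply exp_ineq1. }
    assert (E2 : exp (- r * y) <= 1).
    { rewrite <- exp_0. destruct (Req_dec (r * y) 0) as [e | hn].
      - replace (- r * y) with (- (r * y)) by ring. rewrite e, Ropp_0. lra.
      - left. apply exp_increasing. lra. }
    assert (P : 0 < m * exp (r * y)) by (apply Rmult_lt_0_compat; auto using exp_pos).
    assert (E3 : / Cmod (v1 y) <= / (m * exp (r * y))) by (apply Rinv_le_contravar; auto).
    apply Rle_trans with (M * / (m * exp (r * y)) * exp (r * y)).
    - apply Rmult_le_compat; try lra.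
      + apply Rmult_le_pos. apply Cmod_ge_0. left. apply Rinv_0_lt_compat. lra.
      + apply Rmult_le_compat; auto using Cmod_ge_0.
        * left. apply Rinv_0_lt_compat. lra.
        * nra.
    - right. field. split; [|lra]. assert (Q := exp_pos (r * y)). lra. }
  (* At this point [rho * (1 + r * y0)] equals [M / m] plus a positive amount. The linear minorant
     [1 + r * y] of the exponential is already enough for the contradiction. *)
  set (y0 := Y + M / m / rho / r).
  assert (HMm : 0 < M / m) by now apply Rdiv_lt_0_compat.
  assert (Hy0 : Y <= y0).
  { unfold y0. assert (0 < M / m / rho / r) by (repeat apply Rdiv_lt_0_compat; auto). lra. }
  specialize (Hb y0 Hy0).
  assert (E : rho * (1 + r * y0) = rho + rho * r * Y + M / m).
  { unfold y0. field. repeat split; lra. }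
  assert (0 <= rho * r * Y) by (repeat apply Rmult_le_pos; lra).
  lra.
Qed.

(** Encoded as a constant family so that the whole calculus of [bounded_family] applies to single
    functions; the parameter value 1 is then an arbitrary admissible one. *)
Definition exp_bounded (eta : R) (f : R -> C) : Prop := bounded_family eta (fun _ => f).

Lemma unit_parameter : 0 < 1 <= 1. Proof. lra. Qed.

Lemma exp_bounded_bound eta f : exp_bounded eta f ->
  exists K, 0 < K /\ forall y, 0 <= y -> Cmod (f y) <= K * exp (eta * y).
Proof.
  intros H. destruct (family_bound _ _ H) as [K [HK Hb]]. exists K; split; auto.
  intros y Hy. exact (Hb 1 y unit_parameter Hy).
Qed.

Lemma exp_bounded_CDer eta f y : exp_bounded eta f -> 0 <= y -> CDer f y (Cderive f y).
Proof. intros H Hy. exact (family_CDer _ _ 1 y H unit_parameter Hy). Qed.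

Lemma exp_bounded_ext eta f g : (forall y, 0 <= y -> f y = g y) ->
  exp_bounded eta f -> exp_bounded eta g.
Proof. intros E. apply family_ext. auto. Qed.

(** Bootstrap: order-zero bounds on [u] and [u1] suffice, since every further derivative is
    expressed by the equation through lower ones. The two claims have to advance together, each
    feeding the other. *)
Lemma exp_bounded_of_ode (r : R) (u u1 q h : R -> C) (K : R) (hK : 0 < K)
    (hu : forall y, 0 <= y -> CDer u y (u1 y))
    (hu1 : forall y, 0 <= y -> CDer u1 y (q y * u y + h y)%C)
    (bu : forall y, 0 <= y -> Cmod (u y) <= K * exp (r * y))
    (bu1 : forall y, 0 <= y -> Cmod (u1 y) <= K * exp (r * y))
    (hq : exp_bounded 0 q) (hh : exp_bounded r h) :
  exp_bounded r u.
Proof.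
  enough (H : forall n, bounded_upto n r (fun _ => u) /\ bounded_upto n r (fun _ => u1))
    by (intros n; apply H).
  induction n as [|n [Hu Hu1]].
  - split; (split; [|exact I]); exists K; split; auto.
  - split; (split; [exists K; split; auto|split]).
    + intros _ y _ Hy. eapply Cex_derive_intro. now apply hu.
    + apply (bounded_upto_ext n r (fun _ => u1)); auto.
      intros _ y _ Hy. symmetry. apply CDer_eq; auto.
    + intros _ y _ Hy. eapply Cex_derive_intro. now apply hu1.
    + apply (bounded_upto_ext n r (fun _ y => q y * u y + h y)%C).
      * intros _ y _ Hy. symmetry. apply CDer_eq; auto.
      * apply (bounded_upto_plus n r (fun _ y => q y * u y)%C (fun _ => h)); [|apply hh].
        rewrite <- (Rplus_0_l r). apply (bounded_upto_mult n 0 r (fun _ => q) (fun _ => u)); auto.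
Qed.

Lemma exp_le (a b : R) : a <= b -> exp a <= exp b.
Proof.
  intros [H | ->]; [left; now apply exp_increasing | lra].
Qed.

(** The solution is [/ W * (v2 * F1 - v1 * F2)] with primitives [F1] of [v1 h] and [F2] of [v2 h].
    The gain [eta] makes [v2 h] integrable, so [F2] is bounded; [F1] needs only [exp (2 r y)], which
    the factor [v2] reduces to [exp (r y)]. Nothing depends on the sign of [r]. *)
Lemma variation_of_constants (r eta : R) (v1 v2 q h : R -> C) (W : C)
    (hr : r <> 0) (heta : 0 < eta)
    (hv1 : exp_bounded r v1) (hv2 : exp_bounded (- r) v2)
    (hq : exp_bounded 0 q) (hh : exp_bounded (r - eta) h) (hW : W <> RtoC 0)
    (e1 : forall y, 0 <= y -> CDer (Cderive v1) y (q y * v1 y)%C)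
    (e2 : forall y, 0 <= y -> CDer (Cderive v2) y (q y * v2 y)%C)
    (eW : forall y, 0 <= y -> (v1 y * Cderive v2 y - Cderive v1 y * v2 y)%C = W) :
  exists u, exp_bounded r u /\
    forall y, 0 <= y -> CDer (Cderive u) y (q y * u y + h y)%C.
Proof.
  assert (H1 : exp_bounded (2 * r - eta) (fun y => v1 y * h y)%C).
  { replace (2 * r - eta) with (r + (r - eta)) by ring.
    now apply (family_mult r (r - eta) (fun _ => v1) (fun _ => h)). }
  assert (H2 : exp_bounded (- eta) (fun y => v2 y * h y)%C).
  { replace (- eta) with (- r + (r - eta)) by ring.
    now apply (family_mult (- r) (r - eta) (fun _ => v2) (fun _ => h)). }
  assert (P2 : exists F M, 0 < M /\ forall y, 0 <= y ->
    CDer F y (v2 y * h y)%C /\ Cmod (F y) <= M).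
  { destruct (exp_bounded_bound _ _ H2) as [K [HK Hb]].
    destruct (primitive_exp_bound (fun y => v2 y * h y)%C K (- eta)) as [F [M [HM HF]]]; auto.
    - lra.
    - intros y Hy. eapply Cex_derive_intro. now apply (exp_bounded_CDer _ _ _ H2).
    - exists F, M. split; auto. intros y Hy. destruct (HF y Hy) as [HD HB]. split; auto.
      eapply Rle_trans; [exact HB|]. rewrite <- (Rmult_1_r M) at 2.
      apply Rmult_le_compat_l; [lra|]. rewrite <- exp_0. apply exp_le. nra. }
  assert (P1 : exists F M, 0 < M /\ forall y, 0 <= y ->
    CDer F y (v1 y * h y)%C /\ Cmod (F y) <= M * exp (2 * r * y)).
  { destruct (exp_bounded_bound _ _ H1) as [K [HK Hb]].
    (* The natural rate [2 r - eta] may vanish when [r > 0], and a zero rate has no primitive bound;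
       weakening to [2 r] avoids it at no cost. For [r < 0] the natural rate is already negative. *)
    assert (Hs : exists s, s <> 0 /\ 2 * r - eta <= s <= 2 * r).
    { destruct (Rlt_dec r 0). exists (2 * r - eta); lra. exists (2 * r); lra. }
    destruct Hs as [s [Hs0 Hs]].
    destruct (primitive_exp_bound (fun y => v1 y * h y)%C K s) as [F [M [HM HF]]]; auto.
    - intros y Hy. eapply Cex_derive_intro. now apply (exp_bounded_CDer _ _ _ H1).
    - intros y Hy. eapply Rle_trans; [now apply Hb|]. apply Rmult_le_compat_l; [lra|].
      apply exp_le. nra.
    - exists F, M. split; auto. intros y Hy. destruct (HF y Hy) as [HD HB]. split; auto.
      eapply Rle_trans; [exact HB|]. apply Rmult_le_compat_l; [lra|]. apply exp_le. nra. }
  destruct P1 as [F1 [M1 [HM1 HF1]]]. destruct P2 as [F2 [M2 [HM2 HF2]]].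
  set (u := fun y => (/ W * (v2 y * F1 y - v1 y * F2 y))%C).
  set (u1 := fun y => (/ W * (Cderive v2 y * F1 y - Cderive v1 y * F2 y))%C).
  assert (Du : forall y, 0 <= y -> CDer u y (u1 y)).
  { intros y Hy. unfold u, u1. apply CDer_scal; auto.
    replace (Cderive v2 y * F1 y - Cderive v1 y * F2 y)%C with
      ((Cderive v2 y * F1 y + v2 y * (v1 y * h y))
       - (Cderive v1 y * F2 y + v1 y * (v2 y * h y)))%C by ring.
    apply CDer_minus; auto; apply CDer_mult; auto.
    - now apply (exp_bounded_CDer (- r)).
    - now apply HF1.
    - now apply (exp_bounded_CDer r).
    - now apply HF2. }
  assert (Du1 : forall y, 0 <= y -> CDer u1 y (q y * u y + h y)%C).
  { intros y Hy. unfold u, u1.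
    replace (q y * (/ W * (v2 y * F1 y - v1 y * F2 y)) + h y)%C with
      (/ W * ((q y * v2 y * F1 y + Cderive v2 y * (v1 y * h y))
       - (q y * v1 y * F2 y + Cderive v1 y * (v2 y * h y))))%C.
    - apply CDer_scal; auto. apply CDer_minus; auto; apply CDer_mult; auto.
      + now apply HF1.
      + now apply HF2.
    - transitivity (q y * (/ W * (v2 y * F1 y - v1 y * F2 y))
        + / W * (v1 y * Cderive v2 y - Cderive v1 y * v2 y) * h y)%C.
      + ring.
      + rewrite (eW y Hy). field. auto. }
  assert (HE : forall y, exp (- r * y) * exp (2 * r * y) = exp (r * y)).
  { intros y. rewrite <- exp_plus. f_equal. ring. }
  assert (Hbound : forall a b, exp_bounded r a -> exp_bounded (- r) b ->
    exists K, 0 < K /\ forall y, 0 <= y ->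
      Cmod (/ W * (b y * F1 y - a y * F2 y)) <= K * exp (r * y)).
  { intros a b Ha Hb.
    destruct (exp_bounded_bound _ _ Ha) as [A [HA Ba]].
    destruct (exp_bounded_bound _ _ Hb) as [B [HB Bb]].
    assert (HWp : 0 < / Cmod W) by (apply Rinv_0_lt_compat; now apply Cmod_gt_0).
    exists (/ Cmod W * (B * M1 + A * M2)). split.
    { apply Rmult_lt_0_compat; auto. nra. }
    intros y Hy. rewrite Cmod_mult, Cmod_inv by auto. rewrite Rmult_assoc.
    apply Rmult_le_compat_l; [lra|].
    unfold Cminus. eapply Rle_trans. apply Cmod_triangle. rewrite Cmod_opp, !Cmod_mult.
    rewrite Rmult_plus_distr_r. apply Rplus_le_compat.
    - apply Rle_trans with ((B * exp (- r * y)) * (M1 * exp (2 * r * y))).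
      + apply Rmult_le_compat; auto using Cmod_ge_0. now apply HF1.
      + rewrite <- (HE y). right. ring.
    - apply Rle_trans with ((A * exp (r * y)) * M2).
      + apply Rmult_le_compat; auto using Cmod_ge_0. now apply HF2.
      + right. ring. }
  destruct (Hbound v1 v2 hv1 hv2) as [K [HK Ku]].
  destruct (Hbound (Cderive v1) (Cderive v2)) as [K' [HK' Ku']].
  { now apply (family_derive r (fun _ => v1)). }
  { now apply (family_derive (- r) (fun _ => v2)). }
  exists u. split.
  - apply (exp_bounded_of_ode r u u1 q h (K + K')); auto; try lra.
    + intros y Hy. assert (P := exp_pos (r * y)). specialize (Ku y Hy). unfold u. nra.
    + intros y Hy. assert (P := exp_pos (r * y)). specialize (Ku' y Hy). unfold u1. nra.
    + apply (family_weaken (r - eta)); auto. lra.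
  - intros y Hy. apply (CDer_ext u1); auto.
    intros z Hz. symmetry. apply CDer_eq; auto.
Qed.

(** * The adjoint Rayleigh equation *)

Lemma smoothR_is_derive (f : R -> R) j y : smoothR f -> 0 <= y ->
  @is_derive_Rplus RR (dyR j f) y (dyR (S j) f y).
Proof.
  intros H Hy. apply (is_derive_derive_Rplus (V := RR)); auto.
  destruct (H (S j)) as [Hd _]. apply Hd; auto.
Qed.

(** Stated from order [k] on because the profile itself need not decay, only its derivatives do. *)
Lemma exp_bounded_RtoC (eta : R) (f : R -> R) (k : nat) (hf : smoothR f)
    (hb : forall j, (k <= j)%nat -> exists K, 0 < K /\
      forall y, 0 <= y -> Rabs (dyR j f y) <= K * exp (eta * y)) :
  exp_bounded eta (fun y => RtoC (dyR k f y)).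
Proof.
  intros n. revert k hb. induction n; intros k hb.
  - split; [|exact I]. destruct (hb k (le_n k)) as [K [HK H]]. exists K; split; auto.
    intros _ y _ Hy. rewrite Cmod_R. auto.
  - assert (HD : forall y, 0 <= y -> CDer (fun z => RtoC (dyR k f z)) y (RtoC (dyR (S k) f y))).
    { intros y Hy. apply CDer_RtoC; auto. now apply smoothR_is_derive. }
    split; [|split].
    + destruct (hb k (le_n k)) as [K [HK H]]. exists K; split; auto.
      intros _ y _ Hy. rewrite Cmod_R. auto.
    + intros _ y _ Hy. eapply Cex_derive_intro. now apply HD.
    + apply (bounded_upto_ext n eta (fun _ y => RtoC (dyR (S k) f y))).
      * intros _ y _ Hy. symmetry. apply CDer_eq; auto.
      * apply IHn. intros j Hj. apply hb. lia.
Qed.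

Section Rayleigh.

Variables (Us : R -> R) (alpha : Z) (c : C).

Definition shifted (y : R) : C := (RtoC (Us y) - Cconj c)%C.
Local Notation w := shifted.
Local Notation U1 := (fun y => RtoC (dyR 1 Us y)).
Local Notation U2 := (fun y => RtoC (dyR 2 Us y)).

Record profile_facts (eta : R) : Prop := {
  pf_eta : 0 < eta;
  pf_w : exp_bounded 0 w;
  pf_U1 : exp_bounded (- eta) U1;
  pf_U2 : exp_bounded (- eta) U2;
  pf_w_CDer : forall y, 0 <= y -> CDer w y (U1 y);
  pf_U1_CDer : forall y, 0 <= y -> CDer U1 y (U2 y);
  pf_w_lower : forall y, Im c <= Cmod (w y)
}.

Lemma shear_profile_facts : shear_profile Us -> exists eta, profile_facts eta.
Proof.
  intros [Hs [M HM] _ _ _ _ [eta [K [Heta HK]]]].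
  assert (HU : forall k, (1 <= k)%nat -> exp_bounded (- eta) (fun y => RtoC (dyR k Us y))).
  { intros k Hk. apply exp_bounded_RtoC; auto. intros j Hj.
    destruct (HK j ltac:(lia)) as [H1 H2]. exists (K j); auto. }
  assert (Hw : forall y, 0 <= y -> CDer w y (U1 y)).
  { intros y Hy. replace (U1 y) with (U1 y - 0)%C by ring. apply CDer_minus; auto.
    - apply CDer_RtoC; auto. exact (smoothR_is_derive Us 0 y Hs Hy).
    - now apply CDer_const. }
  exists eta. constructor; auto.
  - apply (family_intro 0 (fun _ => w) (fun _ => U1)); auto.
    + exists (Rabs M + 1 + Cmod c). split.
      { assert (H1 := Rabs_pos M). assert (H2 := Cmod_ge_0 c). lra. }
      intros _ y _ Hy. rewrite Rmult_0_l, exp_0, Rmult_1_r.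
      unfold shifted, Cminus. eapply Rle_trans. apply Cmod_triangle.
      rewrite Cmod_opp, Cmod_conj, Cmod_R. specialize (HM y Hy).
      assert (H := Rle_abs M). lra.
    + apply (family_weaken (- eta)). lra. now apply HU.
  - intros y Hy. apply CDer_RtoC; auto. now apply smoothR_is_derive.
  (* [Us] is real and the conjugation cancels the minus sign, so [w] has constant imaginary part
     [Im c]: for an unstable [c] there is no critical layer. *)
  - intros y. replace (Im c) with (Im (w y)) by (unfold shifted, Im; simpl; ring).
    eapply Rle_trans; [apply Rle_abs|]. eapply Rle_trans; [|apply Rmax_Cmod]. apply Rmax_r.
Qed.

Local Notation Ray := (Ray_adj Us alpha c).
Local Notation Lap := (Laplace alpha).

Context {eta : R} (pf : profile_facts eta) (hc : 0 < Im c).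

Lemma shifted_ne_0 y : w y <> RtoC 0.
Proof. intros E. assert (H := pf_w_lower _ pf y). rewrite E, Cmod_0 in H. lra. Qed.

Lemma exp_bounded_inv_shifted : exp_bounded 0 (fun y => / w y)%C.
Proof.
  apply (family_inv (fun _ => w) (Im c)); auto.
  - intros _ y _ _. apply (pf_w_lower _ pf).
  - apply (pf_w _ pf).
Qed.

Definition twice_CDer (phi : R -> C) : Prop :=
  (forall y, 0 <= y -> CDer phi y (Cderive phi y)) /\
  (forall y, 0 <= y -> CDer (Cderive phi) y (Cderive (Cderive phi) y)).

Lemma exp_bounded_derive r phi : exp_bounded r phi -> exp_bounded r (Cderive phi).
Proof. apply (family_derive r (fun _ => phi)). Qed.

Lemma exp_bounded_twice r phi : exp_bounded r phi -> twice_CDer phi.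
Proof.
  intros H. split; intros y Hy.
  - now apply (exp_bounded_CDer r).
  - apply (exp_bounded_CDer r); auto. now apply exp_bounded_derive.
Qed.

Lemma shifted_mult_derive phi : twice_CDer phi ->
  (forall y, 0 <= y -> CDer (fun z => w z * phi z)%C y (U1 y * phi y + w y * Cderive phi y)%C) /\
  (forall y, 0 <= y -> CDer (Cderive (fun z => w z * phi z)%C) y
     (U2 y * phi y + RtoC 2 * U1 y * Cderive phi y + w y * Cderive (Cderive phi) y)%C).
Proof.
  intros [H1 H2].
  assert (D1 : forall y, 0 <= y ->
    CDer (fun z => w z * phi z)%C y (U1 y * phi y + w y * Cderive phi y)%C).
  { intros y Hy. apply (CDer_mult w phi); auto. now apply (pf_w_CDer _ pf). }
  split; [exact D1|]. intros y Hy.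
  apply (CDer_ext (fun z => U1 z * phi z + w z * Cderive phi z)%C); auto.
  - intros z Hz. symmetry. apply CDer_eq; auto.
  - replace (U2 y * phi y + RtoC 2 * U1 y * Cderive phi y + w y * Cderive (Cderive phi) y)%C with
      ((U2 y * phi y + U1 y * Cderive phi y)
        + (U1 y * Cderive phi y + w y * Cderive (Cderive phi) y))%C.
    + apply CDer_plus; auto.
      * apply (CDer_mult U1 phi); auto. now apply (pf_U1_CDer _ pf).
      * apply (CDer_mult w (Cderive phi)); auto. now apply (pf_w_CDer _ pf).
    + replace (RtoC 2) with (RtoC 1 + RtoC 1)%C by (rewrite <- RtoC_plus; f_equal; ring). ring.
Qed.

(** Leibniz' rule produces a term [Us'' phi] that cancels the zeroth-order term of the operator.
    Beyond [w * Lap phi] only a term with the decaying factor [Us'] is left. *)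
Lemma Ray_adj_expand phi y : twice_CDer phi -> 0 <= y ->
  Ray phi y = (w y * Lap phi y + RtoC 2 * U1 y * Cderive phi y)%C.
Proof.
  intros H Hy. destruct (shifted_mult_derive phi H) as [D1 D2].
  unfold Ray_adj, Laplace.
  change (dyC 2 (fun z => (RtoC (Us z) - Cconj c) * phi z)%C y)
    with (Cderive (Cderive (fun z => w z * phi z)%C) y).
  change (dyC 2 phi y) with (Cderive (Cderive phi) y).
  rewrite (CDer_eq _ _ _ Hy (D2 y Hy)). unfold shifted. ring.
Qed.

Lemma Laplace_ext phi psi y : (forall z, 0 <= z -> phi z = psi z) -> twice_CDer phi ->
  0 <= y -> Lap phi y = Lap psi y.
Proof.
  intros E [H1 H2] Hy.
  assert (E2 : dyC 2 phi y = dyC 2 psi y).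
  { change (Cderive (Cderive phi) y = Cderive (Cderive psi) y).
    apply Cderive_ext.
    - exact Hy.
    - intros z Hz. apply Cderive_ext; auto. eapply Cex_derive_intro. now apply H1.
    - eapply Cex_derive_intro. now apply H2. }
  unfold Laplace. now rewrite E2, (E y Hy).
Qed.

Lemma exp_bounded_Laplace r phi : exp_bounded r phi -> exp_bounded r (Lap phi).
Proof.
  intros H. apply (family_minus r (fun _ => dyC 2 phi) (fun _ y => RtoC (IZR alpha ^ 2) * phi y)%C).
  - now apply (family_dyC r (fun _ => phi)).
  - now apply (family_scal_const r (fun _ => phi)).
Qed.

(** Solving the expanded equation for the Laplacian gives [(h - 2 Us' phi') / w], in which both
    terms carry the extra decay. This is why the source of the next order is admissible. *)
Lemma exp_bounded_Laplace_decay r phi h : exp_bounded r phi -> exp_bounded (r - eta) h ->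
  (forall y, 0 <= y -> Ray phi y = h y) -> exp_bounded (r - eta) (Lap phi).
Proof.
  intros Hphi Hh HR.
  apply (exp_bounded_ext _ (fun y => / w y * (h y - RtoC 2 * (U1 y * Cderive phi y)))%C).
  - intros y Hy. rewrite <- HR, Ray_adj_expand by (auto; now apply (exp_bounded_twice r)).
    field. apply shifted_ne_0.
  - rewrite <- (Rplus_0_l (r - eta)).
    apply (family_mult 0 (r - eta) (fun _ y => / w y)%C
      (fun _ y => h y - RtoC 2 * (U1 y * Cderive phi y))%C).
    + apply exp_bounded_inv_shifted.
    + apply (family_minus _ (fun _ => h) (fun _ y => RtoC 2 * (U1 y * Cderive phi y))%C); auto.
      apply (family_scal_const _ (fun _ y => U1 y * Cderive phi y)%C).
      replace (r - eta) with (- eta + r) by ring.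
      apply (family_mult (- eta) r (fun _ => U1) (fun _ => Cderive phi)).
      * apply (pf_U1 _ pf).
      * now apply exp_bounded_derive.
Qed.

Definition ray_potential (y : R) : C := (RtoC (IZR alpha ^ 2) + U2 y * / w y)%C.

Lemma exp_bounded_ray_potential : exp_bounded 0 ray_potential.
Proof.
  apply (family_plus 0 (fun _ _ => RtoC (IZR alpha ^ 2)) (fun _ y => U2 y * / w y)%C).
  - apply (family_const (fun _ => RtoC (IZR alpha ^ 2)) (Cmod (RtoC (IZR alpha ^ 2)))).
    intros; lra.
  - apply (family_weaken (- eta + 0)). { assert (H := pf_eta _ pf). lra. }
    apply (family_mult (- eta) 0 (fun _ => U2) (fun _ y => / w y)%C).
    + apply (pf_U2 _ pf).
    + apply exp_bounded_inv_shifted.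
Qed.

Lemma exp_bounded_shifted_mult r phi : exp_bounded r phi ->
  exp_bounded r (fun y => w y * phi y)%C.
Proof.
  intros H. rewrite <- (Rplus_0_l r).
  apply (family_mult 0 r (fun _ => w) (fun _ => phi)); auto. apply (pf_w _ pf).
Qed.

Lemma Ray_adj_ode r phi : exp_bounded r phi -> (forall y, 0 <= y -> Ray phi y = RtoC 0) ->
  forall y, 0 <= y ->
    CDer (Cderive (fun z => w z * phi z)%C) y (ray_potential y * (w y * phi y))%C.
Proof.
  intros H HR y Hy. destruct (shifted_mult_derive phi (exp_bounded_twice r phi H)) as [_ D2].
  replace (ray_potential y * (w y * phi y))%C with
    (U2 y * phi y + RtoC 2 * U1 y * Cderive phi y + w y * Cderive (Cderive phi) y)%C; auto.
  specialize (HR y Hy). rewrite Ray_adj_expand in HR by (auto; now apply (exp_bounded_twice r)).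
  unfold Laplace in HR. change (dyC 2 phi y) with (Cderive (Cderive phi) y) in HR.
  transitivity ((w y * (Cderive (Cderive phi) y - RtoC (IZR alpha ^ 2) * phi y)
     + RtoC 2 * U1 y * Cderive phi y) + U2 y * phi y + RtoC (IZR alpha ^ 2) * (w y * phi y))%C.
  - ring.
  - rewrite HR. unfold ray_potential. field. apply shifted_ne_0.
Qed.

Section Fundamental.

Variables (r : R) (phi1 phi2 : R -> C) (W : C).
Hypothesis hr : r <> 0.
Hypothesis b1 : exp_bounded r phi1.
Hypothesis b2 : exp_bounded (- r) phi2.
Hypothesis R1 : forall y, 0 <= y -> Ray phi1 y = RtoC 0.
Hypothesis R2 : forall y, 0 <= y -> Ray phi2 y = RtoC 0.
Hypothesis hW : W <> RtoC 0.
Hypothesis eW : forall y, 0 <= y ->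
  (w y * phi1 y * Cderive (fun z => w z * phi2 z)%C y
   - Cderive (fun z => w z * phi1 z)%C y * (w y * phi2 y))%C = W.

(** Variation of constants is applied to [u = w psi], and dividing by [w] costs no growth. The decay
    of [Lap psi] is returned as well, because it is what the next step of the recursion consumes. *)
Lemma Ray_adj_solve (h : R -> C) : exp_bounded (r - eta) h ->
  exists psi, exp_bounded r psi /\ exp_bounded (r - eta) (Lap psi) /\
    forall y, 0 <= y -> Ray psi y = h y.
Proof.
  intros Hh.
  destruct (variation_of_constants r eta (fun y => w y * phi1 y)%C (fun y => w y * phi2 y)%C
    ray_potential h W) as [u [Hu Du]]; auto.
  - apply (pf_eta _ pf).
  - now apply exp_bounded_shifted_mult.
  - now apply exp_bounded_shifted_mult.
  - apply exp_bounded_ray_potential.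
  - now apply (Ray_adj_ode r).
  - now apply (Ray_adj_ode (- r)).
  - set (psi := fun y => (/ w y * u y)%C).
    assert (Hpsi : exp_bounded r psi).
    { rewrite <- (Rplus_0_l r).
      apply (family_mult 0 r (fun _ y => / w y)%C (fun _ => u)); auto.
      apply exp_bounded_inv_shifted. }
    assert (HR : forall y, 0 <= y -> Ray psi y = h y).
    { intros y Hy. unfold Ray_adj.
      rewrite <- (Laplace_ext u); auto; [|intros z Hz|now apply (exp_bounded_twice r)].
      - unfold Laplace. change (dyC 2 u y) with (Cderive (Cderive u) y).
        rewrite (CDer_eq _ _ _ Hy (Du y Hy)). unfold ray_potential, psi.
        ring.
      - unfold psi. change (u z = w z * (/ w z * u z))%C. field. apply shifted_ne_0. }
    exists psi. repeat split; auto. now apply (exp_bounded_Laplace_decay r psi h).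
Qed.

(** At a double zero both [w phi1] and its derivative vanish, and with them the Wronskian. *)
Lemma Ray_adj_simple_zeros y : 0 <= y -> phi1 y = RtoC 0 -> Cderive phi1 y <> RtoC 0.
Proof.
  intros Hy E E'. apply hW. rewrite <- (eW y Hy).
  destruct (shifted_mult_derive phi1 (exp_bounded_twice r phi1 b1)) as [D1 _].
  rewrite (CDer_eq _ _ _ Hy (D1 y Hy)), E, E'. ring.
Qed.

End Fundamental.

End Rayleigh.

(** * The formal expansion in the viscosity *)

Section Expansion.

Variables (Us : R -> R) (alpha : Z) (c : C) (eta : R).
Hypothesis pf : profile_facts Us c eta.
Hypothesis hc : 0 < Im c.
Local Notation w := (shifted Us c).
Local Notation Ray := (Ray_adj Us alpha c).
Local Notation Lap := (Laplace alpha).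
Local Notation Orr := (Orr_adj Us alpha c).

Definition visc : C := (/ (Ci * RtoC (IZR alpha)))%C.

Lemma twice_CDer_linear (f g : R -> C) (a : C) : twice_CDer f -> twice_CDer g ->
  twice_CDer (fun y => f y + a * g y)%C /\
  (forall y, 0 <= y -> Cderive (fun y => f y + a * g y)%C y = (Cderive f y + a * Cderive g y)%C) /\
  (forall y, 0 <= y -> Cderive (Cderive (fun y => f y + a * g y)%C) y
     = (Cderive (Cderive f) y + a * Cderive (Cderive g) y)%C).
Proof.
  intros [F1 F2] [G1 G2].
  assert (D1 : forall y, 0 <= y ->
    CDer (fun y => f y + a * g y)%C y (Cderive f y + a * Cderive g y)%C).
  { intros y Hy. apply CDer_plus; auto. apply CDer_scal; auto. }
  assert (E1 : forall y, 0 <= y ->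
    Cderive (fun y => f y + a * g y)%C y = (Cderive f y + a * Cderive g y)%C).
  { intros y Hy. exact (CDer_eq _ _ _ Hy (D1 y Hy)). }
  assert (D2 : forall y, 0 <= y -> CDer (Cderive (fun y => f y + a * g y)%C) y
     (Cderive (Cderive f) y + a * Cderive (Cderive g) y)%C).
  { intros y Hy. apply (CDer_ext (fun y => Cderive f y + a * Cderive g y)%C); auto.
    - intros z Hz. now rewrite E1.
    - apply CDer_plus; auto. apply CDer_scal; auto. }
  assert (E2 : forall y, 0 <= y -> Cderive (Cderive (fun y => f y + a * g y)%C) y
     = (Cderive (Cderive f) y + a * Cderive (Cderive g) y)%C).
  { intros y Hy. exact (CDer_eq _ _ _ Hy (D2 y Hy)). }
  split; [split|split; [exact E1|exact E2]]; intros y Hy.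
  - rewrite E1 by exact Hy. exact (D1 y Hy).
  - rewrite E2 by exact Hy. exact (D2 y Hy).
Qed.

Lemma Laplace_linear (f g : R -> C) (a : C) y : twice_CDer f -> twice_CDer g -> 0 <= y ->
  Lap (fun y => f y + a * g y)%C y = (Lap f y + a * Lap g y)%C.
Proof.
  intros Hf Hg Hy. destruct (twice_CDer_linear f g a Hf Hg) as [_ [_ E2]].
  specialize (E2 y Hy).
  change (dyC 2 (fun y => f y + a * g y)%C y = (dyC 2 f y + a * dyC 2 g y)%C) in E2.
  unfold Laplace. rewrite E2. ring.
Qed.

Lemma Orr_adj_expand nu phi y : twice_CDer phi -> 0 <= y ->
  Orr nu phi y = (w y * Lap phi y + RtoC 2 * RtoC (dyR 1 Us y) * Cderive phi y
    + RtoC nu * visc * Lap (Lap phi) y)%C.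
Proof.
  intros H Hy. unfold Orr_adj. rewrite (Ray_adj_expand Us alpha c pf) by assumption.
  reflexivity.
Qed.

Lemma Orr_adj_linear nu r r' (f g : R -> C) (a : C) y :
  exp_bounded r f -> exp_bounded r' g -> 0 <= y ->
  Orr nu (fun y => f y + a * g y)%C y = (Orr nu f y + a * Orr nu g y)%C.
Proof.
  intros Hf Hg Hy.
  assert (Tf := exp_bounded_twice r f Hf). assert (Tg := exp_bounded_twice r' g Hg).
  destruct (twice_CDer_linear f g a Tf Tg) as [T [E1 _]].
  assert (Tlf := exp_bounded_twice _ _ (exp_bounded_Laplace alpha r f Hf)).
  assert (Tlg := exp_bounded_twice _ _ (exp_bounded_Laplace alpha r' g Hg)).
  assert (EL : Lap (Lap (fun y => f y + a * g y)%C) y = (Lap (Lap f) y + a * Lap (Lap g) y)%C).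
  { rewrite <- (Laplace_linear (Lap f) (Lap g)) by assumption.
    symmetry. apply Laplace_ext.
    - intros z Hz. symmetry. now apply Laplace_linear.
    - now apply twice_CDer_linear.
    - exact Hy. }
  rewrite !Orr_adj_expand by assumption.
  rewrite EL, Laplace_linear, E1 by assumption. ring.
Qed.

(** The recursion runs on functions together with a proof of the invariant [P]: the decay of
    [Lap (psi k)] makes [- visc * Lap (Lap (psi k))] a legitimate source, and the solver restores
    the invariant. For [phi] itself the invariant holds because its source is zero. *)
Lemma expansion_coefficients (r : R) (phi : R -> C)
    (hphi : exp_bounded r phi) (hR : forall y, 0 <= y -> Ray phi y = RtoC 0)
    (hsolve : forall h, exp_bounded (r - eta) h ->
      exists psi, exp_bounded r psi /\ exp_bounded (r - eta) (Lap psi) /\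
        forall y, 0 <= y -> Ray psi y = h y) :
  exists psi : nat -> R -> C, psi 0%nat = phi /\
    (forall k, exp_bounded r (psi k)) /\
    forall k y, 0 <= y -> Ray (psi (S k)) y = (- visc * Lap (Lap (psi k)) y)%C.
Proof.
  set (P := fun f : R -> C => exp_bounded r f /\ exp_bounded (r - eta) (Lap f)).
  assert (Hstep : forall f : {f | P f}, exists g : {g | P g},
    forall y, 0 <= y -> Ray (proj1_sig g) y = (- visc * Lap (Lap (proj1_sig f)) y)%C).
  { intros [f [H1 H2]]. simpl.
    destruct (hsolve (fun y => - visc * Lap (Lap f) y)%C) as [g [G1 [G2 G3]]].
    - apply (family_scal_const _ (fun _ => Lap (Lap f))). now apply exp_bounded_Laplace.
    - exists (exist P g (conj G1 G2)). exact G3. }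
  assert (H0 : P phi).
  { split; auto.
    apply (exp_bounded_Laplace_decay Us alpha c pf hc r phi (fun _ => RtoC 0)); auto.
    apply family_zero. }
  (* Choice turns solvability into a function on the subtype of [P], which can then be iterated. *)
  set (step := fun f => proj1_sig (constructive_indefinite_description _ (Hstep f))).
  exists (fun k => proj1_sig (Nat.iter k step (exist P phi H0))).
  split; [reflexivity|split].
  - intros k. apply (proj2_sig (Nat.iter k step (exist P phi H0))).
  - intros k. exact (proj2_sig (constructive_indefinite_description _
      (Hstep (Nat.iter k step (exist P phi H0))))).
Qed.

(** The partial sum without its leading term, divided by [nu]: one power of [nu] is kept outside so
    that the deviation from [phi_c] is visibly of order [nu]. *)
Fixpoint corrector (psi : nat -> R -> C) (n : nat) (nu y : R) : C :=
  match n with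
  | O => RtoC 0
  | S m => (corrector psi m nu y + RtoC (nu ^ m) * psi (S m) y)%C
  end.

Lemma Cmod_pow_le_1 nu n : 0 < nu <= 1 -> Cmod (RtoC (nu ^ n)) <= 1.
Proof.
  intros H. rewrite Cmod_R, Rabs_pos_eq by (apply pow_le; lra).
  rewrite <- (pow1 n). apply pow_incr. lra.
Qed.

Lemma family_corrector r psi n : (forall k, exp_bounded r (psi k)) ->
  bounded_family r (corrector psi n).
Proof.
  intros H. induction n; simpl.
  - apply family_zero.
  - apply (family_plus r (corrector psi n) (fun nu y => RtoC (nu ^ n) * psi (S n) y)%C); auto.
    apply (family_scal r (fun _ => psi (S n)) (fun nu => RtoC (nu ^ n)) 1); [|apply H].
    intros nu. apply Cmod_pow_le_1.
Qed.

Lemma family_exp_bounded r F nu : bounded_family r F -> 0 < nu <= 1 -> exp_bounded r (F nu).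
Proof.
  intros H Hnu. apply family_of_smooth. now apply (family_smooth r F).
  intros j. destruct (family_bound _ _ (family_dyC r F j H)) as [K [HK Hb]].
  exists K. split; auto.
Qed.

(* The sum telescopes: each coefficient cancels the viscous term of the previous one. *)
Lemma Orr_adj_expansion r psi n nu y : (forall k, exp_bounded r (psi k)) ->
  (forall y, 0 <= y -> Ray (psi 0%nat) y = RtoC 0) ->
  (forall k y, 0 <= y -> Ray (psi (S k)) y = (- visc * Lap (Lap (psi k)) y)%C) ->
  0 < nu <= 1 -> 0 <= y ->
  Orr nu (fun y => psi 0%nat y + RtoC nu * corrector psi n nu y)%C y
  = (RtoC (nu ^ S n) * (visc * Lap (Lap (psi n)) y))%C.
Proof.
  intros H H0 HS Hnu Hy. induction n.
  - assert (B : exp_bounded r (fun y => corrector psi 0 nu y)) by apply (family_zero r).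
    rewrite (Orr_adj_linear nu r r (psi 0%nat)) by auto.
    assert (E : Orr nu (corrector psi 0 nu) y = RtoC 0).
    { rewrite Orr_adj_expand by (auto; now apply (exp_bounded_twice r)).
      change (corrector psi 0 nu) with (fun _ : R => RtoC 0).
      assert (Z1 : forall z, 0 <= z -> Cderive (fun _ => RtoC 0) z = RtoC 0).
      { intros z Hz. apply CDer_eq; auto. now apply CDer_const. }
      assert (Z2 : forall z, 0 <= z -> Cderive (Cderive (fun _ => RtoC 0)) z = RtoC 0).
      { intros z Hz. apply CDer_eq; auto. apply (CDer_ext (fun _ => RtoC 0)); auto.
        intros; now rewrite Z1. now apply CDer_const. }
      assert (L1 : forall z, 0 <= z -> Lap (fun _ => RtoC 0) z = RtoC 0).
      { intros z Hz. unfold Laplace.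
        change (dyC 2 (fun _ => RtoC 0) z) with (Cderive (Cderive (fun _ => RtoC 0)) z).
        rewrite Z2 by exact Hz. ring. }
      assert (L2 : Lap (Lap (fun _ => RtoC 0)) y = RtoC 0).
      { transitivity (Lap (fun _ => RtoC 0) y); [|now apply L1]. symmetry. apply Laplace_ext.
        - intros z Hz. symmetry. now apply L1.
        - apply (exp_bounded_twice 0). apply (family_zero 0).
        - exact Hy. }
      rewrite L2, L1, Z1 by exact Hy. ring. }
    rewrite E. unfold Orr_adj at 1. rewrite H0 by exact Hy. unfold visc, Cdiv. simpl.
    rewrite Rmult_1_r. ring.
  - simpl corrector.
    assert (B : exp_bounded r (fun y => psi 0%nat y + RtoC nu * corrector psi n nu y)%C).
    { apply (family_plus r (fun _ => psi 0%nat) (fun _ y => RtoC nu * corrector psi n nu y)%C).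
      apply H. apply (family_scal_const r (fun _ => corrector psi n nu)).
      apply family_exp_bounded; auto. now apply family_corrector. }
    transitivity (Orr nu (fun y => (psi 0%nat y + RtoC nu * corrector psi n nu y)
      + RtoC (nu ^ S n) * psi (S n) y)%C y).
    + f_equal. apply FunctionalExtensionality.functional_extensionality. intros z.
      simpl. rewrite !RtoC_mult. ring.
    + rewrite (Orr_adj_linear nu r r _ (psi (S n))) by auto.
      rewrite IHn. unfold Orr_adj. rewrite HS by exact Hy.
      fold visc. unfold Cdiv. fold visc. simpl. rewrite !RtoC_mult. ring.
Qed.

End Expansion.

(** * Wronskian and zeros of the fundamental solutions *)

Section Wronskian.

Variables (Us : R -> R) (alpha : Z) (c : C) (eta : R).
Hypothesis pf : profile_facts Us c eta.
Hypothesis hc : 0 < Im c.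
Local Notation w := (shifted Us c).
Local Notation Ray := (Ray_adj Us alpha c).

(** Formed from the products [w phi], whose equation has no first-order term; by Abel's identity it
    is therefore constant, which fails for the bare [phi]. *)
Definition wronskian (phi1 phi2 : R -> C) (y : R) : C :=
  (w y * phi1 y * Cderive (fun z => w z * phi2 z)%C y
   - Cderive (fun z => w z * phi1 z)%C y * (w y * phi2 y))%C.

Lemma wronskian_constant r r' phi1 phi2 :
  exp_bounded r phi1 -> exp_bounded r' phi2 ->
  (forall y, 0 <= y -> Ray phi1 y = RtoC 0) -> (forall y, 0 <= y -> Ray phi2 y = RtoC 0) ->
  forall y, 0 <= y -> wronskian phi1 phi2 y = wronskian phi1 phi2 0.
Proof.
  intros b1 b2 R1 R2. apply (CDer_zero_constant (wronskian phi1 phi2) 0). lra.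
  intros y Hy.
  assert (B1 := exp_bounded_CDer _ _ y (exp_bounded_shifted_mult Us c pf r phi1 b1) Hy).
  assert (B2 := exp_bounded_CDer _ _ y (exp_bounded_shifted_mult Us c pf r' phi2 b2) Hy).
  assert (O1 := Ray_adj_ode Us alpha c pf hc r phi1 b1 R1 y Hy).
  assert (O2 := Ray_adj_ode Us alpha c pf hc r' phi2 b2 R2 y Hy).
  assert (H := CDer_minus _ _ _ _ _ Hy (CDer_mult _ _ _ _ _ Hy B1 O2)
                 (CDer_mult _ _ _ _ _ Hy O1 B2)).
  simpl in H.
  match type of H with CDer _ _ ?l => replace l with (RtoC 0) in H by ring end.
  exact H.
Qed.

(** With [r > 0] the first solution is the growing one, as the ratio argument of [wronskian_ne_0]
    requires. The lower bound on [w] transfers the growth of [phi1] to [w phi1]. *)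
Lemma exists_wronskian r m Y phi1 phi2 : 0 < r -> 0 < m -> 0 <= Y ->
  exp_bounded r phi1 -> exp_bounded (- r) phi2 ->
  (forall y, 0 <= y -> Ray phi1 y = RtoC 0) -> (forall y, 0 <= y -> Ray phi2 y = RtoC 0) ->
  (forall y, Y <= y -> m * exp (r * y) <= Cmod (phi1 y)) ->
  (forall y, Y <= y -> phi2 y <> RtoC 0) ->
  exists W, W <> RtoC 0 /\ forall y, 0 <= y -> wronskian phi1 phi2 y = W.
Proof.
  intros Hr Hm HY b1 b2 R1 R2 L1 L2.
  exists (wronskian phi1 phi2 0). split; [|now apply (wronskian_constant r (- r))].
  intros E.
  destruct (exp_bounded_bound _ _ (exp_bounded_shifted_mult Us c pf _ phi2 b2)) as [M [HM Hb]].
  apply (wronskian_ne_0 (fun y => w y * phi1 y)%C (Cderive (fun y => w y * phi1 y)%C)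
    (fun y => w y * phi2 y)%C (Cderive (fun y => w y * phi2 y)%C) r (Im c * m) M Y); auto.
  - now apply Rmult_lt_0_compat.
  - intros y Hy. apply (exp_bounded_CDer r); auto. now apply (exp_bounded_shifted_mult Us c pf).
  - intros y Hy. apply (exp_bounded_CDer (- r)); auto. now apply (exp_bounded_shifted_mult Us c pf).
  - intros y Hy. rewrite Cmod_mult, Rmult_assoc.
    apply Rmult_le_compat; auto; try lra.
    + apply Rmult_le_pos. lra. left; apply exp_pos.
    + apply (pf_w_lower _ _ _ pf).
  - intros y Hy. apply Hb. lra.
  - intros E0. apply (L2 Y (Rle_refl Y)).
    assert (Hw := shifted_ne_0 Us c pf hc Y).
    replace (phi2 Y) with (/ w Y * (w Y * phi2 Y))%C by (field; auto).
    rewrite E0. ring.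
  - intros y Hy.
    transitivity (wronskian phi1 phi2 y). reflexivity.
    now rewrite (wronskian_constant r (- r)).
Qed.

Lemma wronskian_swap phi1 phi2 y : wronskian phi2 phi1 y = (- wronskian phi1 phi2 y)%C.
Proof. unfold wronskian. ring. Qed.

End Wronskian.

(** * Exponential bounds from the asymptotics *)

Definition opposite (s : branch) : branch := match s with Plus => Minus | Minus => Plus end.

Lemma asymptotic_bounds (f : R -> C) (r : R) (K : C) (hK : K <> RtoC 0) :
  filterlim (fun y => (f y / RtoC (exp (r * y)))%C) (Rbar_locally p_infty) (locally K) ->
  exists m M Y, 0 < m /\ 0 < M /\ 0 <= Y /\
    forall y, Y <= y -> m * exp (r * y) <= Cmod (f y) <= M * exp (r * y).
Proof.
  intros H.
  assert (Kp : 0 < Cmod K) by now apply Cmod_gt_0.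
  assert (Hb : locally (K : C_UniformSpace) (fun z : C => Cmod (z - K) < Cmod K / 2)).
  { exists (mkposreal (Cmod K / 4) ltac:(lra)). intros z [H1 H2].
    eapply Rle_lt_trans. apply Cmod_le_Rabs_plus.
    change (Rabs (fst z - fst K) < Cmod K / 4) in H1.
    change (Rabs (snd z - snd K) < Cmod K / 4) in H2.
    unfold Re, Im; simpl. unfold Rminus in *. lra. }
  specialize (H _ Hb). destruct H as [Y HY].
  exists (Cmod K / 2), (2 * Cmod K), (Rmax 0 (Y + 1)).
  repeat split; try lra; try apply Rmax_l.
  all: assert (P := exp_pos (r * y)); assert (Q := Rmax_r 0 (Y + 1));
    specialize (HY y ltac:(lra));
    set (q := (f y / RtoC (exp (r * y)))%C) in *;
    assert (E : Cmod (f y) = Cmod q * exp (r * y));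
    [ replace (f y) with (q * RtoC (exp (r * y)))%C;
      [rewrite Cmod_mult, Cmod_R, Rabs_pos_eq; lra
      | unfold q; field; intros E; apply RtoC_inj in E; lra] |].
  - assert (T := Cmod_triangle q (- (q - K))). rewrite Cmod_opp in T.
    replace (q + - (q - K))%C with K in T by ring.
    rewrite E. apply Rmult_le_compat_r; lra.
  - assert (T := Cmod_triangle (q - K) K).
    replace (q - K + K)%C with q in T by ring.
    rewrite E. apply Rmult_le_compat_r; lra.
Qed.

(** The asymptotics control each derivative only beyond some [Y]; on [[0, Y]] a maximum exists by
    continuity and is compared with the minimum of the exponential. *)
Lemma exp_bounded_of_asymptotic (f : R -> C) (r : R) : smoothC f ->
  (forall n, exists K : C, K <> RtoC 0 /\
    filterlim (fun y => (dyC n f y / RtoC (exp (r * y)))%C)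
      (Rbar_locally p_infty) (locally K)) ->
  exp_bounded r f.
Proof.
  intros Hs Ha. apply family_of_smooth; auto. intros n.
  destruct (Ha n) as [K [HK HL]].
  destruct (asymptotic_bounds _ _ K HK HL) as [m [M [Y [Hm [HM [HY Hb]]]]]].
  destruct (compact_max (fun y => Cmod (dyC n f y)) 0 Y) as [B HB].
  - lra.
  - intros y Hy. apply Rplus_continuous_at_Cmod. lra. apply smooth_ex_derive; auto; lra.
  (* [e] bounds [exp (r * y)] from below on [[0, Y]] for either sign of [r]. *)
  - set (e := exp (- (Rabs r * Y))). assert (He : 0 < e) by apply exp_pos.
    assert (PB := Rabs_pos B).
    assert (HBe : 0 <= Rabs B / e).
    { apply Rmult_le_pos; auto. left; now apply Rinv_0_lt_compat. }
    exists (M + Rabs B / e). split. lra.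
    intros y Hy. assert (P := exp_pos (r * y)).
    rewrite Rmult_plus_distr_r.
    destruct (Rle_dec Y y) as [h | h].
    + specialize (Hb y h). assert (0 <= Rabs B / e * exp (r * y)) by (apply Rmult_le_pos; lra).
      lra.
    + specialize (HB y ltac:(lra)).
      assert (0 <= M * exp (r * y)) by (apply Rmult_le_pos; lra).
      assert (Hexp : e <= exp (r * y)).
      { apply exp_le. assert (Q := Rle_abs (- r)). rewrite Rabs_Ropp in Q.
        assert (Q' := Rabs_pos r). nra. }
      assert (Rabs B <= Rabs B / e * exp (r * y)).
      { replace (Rabs B) with (Rabs B / e * e) at 1 by (field; lra).
        apply Rmult_le_compat_l; auto. }
      assert (Q := Rle_abs B). lra.
Qed.

(** * Finiteness of the zeros and lower bounds away from them *)

Lemma Rplus_continuous_at_plus h k y : Rplus_continuous_at h y -> Rplus_continuous_at k y ->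
  Rplus_continuous_at (fun z => h z + k z) y.
Proof.
  intros Hh Hk eps Heps.
  destruct (Hh (eps / 2)) as [d [Hd Hh']]. lra.
  destruct (Hk (eps / 2)) as [e [He Hk']]. lra.
  exists (Rmin d e). split. now apply Rmin_glb_lt. intros z Hz Hzd.
  specialize (Hh' z Hz (Rlt_le_trans _ _ _ Hzd (Rmin_l _ _))).
  specialize (Hk' z Hz (Rlt_le_trans _ _ _ Hzd (Rmin_r _ _))).
  replace (h z + k z - (h y + k y)) with ((h z - h y) + (k z - k y)) by ring.
  eapply Rle_lt_trans. apply Rabs_triang. lra.
Qed.

(** Each slot [[k s, (k+1) s)] holds at most one point of the set, so the enumeration grows by at
    most one per slot, and finitely many slots cover [[0, Y]]. *)
Lemma separated_finite (S : R -> Prop) (Y s : R) (hs : 0 < s)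
    (hS : forall y, S y -> 0 <= y <= Y)
    (hsep : forall x y, S x -> S y -> x <> y -> s <= Rabs (x - y)) :
  exists (n : nat) (z : nat -> R),
    (forall i, (i < n)%nat -> S (z i)) /\
    (forall y, S y -> exists i, (i < n)%nat /\ y = z i) /\
    (forall i j, (i < n)%nat -> (j < n)%nat -> i <> j -> z i <> z j).
Proof.
  assert (H : forall k : nat, exists (n : nat) (z : nat -> R),
    (forall i, (i < n)%nat -> S (z i) /\ z i < INR k * s) /\
    (forall y, S y -> y < INR k * s -> exists i, (i < n)%nat /\ y = z i) /\
    (forall i j, (i < n)%nat -> (j < n)%nat -> i <> j -> z i <> z j)).
  { induction k as [|k [n [z [H1 [H2 H3]]]]].
    - exists 0%nat, (fun _ => 0). repeat split; try (intros; lia).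
      intros y Hy Hlt. exfalso. destruct (hS y Hy). simpl in Hlt. lra.
    - rewrite S_INR.
      destruct (classic (exists y, S y /\ INR k * s <= y < (INR k + 1) * s)) as [[y0 [Hy0 Hk]] | Hno].
      + exists (Datatypes.S n), (fun i => if Nat.eq_dec i n then y0 else z i).
        repeat split.
        * destruct (Nat.eq_dec i n); auto. apply H1. lia.
        * destruct (Nat.eq_dec i n). lra.
          destruct (H1 i ltac:(lia)). nra.
        * intros y Hy Hlt. destruct (Rlt_dec y (INR k * s)) as [h | h].
          -- destruct (H2 y Hy h) as [i [Hi Ei]]. exists i. split. lia.
             destruct (Nat.eq_dec i n). lia. auto.
          -- exists n. split. lia. destruct (Nat.eq_dec n n); [|lia].
             apply NNPP; intros Hne. specialize (hsep y y0 Hy Hy0 Hne).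
             unfold Rabs in hsep; destruct Rcase_abs; lra.
        * intros i j Hi Hj Hij. destruct (Nat.eq_dec i n), (Nat.eq_dec j n); try lia.
          -- destruct (H1 j ltac:(lia)). lra.
          -- destruct (H1 i ltac:(lia)). lra.
          -- apply H3; lia.
      + exists n, z. repeat split; auto.
        * now apply H1.
        * destruct (H1 i H). nra.
        * intros y Hy Hlt. apply H2; auto.
          destruct (Rlt_dec y (INR k * s)); auto. exfalso. apply Hno. exists y. split; auto. lra. }
  destruct (nfloor_ex (Rabs Y / s)) as [k0 Hk0].
  { apply Rmult_le_pos. apply Rabs_pos. left; now apply Rinv_0_lt_compat. }
  destruct (H (Datatypes.S k0)) as [n [z [H1 [H2 H3]]]].
  exists n, z. repeat split; auto.
  - intros i Hi. now apply H1.
  - intros y Hy. apply H2; auto. rewrite S_INR.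
    destruct (hS y Hy). assert (Q := Rle_abs Y).
    apply Rle_lt_trans with (Rabs Y / s * s).
    + replace (Rabs Y / s * s) with (Rabs Y) by (field; lra). lra.
    + apply Rmult_lt_compat_r; lra.
Qed.

(** A sum of hat functions of height and radius [rho]. Added to [Cmod phi] it fills the zeros, so
    the sum has a positive minimum on a compact interval; where the hats vanish this is a lower
    bound on [Cmod phi] alone. *)
Fixpoint tents (rho : R) (z : nat -> R) (n : nat) (y : R) : R :=
  match n with
  | O => 0
  | S m => tents rho z m y + Rmax 0 (rho - Rabs (y - z m))
  end.

Lemma tents_nonneg rho z n y : 0 <= tents rho z n y.
Proof.
  induction n; simpl. lra. assert (H := Rmax_l 0 (rho - Rabs (y - z n))). lra.
Qed.

Lemma tents_continuous rho z n y : Rplus_continuous_at (tents rho z n) y.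
Proof.
  induction n; simpl.
  - intros eps Heps. exists 1. split. lra. intros. rewrite Rminus_diag, Rabs_R0. lra.
  - apply Rplus_continuous_at_plus; auto.
    intros eps Heps. exists eps. split; auto. intros x _ Hx. eapply Rle_lt_trans; [|exact Hx].
    unfold Rmax; repeat destruct Rle_dec; unfold Rabs in *; repeat destruct Rcase_abs; lra.
Qed.

Lemma tents_pos rho z n i : 0 < rho -> (i < n)%nat -> 0 < tents rho z n (z i).
Proof.
  intros Hr Hi. induction n; simpl. lia.
  assert (H := tents_nonneg rho z n (z i)).
  assert (H' := Rmax_l 0 (rho - Rabs (z i - z n))).
  destruct (Nat.eq_dec i n) as [-> | hne].
  - rewrite Rminus_diag, Rabs_R0, Rminus_0_r, Rmax_right by lra. lra.
  - specialize (IHn ltac:(lia)). lra.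
Qed.

Lemma tents_outside rho z n y : (forall i, (i < n)%nat -> rho < Rabs (y - z i)) ->
  tents rho z n y = 0.
Proof.
  intros H. induction n; simpl; auto. rewrite IHn by (intros; apply H; lia).
  rewrite Rmax_left; [lra|]. specialize (H n ltac:(lia)). lra.
Qed.

(** [D] is any approximate slope, not necessarily the derivative at [a]: near a zero of [phi] the
    slope of [phi] serves for the perturbed function based at its own node. *)
Lemma CDer_taylor1 (f f' : R -> C) (D : C) (K a b : R) (ha : 0 <= a) (hb : 0 <= b)
    (hf : forall y, Rmin a b <= y <= Rmax a b -> CDer f y (f' y))
    (hK : forall y, Rmin a b <= y <= Rmax a b -> Cmod (f' y - D) <= K) :
  Cmod (f b - f a - D * RtoC (b - a)) <= K * Rabs (b - a).
Proof.
  replace (f b - f a - D * RtoC (b - a))%C with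
    ((f b - D * RtoC b) - (f a - D * RtoC a))%C by (rewrite RtoC_minus; ring).
  apply (CDer_lipschitz_on (fun y => f y - D * RtoC y)%C (fun y => f' y - D)%C); auto.
  intros y Hy.
  assert (Hy0 : 0 <= y). { apply Rle_trans with (Rmin a b). now apply Rmin_glb. apply Hy. }
  replace (f' y - D)%C with (f' y - D * RtoC 1)%C by ring.
  apply CDer_minus; auto. apply CDer_scal; auto.
  apply (CDer_RtoC_is_derive (fun y => y)); auto. auto_derive; auto.
Qed.

(** The numbers are budgets. Nodes displaced by at most [rho] from zeros [4 * rho] apart remain
    separated by [rho]. Of the slope [d], one quarter is lost to its oscillation near the zero and
    one quarter to the perturbation. [rho <= 1] keeps the nodes in [[0, Y + 1]]. *)
Record zero_structure (phi : R -> C) (r : R) (n : nat) (z : nat -> R) (rho c1 d Y : R) : Prop := {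
  zs_rho : 0 < rho <= 1;
  zs_c1 : 0 < c1;
  zs_d : 0 < d;
  zs_Y : 0 <= Y;
  zs_range : forall i, (i < n)%nat -> 0 <= z i <= Y;
  zs_sep : forall i j, (i < n)%nat -> (j < n)%nat -> i <> j -> 4 * rho <= Rabs (z i - z j);
  zs_far : forall y, 0 <= y -> (forall i, (i < n)%nat -> rho < Rabs (y - z i)) ->
    c1 * exp (r * y) <= Cmod (phi y);
  zs_near : forall i y, (i < n)%nat -> 0 <= y -> Rabs (y - z i) <= rho ->
    Cmod (Cderive phi y - Cderive phi (z i)) <= d / 4;
  zs_slope : forall i, (i < n)%nat -> d <= Cmod (Cderive phi (z i))
}.

Lemma exp_rate_bound r y Y : 0 <= y <= Y -> exp (- (Rabs r * Y)) <= exp (r * y) <= exp (Rabs r * Y).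
Proof.
  intros Hy. assert (Q := Rle_abs (- r)). rewrite Rabs_Ropp in Q. assert (Q0 := Rle_abs r).
  assert (Q' := Rabs_pos r). split; apply exp_le; nra.
Qed.

Lemma zero_structure_exists (phi : R -> C) (r m Y : R) (hm : 0 < m) (hY : 0 <= Y)
    (hphi : exp_bounded r phi)
    (hlow : forall y, Y <= y -> m * exp (r * y) <= Cmod (phi y))
    (hsimple : forall y, 0 <= y -> phi y = RtoC 0 -> Cderive phi y <> RtoC 0) :
  exists n z rho c1 d, zero_structure phi r n z rho c1 d Y.
Proof.
  assert (hphi1 := exp_bounded_derive r phi hphi).
  assert (hphi2 := exp_bounded_derive r _ hphi1).
  assert (Hcont : forall f, exp_bounded r f -> forall y, 0 <= y <= Y ->
    Rplus_continuous_at (fun y => Cmod (f y)) y).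
  { intros f Hf y Hy. apply Rplus_continuous_at_Cmod. lra.
    eapply Cex_derive_intro. apply (exp_bounded_CDer r); auto; lra. }
  (* The minimum is positive because no zero is double, and at a zero of [phi] it bounds the slope
     from below. *)
  destruct (compact_min (fun y => Cmod (phi y) + Cmod (Cderive phi y)) 0 Y) as [t0 [Ht0 Hmin]].
  { lra. } { intros y Hy. apply Rplus_continuous_at_plus; auto. }
  set (d := Cmod (phi t0) + Cmod (Cderive phi t0)) in *.
  assert (Hd : 0 < d).
  { assert (P1 := Cmod_ge_0 (phi t0)). assert (P2 := Cmod_ge_0 (Cderive phi t0)).
    destruct (classic (phi t0 = RtoC 0)) as [E | E].
    - assert (0 < Cmod (Cderive phi t0)) by (apply Cmod_gt_0; apply hsimple; auto; lra).
      unfold d; lra.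
    - apply Cmod_gt_0 in E. unfold d; lra. }
  destruct (exp_bounded_bound _ _ hphi2) as [K [HK Hb]].
  set (M := K * exp (Rabs r * (Y + 1))).
  assert (HM : 0 < M) by (apply Rmult_lt_0_compat; auto using exp_pos).
  assert (HMb : forall y, 0 <= y <= Y + 1 -> Cmod (Cderive (Cderive phi) y) <= M).
  { intros y Hy. eapply Rle_trans. apply Hb; lra. apply Rmult_le_compat_l. lra.
    now apply exp_rate_bound. }
  assert (Hslope : forall y, 0 <= y -> phi y = RtoC 0 -> y <= Y /\ d <= Cmod (Cderive phi y)).
  { intros y Hy E.
    assert (HyY : y <= Y).
    { apply Rnot_lt_le; intros Hlt. specialize (hlow y ltac:(lra)). rewrite E, Cmod_0 in hlow.
      assert (P := exp_pos (r * y)). nra. }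
    split; auto. specialize (Hmin y ltac:(lra)). rewrite E, Cmod_0 in Hmin. lra. }
  assert (HLip : forall x y, 0 <= x <= Y + 1 -> 0 <= y <= Y + 1 ->
    Cmod (Cderive phi y - Cderive phi x) <= M * Rabs (y - x)).
  { intros x y Hx Hy. apply (CDer_lipschitz_on (Cderive phi) (Cderive (Cderive phi))); try lra.
    - intros u Hu. apply (exp_bounded_CDer r); auto.
      apply Rle_trans with (Rmin x y). apply Rmin_glb; lra. apply Hu.
    - intros u Hu. apply HMb. split.
      + apply Rle_trans with (Rmin x y). apply Rmin_glb; lra. apply Hu.
      + apply Rle_trans with (Rmax x y). apply Hu. apply Rmax_lub; lra. }
  (* One choice serves two purposes: [M * rho <= d / 4] limits the oscillation of the slope, and
     [4 * rho <= d / M] matches the distance between zeros. *)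
  set (rho := Rmin 1 (d / (4 * M))).
  assert (Hdm : 0 < d / (4 * M)) by (apply Rdiv_lt_0_compat; lra).
  assert (Hrho : 0 < rho <= 1).
  { unfold rho. split. apply Rmin_glb_lt; lra. apply Rmin_l. }
  assert (HrhoM : 4 * rho <= d / M /\ M * rho <= d / 4).
  { assert (Q : rho <= d / (4 * M)) by apply Rmin_r. split.
    - apply Rle_trans with (4 * (d / (4 * M))). lra. right; field; lra.
    - apply Rle_trans with (M * (d / (4 * M))). apply Rmult_le_compat_l; lra. right; field; lra. }
  (* Between two zeros the linear term of size at least [d |x - y|] has to be absorbed by a
     remainder of size [M |x - y|^2]. *)
  assert (Hsep : forall x y, (0 <= x /\ phi x = RtoC 0) -> (0 <= y /\ phi y = RtoC 0) ->
    x <> y -> d / M <= Rabs (x - y)).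
  { intros x y [Hx Ex] [Hy Ey] Hne.
    destruct (Hslope x Hx Ex) as [HxY _]. destruct (Hslope y Hy Ey) as [HyY HyS].
    assert (T : Cmod (phi x - phi y - Cderive phi y * RtoC (x - y)) <= (M * Rabs (x - y)) * Rabs (x - y)).
    { apply (CDer_taylor1 phi (Cderive phi)); auto.
      - intros u Hu. apply (exp_bounded_CDer r); auto.
        apply Rle_trans with (Rmin y x). apply Rmin_glb; lra. apply Hu.
      - intros u Hu.
        assert (Hu1 : 0 <= u). { apply Rle_trans with (Rmin y x). apply Rmin_glb; lra. apply Hu. }
        assert (Hu2 : u <= Y). { apply Rle_trans with (Rmax y x). apply Hu. apply Rmax_lub; lra. }
        eapply Rle_trans. apply HLip; lra. apply Rmult_le_compat_l. lra.
        revert Hu. unfold Rmin, Rmax, Rabs; repeat destruct Rle_dec; repeat destruct Rcase_abs; lra. }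
    rewrite Ex, Ey in T.
    replace (RtoC 0 - RtoC 0 - Cderive phi y * RtoC (x - y))%C with
      (- (Cderive phi y * RtoC (x - y)))%C in T by ring.
    rewrite Cmod_opp, Cmod_mult, Cmod_R in T.
    assert (P : 0 < Rabs (x - y)) by (apply Rabs_pos_lt; lra).
    apply Rmult_le_reg_r in T; auto.
    apply Rmult_le_reg_l with M; auto. replace (M * (d / M)) with d by (field; lra). lra. }
  destruct (separated_finite (fun y => 0 <= y /\ phi y = RtoC 0) Y (d / M)) as [n [z [Z1 [Z2 Z3]]]].
  { now apply Rdiv_lt_0_compat. }
  { intros y [Hy E]. split; auto. now apply Hslope. }
  { exact Hsep. }
  destruct (compact_min (fun y => Cmod (phi y) + tents rho z n y) 0 Y) as [t1 [Ht1 Hmin1]].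
  { lra. } { intros y Hy. apply Rplus_continuous_at_plus; auto. apply tents_continuous. }
  set (k0 := Cmod (phi t1) + tents rho z n t1) in *.
  assert (Hk0 : 0 < k0).
  { unfold k0. assert (P1 := Cmod_ge_0 (phi t1)). assert (P2 := tents_nonneg rho z n t1).
    destruct (classic (phi t1 = RtoC 0)) as [E | E].
    - destruct (Z2 t1) as [i [Hi Ei]]. { split; auto; lra. }
      rewrite Ei in P1 |- *. assert (H := tents_pos rho z n i ltac:(lra) Hi). lra.
    - apply Cmod_gt_0 in E. lra. }
  set (e := exp (- (Rabs r * Y))). assert (He : 0 < e) by apply exp_pos.
  exists n, z, rho, (Rmin m (k0 * e)), d.
  constructor; auto.
  - apply Rmin_glb_lt; auto. now apply Rmult_lt_0_compat.
  - intros i Hi. destruct (Z1 i Hi) as [H1 H2]. split; auto. now apply Hslope.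
  - intros i j Hi Hj Hij. apply Rle_trans with (d / M). lra. apply Hsep; auto.
  - intros y Hy Hfar. assert (P := exp_pos (r * y)).
    destruct (Rle_dec Y y) as [h | h].
    + eapply Rle_trans; [|now apply hlow]. apply Rmult_le_compat_r. lra. apply Rmin_l.
    + specialize (Hmin1 y ltac:(lra)). rewrite tents_outside, Rplus_0_r in Hmin1 by assumption.
      eapply Rle_trans; [|exact Hmin1].
      apply Rle_trans with (k0 * e * exp (r * y)).
      { apply Rmult_le_compat_r. lra. apply Rmin_r. }
      rewrite Rmult_assoc. rewrite <- (Rmult_1_r k0) at 2. apply Rmult_le_compat_l. lra.
      destruct (exp_rate_bound r y Y ltac:(lra)) as [_ Q].
      unfold e. rewrite exp_Ropp.
      assert (P' := exp_pos (Rabs r * Y)).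
      apply Rmult_le_reg_l with (exp (Rabs r * Y)); auto.
      rewrite <- Rmult_assoc, Rinv_r by lra. lra.
  - intros i y Hi Hy Hnear. destruct (Z1 i Hi) as [H1 H2]. destruct (Hslope _ H1 H2) as [HzY _].
    assert (Hy1 : y <= Y + 1). { assert (Q := Rle_abs (y - z i)). lra. }
    eapply Rle_trans. apply HLip; lra.
    apply Rle_trans with (M * rho). apply Rmult_le_compat_l; lra. lra.
  - intros i Hi. destruct (Z1 i Hi) as [H1 H2]. now apply Hslope.
Qed.

(* The node is a minimiser of [Cmod g]: since [g] is nearly affine, its modulus
   grows linearly away from the minimiser whether or not [g] vanishes there. *)
Lemma node_exists (phi g : R -> C) (r : R) n z rho c1 d Y
    (hz : zero_structure phi r n z rho c1 d Y)
    (hg : forall y, 0 <= y -> CDer g y (Cderive g y))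
    (hclose : forall y, 0 <= y <= Y + 1 -> Cmod (Cderive g y - Cderive phi y) <= d / 4)
    (i : nat) (hi : (i < n)%nat) :
  exists t, 0 <= t /\ Rabs (t - z i) <= rho /\
    forall y, 0 <= y -> Rabs (y - z i) <= rho -> d / 4 * Rabs (y - t) <= Cmod (g y).
Proof.
  destruct hz as [Hrho Hc1 Hd HY Hrange Hsep Hfar Hnear Hslope].
  destruct (Hrange i hi) as [Hz0 HzY].
  assert (Hball : forall y, Rmax 0 (z i - rho) <= y <= z i + rho <-> 0 <= y /\ Rabs (y - z i) <= rho).
  { intros y. unfold Rmax, Rabs; destruct Rle_dec; destruct Rcase_abs; split; intros; lra. }
  destruct (compact_min (fun y => Cmod (g y)) (Rmax 0 (z i - rho)) (z i + rho)) as [t [Ht Hmin]].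
  { split. apply Rmax_l. apply Rmax_lub; lra. }
  { intros y Hy. apply Hball in Hy. apply Rplus_continuous_at_Cmod. lra.
    eapply Cex_derive_intro. now apply hg. }
  exists t. assert (Ht' := proj1 (Hball t) Ht). split; [lra|]. split; [lra|].
  intros y Hy Hyb.
  assert (Hyt := proj2 (Hball y) (conj Hy Hyb)).
  set (D := Cderive phi (z i)).
  assert (T : Cmod (g y - g t - D * RtoC (y - t)) <= d / 2 * Rabs (y - t)).
  { apply (CDer_taylor1 g (Cderive g)); try lra; intros u Hu;
      (assert (Hu' : 0 <= u /\ Rabs (u - z i) <= rho);
       [apply Hball; split;
        [eapply Rle_trans; [|apply Hu]; apply Rmin_glb; lra
        |eapply Rle_trans; [apply Hu|]; apply Rmax_lub; lra]|]).
    - now apply hg.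
    - replace (Cderive g u - D)%C with
        ((Cderive g u - Cderive phi u) + (Cderive phi u - D))%C by ring.
      eapply Rle_trans. apply Cmod_triangle.
      assert (Hu1 : u <= Y + 1). { assert (Q := Rle_abs (u - z i)). lra. }
      specialize (hclose u ltac:(lra)).
      specialize (Hnear i u hi ltac:(lra) ltac:(lra)). fold D in Hnear. lra. }
  (* The slope is at least [d] and the remainder takes [d / 2], so [|g y - g t|] is at least
     [d / 2 * |y - t|]; minimality [|g t| <= |g y|] makes this at most [2 |g y|], hence the factor
     [d / 4]. *)
  assert (T1 := Cmod_triangle (g y - g t) (- (g y - g t - D * RtoC (y - t)))).
  replace (g y - g t + - (g y - g t - D * RtoC (y - t)))%C with (D * RtoC (y - t))%C in T1 by ring.
  rewrite Cmod_opp, Cmod_mult, Cmod_R in T1.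
  assert (T2 := Cmod_triangle (g y) (- g t)). rewrite Cmod_opp in T2.
  replace (g y + - g t)%C with (g y - g t)%C in T2 by ring.
  specialize (Hmin y Hyt). specialize (Hslope i hi). fold D in Hslope.
  assert (P := Rabs_pos (y - t)).
  assert (d * Rabs (y - t) <= Cmod D * Rabs (y - t)) by (apply Rmult_le_compat_r; auto).
  lra.
Qed.

(** * Interpolation at the nodes *)

Section Interpolation.

Variables (t : R -> nat -> R) (n : nat) (T s : R).
Hypothesis hs : 0 < s <= 1.
Hypothesis ht : forall nu i, 0 < nu <= 1 -> (i < n)%nat -> 0 <= t nu i <= T.
Hypothesis hsep : forall nu i j, 0 < nu <= 1 -> (i < n)%nat -> (j < n)%nat -> i <> j ->
  s <= Rabs (t nu i - t nu j).

Fixpoint nodal (m : nat) (nu y : R) : C :=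
  match m with
  | O => RtoC 1
  | S k => (nodal k nu y * RtoC (y - t nu k))%C
  end.

Lemma family_nodal m : (m <= n)%nat -> bounded_family (INR m) (nodal m).
Proof.
  induction m; intros Hm.
  - simpl. apply (family_const (fun _ => RtoC 1) 1). intros; rewrite Cmod_1; lra.
  - rewrite S_INR. apply (family_mult (INR m) 1 (nodal m) (fun nu y => RtoC (y - t nu m))).
    + apply IHm; lia.
    + apply (family_node (fun nu => t nu m) T). intros nu Hnu.
      rewrite Rabs_pos_eq; apply ht; auto.
Qed.

Lemma nodal_at_node m nu i : (i < m)%nat -> nodal m nu (t nu i) = RtoC 0.
Proof.
  intros Hi. induction m; simpl. lia. destruct (Nat.eq_dec i m) as [-> | Hne].
  - rewrite Rminus_diag. ring.
  - rewrite IHm by lia. ring.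
Qed.

Lemma pow_s_decr m : 0 < s ^ m <= 1.
Proof.
  split. apply pow_lt; lra. rewrite <- (pow1 m). apply pow_incr; lra.
Qed.

Lemma nodal_lower m nu i : 0 < nu <= 1 -> (m <= i < n)%nat ->
  s ^ m <= Cmod (nodal m nu (t nu i)).
Proof.
  intros Hnu Hi. induction m; simpl.
  - rewrite Cmod_1. lra.
  - rewrite Cmod_mult, Cmod_R, Rmult_comm. apply Rmult_le_compat.
    + left; apply pow_s_decr. + lra. + apply IHm; lia. + apply hsep; auto; lia.
Qed.

(** At a node the derivative of the product is the product of its differences to the other nodes:
    [m - 1] factors of modulus at least [s], so [s ^ m] is a safe bound as [s <= 1]. *)
Lemma nodal_derive_lower m nu i : 0 < nu <= 1 -> (m <= n)%nat -> (i < m)%nat ->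
  s ^ m <= Cmod (Cderive (nodal m nu) (t nu i)).
Proof.
  intros Hnu. induction m; intros Hm Hi. lia.
  assert (Hti : 0 <= t nu i) by (apply ht; auto; lia).
  assert (HD : CDer (nodal (S m) nu) (t nu i)
    (Cderive (nodal m nu) (t nu i) * RtoC (t nu i - t nu m) + nodal m nu (t nu i) * RtoC 1)%C).
  { apply (CDer_mult (nodal m nu) (fun y => RtoC (y - t nu m))); auto.
    - apply (family_CDer (INR m)); auto. apply family_nodal; lia.
    - apply (CDer_RtoC_is_derive (fun y => y - t nu m)); auto. auto_derive; auto. }
  rewrite (CDer_eq _ _ _ Hti HD). simpl.
  destruct (Nat.eq_dec i m) as [-> | Hne].
  - rewrite Rminus_diag.
    replace (Cderive (nodal m nu) (t nu m) * RtoC 0 + nodal m nu (t nu m) * RtoC 1)%C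
      with (nodal m nu (t nu m)) by ring.
    eapply Rle_trans; [|apply nodal_lower; auto; lia].
    assert (Q := pow_s_decr m). nra.
  - rewrite (nodal_at_node m nu i) by lia.
    replace (Cderive (nodal m nu) (t nu i) * RtoC (t nu i - t nu m) + RtoC 0 * RtoC 1)%C
      with (Cderive (nodal m nu) (t nu i) * RtoC (t nu i - t nu m))%C by ring.
    rewrite Cmod_mult, Cmod_R, Rmult_comm. apply Rmult_le_compat.
    + left; apply pow_s_decr. + lra. + apply IHm; lia. + apply hsep; auto; lia.
Qed.

(* Newton's form of the interpolation polynomial. *)
Lemma interpolation (v : R -> nat -> C) (V : R)
    (hv : forall nu i, 0 < nu <= 1 -> (i < n)%nat -> Cmod (v nu i) <= V) m :
  (m <= n)%nat -> exists L, bounded_family (INR m) L /\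
    forall nu i, 0 < nu <= 1 -> (i < m)%nat -> L nu (t nu i) = v nu i.
Proof.
  induction m; intros Hm.
  - exists (fun _ _ => RtoC 0). split. apply family_zero. intros; lia.
  - destruct IHm as [L [HL EL]]. lia.
    destruct (family_bound _ _ HL) as [K [HK Kb]].
    set (b := fun nu => ((v nu m - L nu (t nu m)) * / nodal m nu (t nu m))%C).
    assert (Hn0 : forall nu, 0 < nu <= 1 -> nodal m nu (t nu m) <> RtoC 0).
    { intros nu Hnu E. assert (Q := nodal_lower m nu m Hnu ltac:(lia)).
      rewrite E, Cmod_0 in Q. assert (Q' := pow_s_decr m). lra. }
    exists (fun nu y => L nu y + b nu * nodal m nu y)%C. split.
    + apply family_plus.
      * apply (family_weaken (INR m)); auto. apply le_INR; lia.
      * apply (family_weaken (INR m)). apply le_INR; lia.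
        (* The bound on the Newton coefficient: prescribed value plus the earlier interpolant at a
           node below [T], divided by the lower bound on the nodal product. *)
        apply (family_scal (INR m) (nodal m) b ((V + K * exp (INR m * T)) * / s ^ m)).
        -- intros nu Hnu. unfold b. rewrite Cmod_mult, Cmod_inv by auto.
           assert (Q := nodal_lower m nu m Hnu ltac:(lia)).
           assert (Q' := pow_s_decr m).
           apply Rmult_le_compat.
           ++ apply Cmod_ge_0.
           ++ left. apply Rinv_0_lt_compat. lra.
           ++ unfold Cminus. eapply Rle_trans. apply Cmod_triangle. rewrite Cmod_opp.
              destruct (ht nu m Hnu ltac:(lia)) as [Ht1 Ht2].
              apply Rplus_le_compat. apply hv; auto.
              eapply Rle_trans. apply Kb; auto. apply Rmult_le_compat_l. lra.
              apply exp_le. apply Rmult_le_compat_l; auto. apply pos_INR.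
           ++ apply Rinv_le_contravar; lra.
        -- apply family_nodal; lia.
    + intros nu i Hnu Hi. destruct (Nat.eq_dec i m) as [-> | Hne].
      * unfold b. field. auto.
      * rewrite EL, nodal_at_node by (auto; lia). ring.
Qed.

End Interpolation.

(** The rate is forgotten: pointwise identities between iterated derivatives need only repeated
    differentiability, and this class is closed under all operations involved. *)
Definition tame (f : R -> C) : Prop := exists eta, exp_bounded eta f.

Lemma tame_plus f g : tame f -> tame g -> tame (fun y => f y + g y)%C.
Proof.
  intros [a Hf] [b Hg]. exists (Rmax a b).
  apply (family_plus _ (fun _ => f) (fun _ => g)).
  - apply (family_weaken a); auto. apply Rmax_l.
  - apply (family_weaken b); auto. apply Rmax_r.
Qed.

Lemma tame_mult f g : tame f -> tame g -> tame (fun y => f y * g y)%C.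
Proof.
  intros [a Hf] [b Hg]. exists (a + b). now apply (family_mult a b (fun _ => f) (fun _ => g)).
Qed.

Lemma tame_scal a f : tame f -> tame (fun y => a * f y)%C.
Proof. intros [b Hf]. exists b. now apply (family_scal_const b (fun _ => f)). Qed.

Lemma tame_derive f : tame f -> tame (Cderive f).
Proof. intros [b Hf]. exists b. now apply exp_bounded_derive. Qed.

Lemma tame_CDer f y : tame f -> 0 <= y -> CDer f y (Cderive f y).
Proof. intros [b Hf]. now apply (exp_bounded_CDer b). Qed.

Fixpoint fpow (A : R -> C) (k : nat) (y : R) : C :=
  match k with O => RtoC 1 | S m => (A y * fpow A m y)%C end.

Lemma tame_fpow A k : tame A -> tame (fpow A k).
Proof.
  intros HA. induction k.
  - exists 0. apply (family_const (fun _ => RtoC 1) 1). intros; rewrite Cmod_1; lra.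
  - now apply (tame_mult A (fpow A k)).
Qed.

(** The cofactor left when [A^k B] is differentiated and one power of [A] is spared:
    [(A^k B)' = A^(k-1) (k A' B + A B')]. Iterating it reaches the fourth derivative without a
    general Leibniz formula. *)
Definition lower_power (A B : R -> C) (k : nat) (y : R) : C :=
  (RtoC (INR k) * (Cderive A y * B y) + A y * Cderive B y)%C.

Lemma tame_lower_power A B k : tame A -> tame B -> tame (lower_power A B k).
Proof.
  intros HA HB. apply (tame_plus (fun y => RtoC (INR k) * (Cderive A y * B y))%C
    (fun y => A y * Cderive B y)%C).
  - apply (tame_scal _ (fun y => Cderive A y * B y)%C).
    apply tame_mult; auto. now apply tame_derive.
  - apply tame_mult; auto. now apply tame_derive.
Qed.

Lemma CDer_fpow A k y : tame A -> 0 <= y ->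
  CDer (fpow A (S k)) y (RtoC (INR (S k)) * Cderive A y * fpow A k y)%C.
Proof.
  intros HA Hy. assert (DA := tame_CDer A y HA Hy). induction k.
  - replace (RtoC (INR 1) * Cderive A y * fpow A 0 y)%C
      with (Cderive A y * RtoC 1 + A y * RtoC 0)%C by (simpl; ring).
    apply (CDer_mult A (fun _ => RtoC 1)); auto. now apply CDer_const.
  - replace (RtoC (INR (S (S k))) * Cderive A y * fpow A (S k) y)%C
      with (Cderive A y * fpow A (S k) y
        + A y * (RtoC (INR (S k)) * Cderive A y * fpow A k y))%C.
    + now apply (CDer_mult A (fpow A (S k))).
    + rewrite (S_INR (S k)), RtoC_plus. simpl fpow. ring.
Qed.

Lemma CDer_fpow_mult A B k y : tame A -> tame B -> 0 <= y ->
  CDer (fun z => fpow A (S k) z * B z)%C y (fpow A k y * lower_power A B (S k) y)%C.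
Proof.
  intros HA HB Hy.
  replace (fpow A k y * lower_power A B (S k) y)%C with
    ((RtoC (INR (S k)) * Cderive A y * fpow A k y) * B y + fpow A (S k) y * Cderive B y)%C.
  - apply (CDer_mult (fpow A (S k)) B); auto. now apply CDer_fpow. now apply tame_CDer.
  - unfold lower_power. simpl fpow. ring.
Qed.

Lemma dyC_ext (f g : R -> C) j y : (forall z, 0 <= z -> f z = g z) -> tame f -> 0 <= y ->
  dyC j f y = dyC j g y.
Proof.
  revert f g. induction j; intros f g E Hf Hy.
  - exact (E y Hy).
  - rewrite !dyC_S. apply IHj; [| |exact Hy].
    + intros z Hz. apply Cderive_ext; auto. eapply Cex_derive_intro. now apply tame_CDer.
    + now apply tame_derive.
Qed.

(* A fourth-order zero is invisible to the adjoint Rayleigh operator but not to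
   the viscous term, whose value there involves no derivative of [B]. *)
Lemma quartic_zero A B y : tame A -> tame B -> 0 <= y -> A y = RtoC 0 ->
  let X := (fun z => fpow A 4 z * B z)%C in
  X y = RtoC 0 /\ dyC 1 X y = RtoC 0 /\ dyC 2 X y = RtoC 0 /\
  dyC 4 X y = (RtoC 24 * fpow (Cderive A) 4 y * B y)%C.
Proof.
  intros HA HB Hy E X.
  set (B1 := lower_power A B 4). assert (H1 : tame B1) by now apply tame_lower_power.
  set (B2 := lower_power A B1 3). assert (H2 : tame B2) by now apply tame_lower_power.
  set (B3 := lower_power A B2 2). assert (H3 : tame B3) by now apply tame_lower_power.
  set (B4 := lower_power A B3 1). assert (H4 : tame B4) by now apply tame_lower_power.
  assert (TX : forall k D, tame D -> tame (fun z => fpow A k z * D z)%C).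
  { intros k D HD. apply tame_mult; auto. now apply tame_fpow. }
  assert (D1 : forall z, 0 <= z -> Cderive X z = (fpow A 3 z * B1 z)%C).
  { intros z Hz. apply CDer_eq; [exact Hz|]. now apply (CDer_fpow_mult A B 3). }
  assert (D2 : forall z, 0 <= z -> Cderive (fun z => fpow A 3 z * B1 z)%C z = (fpow A 2 z * B2 z)%C).
  { intros z Hz. apply CDer_eq; [exact Hz|]. now apply (CDer_fpow_mult A B1 2). }
  assert (D3 : forall z, 0 <= z -> Cderive (fun z => fpow A 2 z * B2 z)%C z = (fpow A 1 z * B3 z)%C).
  { intros z Hz. apply CDer_eq; [exact Hz|]. now apply (CDer_fpow_mult A B2 1). }
  assert (D4 : forall z, 0 <= z -> Cderive (fun z => fpow A 1 z * B3 z)%C z = (fpow A 0 z * B4 z)%C).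
  { intros z Hz. apply CDer_eq; [exact Hz|]. now apply (CDer_fpow_mult A B3 0). }
  assert (E1 : forall j z, 0 <= z -> dyC (S j) X z = dyC j (fun z => fpow A 3 z * B1 z)%C z).
  { intros j z Hz. rewrite dyC_S. apply dyC_ext; [exact D1| |exact Hz].
    apply tame_derive. now apply (TX 4%nat B). }
  assert (E2 : forall j z, 0 <= z -> dyC (S j) (fun z => fpow A 3 z * B1 z)%C z
    = dyC j (fun z => fpow A 2 z * B2 z)%C z).
  { intros j z Hz. rewrite dyC_S. apply dyC_ext; [exact D2| |exact Hz].
    apply tame_derive. now apply (TX 3%nat B1). }
  assert (E3 : forall j z, 0 <= z -> dyC (S j) (fun z => fpow A 2 z * B2 z)%C z
    = dyC j (fun z => fpow A 1 z * B3 z)%C z).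
  { intros j z Hz. rewrite dyC_S. apply dyC_ext; [exact D3| |exact Hz].
    apply tame_derive. now apply (TX 2%nat B2). }
  split; [|split; [|split]].
  - unfold X. simpl. rewrite E. ring.
  - rewrite E1 by exact Hy. simpl. rewrite E. ring.
  - rewrite E1, E2 by exact Hy. simpl. rewrite E. ring.
  - rewrite E1, E2, E3 by exact Hy.
    change (Cderive (fun z => fpow A 1 z * B3 z)%C y = (RtoC 24 * fpow (Cderive A) 4 y * B y)%C).
    (* Where [A] vanishes each cofactor keeps only its term [k A'] times the previous one, for [k]
       equal to 4, 3, 2, 1, whence 24. *)
    rewrite D4 by exact Hy. unfold B4, B3, B2, B1, lower_power. simpl fpow.
    rewrite E. replace (RtoC 24) with (RtoC (INR 1) * RtoC (INR 2) * RtoC (INR 3) * RtoC (INR 4))%C.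
    + match goal with |- @eq _ ?a ?b => change (@eq C a b) end. ring.
    + rewrite <- !RtoC_mult. f_equal. simpl. ring.
Qed.

Lemma Laplace_Laplace alpha f y : tame f -> 0 <= y ->
  Laplace alpha (Laplace alpha f) y
  = (dyC 4 f y - RtoC 2 * RtoC (IZR alpha ^ 2) * dyC 2 f y
     + RtoC (IZR alpha ^ 2) * RtoC (IZR alpha ^ 2) * f y)%C.
Proof.
  intros [e Hf] Hy. set (a := RtoC (IZR alpha ^ 2)).
  assert (H2 : exp_bounded e (dyC 2 f)) by now apply (family_dyC e (fun _ => f)).
  assert (E : Laplace alpha (Laplace alpha f) y
    = (Laplace alpha (dyC 2 f) y + - a * Laplace alpha f y)%C).
  { rewrite <- (Laplace_linear alpha (dyC 2 f) f (- a)).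
    - apply Laplace_ext; auto.
      + intros z Hz. unfold Laplace. fold a. ring.
      + apply (exp_bounded_twice e). now apply exp_bounded_Laplace.
    - now apply (exp_bounded_twice e).
    - now apply (exp_bounded_twice e).
    - exact Hy. }
  rewrite E. unfold Laplace. fold a.
  change (dyC 2 (dyC 2 f) y) with (dyC 4 f y).
  replace (RtoC 2) with (RtoC 1 + RtoC 1)%C by (rewrite <- RtoC_plus; f_equal; ring). ring.
Qed.

(** * Correction at the nodes *)

Lemma family_fpow eta F k : bounded_family eta F ->
  bounded_family (INR k * eta) (fun nu => fpow (F nu) k).
Proof.
  intros HF. induction k.
  - simpl INR. rewrite Rmult_0_l. apply (family_const (fun _ => RtoC 1) 1).
    intros; rewrite Cmod_1; lra.
  - replace (INR (S k) * eta) with (eta + INR k * eta) by (rewrite S_INR; ring).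
    now apply (family_mult eta (INR k * eta) F (fun nu => fpow (F nu) k)).
Qed.

Lemma Cmod_fpow A k y : Cmod (fpow A k y) = Cmod (A y) ^ k.
Proof.
  induction k; simpl. apply Cmod_1. now rewrite Cmod_mult, IHk.
Qed.

Lemma family_Laplace alpha eta F : bounded_family eta F ->
  bounded_family eta (fun nu => Laplace alpha (F nu)).
Proof.
  intros H. apply (family_minus eta (fun nu => dyC 2 (F nu))
    (fun nu y => RtoC (IZR alpha ^ 2) * F nu y)%C).
  - now apply family_dyC.
  - now apply family_scal_const.
Qed.

Lemma family_bound_C1 eta F : bounded_family eta F ->
  exists K, 0 < K /\ forall nu y, 0 < nu <= 1 -> 0 <= y ->
    Cmod (F nu y) <= K * exp (eta * y) /\ Cmod (Cderive (F nu) y) <= K * exp (eta * y).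
Proof.
  intros H. destruct (family_bound _ _ H) as [K [HK Hb]].
  destruct (family_bound _ _ (family_derive _ _ H)) as [K' [HK' Hb']].
  exists (K + K'). split. lra. intros nu y Hnu Hy.
  specialize (Hb nu y Hnu Hy). specialize (Hb' nu y Hnu Hy).
  assert (P := exp_pos (eta * y)). split; nra.
Qed.

(** Serves both the correction and the residual, which vanish at the nodes: each becomes bounded by
    the distance to the node, with a constant free of [nu]. *)
Lemma family_lipschitz_at_zero eta F K a b nu Z : bounded_family eta F ->
  0 < nu <= 1 -> 0 < K -> 0 <= a <= Z -> 0 <= b <= Z ->
  (forall y, 0 <= y -> Cmod (Cderive (F nu) y) <= K * exp (eta * y)) ->
  F nu a = RtoC 0 -> Cmod (F nu b) <= K * exp (Rabs eta * Z) * Rabs (b - a).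
Proof.
  intros HF Hnu HK Ha Hb Hd E0.
  replace (F nu b) with (F nu b - F nu a)%C by (rewrite E0; ring).
  apply (CDer_lipschitz_on (F nu) (Cderive (F nu))); try lra; intros y Hy.
  - apply (family_CDer eta F); auto. apply Rle_trans with (Rmin a b); [|apply Hy].
    apply Rmin_glb; lra.
  - assert (Hy0 : 0 <= y). { apply Rle_trans with (Rmin a b); [|apply Hy]. apply Rmin_glb; lra. }
    assert (HyZ : y <= Z). { apply Rle_trans with (Rmax a b); [apply Hy|]. apply Rmax_lub; lra. }
    eapply Rle_trans. now apply Hd. apply Rmult_le_compat_l. lra.
    now apply exp_rate_bound.
Qed.

Section Approximation.

Variables (Us : R -> R) (alpha : Z) (c : C) (eta : R).
Hypothesis pf : profile_facts Us c eta.
Hypothesis hc : 0 < Im c.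
Local Notation w := (shifted Us c).
Local Notation Ray := (Ray_adj Us alpha c).
Local Notation Lap := (Laplace alpha).
Local Notation Orr := (Orr_adj Us alpha c).
Local Notation visc := (visc alpha).

Variables (r : R) (psi : nat -> R -> C) (N : nat).
Hypothesis hpsi : forall k, exp_bounded r (psi k).
Hypothesis hR0 : forall y, 0 <= y -> Ray (psi 0%nat) y = RtoC 0.
Hypothesis hRS : forall k y, 0 <= y -> Ray (psi (S k)) y = (- visc * Lap (Lap (psi k)) y)%C.

Variables (n : nat) (z : nat -> R) (rho c1 d Y : R).
Hypothesis hz : zero_structure (psi 0%nat) r n z rho c1 d Y.

Definition truncated (nu y : R) : C := (psi 0%nat y + RtoC nu * corrector psi (S N) nu y)%C.

Lemma family_nu : bounded_family 0 (fun nu _ => RtoC nu).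
Proof.
  apply (family_const (fun nu => RtoC nu) 1). intros nu Hnu. rewrite Cmod_R, Rabs_pos_eq; lra.
Qed.

Lemma family_truncated : bounded_family r truncated.
Proof.
  apply (family_plus r (fun _ => psi 0%nat) (fun nu y => RtoC nu * corrector psi (S N) nu y)%C).
  - apply hpsi.
  - rewrite <- (Rplus_0_l r). apply (family_mult 0 r (fun nu _ => RtoC nu)).
    apply family_nu. now apply family_corrector.
Qed.

(** The location bounds are asked for every [nu], so that correction and interpolation work on all
    of [0 < nu <= 1]; only the linear lower bound requires [nu] small. *)
Lemma nodes_exist : exists (t : R -> nat -> R) (nu1 : R), 0 < nu1 <= 1 /\
  forall nu i, (i < n)%nat -> 0 <= t nu i /\ Rabs (t nu i - z i) <= rho /\
    (0 < nu <= nu1 -> forall y, 0 <= y -> Rabs (y - z i) <= rho ->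
      d / 4 * Rabs (y - t nu i) <= Cmod (truncated nu y)).
Proof.
  destruct (family_bound_C1 r (corrector psi (S N))) as [K [HK Hb]]. now apply family_corrector.
  assert (Hrho := zs_rho _ _ _ _ _ _ _ _ hz). assert (Hd := zs_d _ _ _ _ _ _ _ _ hz).
  set (E := exp (Rabs r * (Y + 1))). assert (HE : 0 < E) by apply exp_pos.
  assert (HKE : 0 < K * E) by now apply Rmult_lt_0_compat.
  (* Below [nu1] the derivative of [nu * corrector] is at most [d / 4] on [[0, Y + 1]], the
     closeness that [node_exists] assumes. *)
  set (nu1 := Rmin 1 (d / 4 / (K * E))).
  assert (Hnu1 : 0 < nu1 <= 1).
  { split; [apply Rmin_glb_lt; [lra|apply Rdiv_lt_0_compat; lra]|apply Rmin_l]. }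
  assert (H : forall nu i, exists t, (i < n)%nat -> 0 <= t /\ Rabs (t - z i) <= rho /\
    (0 < nu <= nu1 -> forall y, 0 <= y -> Rabs (y - z i) <= rho ->
      d / 4 * Rabs (y - t) <= Cmod (truncated nu y))).
  { intros nu i. destruct (classic ((i < n)%nat /\ 0 < nu <= nu1)) as [[Hi Hnu] | Hno].
    - destruct (node_exists (psi 0%nat) (truncated nu) r n z rho c1 d Y hz) with (i := i)
        as [t [H1 [H2 H3]]]; auto.
      + intros y Hy. apply (family_CDer r truncated); auto. apply family_truncated. lra.
      + intros y Hy.
        assert (D1 : CDer (truncated nu) y
          (Cderive (psi 0%nat) y + RtoC nu * Cderive (corrector psi (S N) nu) y)%C).
        { apply CDer_plus; try lra. apply (exp_bounded_CDer r); auto; lra.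
          apply CDer_scal; try lra. apply (family_CDer r); try lra. now apply family_corrector. }
        rewrite (CDer_eq _ _ _ (proj1 Hy) D1).
        replace (Cderive (psi 0%nat) y + RtoC nu * Cderive (corrector psi (S N) nu) y
          - Cderive (psi 0%nat) y)%C with (RtoC nu * Cderive (corrector psi (S N) nu) y)%C by ring.
        rewrite Cmod_mult, Cmod_R, Rabs_pos_eq by lra.
        apply Rle_trans with (d / 4 / (K * E) * (K * E)).
        * apply Rmult_le_compat; try lra. apply Cmod_ge_0.
          -- apply Rle_trans with nu1. lra. apply Rmin_r.
          -- eapply Rle_trans. apply Hb; lra. apply Rmult_le_compat_l. lra.
             now apply exp_rate_bound.
        * right. field. lra.
      + exists t. auto.
    (* Default node outside the range of small [nu]: the zero itself. *)
    - exists (z i). intros Hi.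
      destruct (zs_range _ _ _ _ _ _ _ _ hz i Hi). rewrite Rminus_diag, Rabs_R0.
      split; [lra|]. split; [lra|]. intros Hnu. exfalso. apply Hno. auto. }
  exists (fun nu i => proj1_sig (constructive_indefinite_description _ (H nu i))), nu1.
  split; auto. intros nu i.
  exact (proj2_sig (constructive_indefinite_description _ (H nu i))).
Qed.

(** The defect of the corrected sum with [nu^(N+1)] factored out. The Rayleigh part of [X] has no
    power of [nu] to spare, so [X], [X'] and [X''] must vanish at the nodes, while the viscous
    bracket is annihilated by [X'''']. *)
Definition residual (X : R -> R -> C) (nu y : R) : C :=
  (w y * Lap (X nu) y + RtoC 2 * RtoC (dyR 1 Us y) * Cderive (X nu) y
   + RtoC nu * visc * (Lap (Lap (psi (S N))) y + Lap (Lap (X nu)) y))%C.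

Lemma family_residual X : bounded_family r X -> bounded_family r (residual X).
Proof.
  intros HX.
  apply (family_plus r
    (fun nu y => w y * Lap (X nu) y + RtoC 2 * RtoC (dyR 1 Us y) * Cderive (X nu) y)%C
    (fun nu y => RtoC nu * visc * (Lap (Lap (psi (S N))) y + Lap (Lap (X nu)) y))%C).
  - apply (family_plus r (fun nu y => w y * Lap (X nu) y)%C
      (fun nu y => RtoC 2 * RtoC (dyR 1 Us y) * Cderive (X nu) y)%C).
    + rewrite <- (Rplus_0_l r). apply (family_mult 0 r (fun _ => w) (fun nu => Lap (X nu))).
      apply (pf_w _ _ _ pf). now apply family_Laplace.
    + apply (family_weaken (- eta + r)). { assert (H := pf_eta _ _ _ pf). lra. }
      apply (family_mult (- eta) r (fun _ y => RtoC 2 * RtoC (dyR 1 Us y))%C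
        (fun nu => Cderive (X nu))).
      * apply (family_scal_const _ (fun _ y => RtoC (dyR 1 Us y))). apply (pf_U1 _ _ _ pf).
      * now apply family_derive.
  - rewrite <- (Rplus_0_l r).
    apply (family_mult 0 r (fun nu _ => RtoC nu * visc)%C
      (fun nu y => Lap (Lap (psi (S N))) y + Lap (Lap (X nu)) y)%C).
    + rewrite <- (Rplus_0_l 0). apply (family_mult 0 0 (fun nu _ => RtoC nu) (fun _ _ => visc)).
      apply family_nu. apply (family_const (fun _ => visc) (Cmod visc)). intros; lra.
    + apply (family_plus r (fun _ => Lap (Lap (psi (S N)))) (fun nu => Lap (Lap (X nu)))).
      * apply exp_bounded_Laplace. now apply exp_bounded_Laplace.
      * apply (family_Laplace alpha r (fun nu => Lap (X nu))). now apply family_Laplace.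
Qed.

Lemma Orr_adj_residual X nu y : bounded_family r X -> 0 < nu <= 1 -> 0 <= y ->
  Orr nu (fun y => truncated nu y + RtoC (nu ^ (N + 1)) * X nu y)%C y
  = (RtoC (nu ^ (N + 1)) * residual X nu y)%C.
Proof.
  intros HX Hnu Hy.
  rewrite (Orr_adj_linear Us alpha c eta pf nu r r (truncated nu) (X nu)); auto.
  - unfold truncated. rewrite (Orr_adj_expansion Us alpha c eta pf r psi (S N)) by assumption.
    rewrite (Orr_adj_expand Us alpha c eta pf) by
      (auto; apply (exp_bounded_twice r); now apply family_exp_bounded).
    unfold residual. rewrite Nat.add_1_r. change (nu ^ S (S N)) with (nu * nu ^ S N).
    rewrite RtoC_mult. ring.
  - apply family_exp_bounded; auto. apply family_truncated.
  - now apply family_exp_bounded.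
Qed.

Lemma correction_exists (t : R -> nat -> R)
    (ht : forall nu i, (i < n)%nat -> 0 <= t nu i /\ Rabs (t nu i - z i) <= rho) :
  exists X, bounded_family r X /\ forall nu i, 0 < nu <= 1 -> (i < n)%nat ->
    X nu (t nu i) = RtoC 0 /\ residual X nu (t nu i) = RtoC 0.
Proof.
  assert (Hrho := zs_rho _ _ _ _ _ _ _ _ hz).
  assert (Hrange : forall nu i, 0 < nu <= 1 -> (i < n)%nat -> 0 <= t nu i <= Y + 1).
  { intros nu i _ Hi. destruct (ht nu i Hi) as [H1 H2].
    destruct (zs_range _ _ _ _ _ _ _ _ hz i Hi).
    assert (Q := Rle_abs (t nu i - z i)). lra. }
  assert (Hsep : forall nu i j, 0 < nu <= 1 -> (i < n)%nat -> (j < n)%nat -> i <> j ->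
    rho <= Rabs (t nu i - t nu j)).
  { intros nu i j _ Hi Hj Hij. destruct (ht nu i Hi) as [_ H1]. destruct (ht nu j Hj) as [_ H2].
    assert (H3 := zs_sep _ _ _ _ _ _ _ _ hz i j Hi Hj Hij).
    revert H1 H2 H3. unfold Rabs; repeat destruct Rcase_abs; lra. }
  set (Theta := nodal t n).
  assert (HTheta : bounded_family (INR n) Theta).
  { apply (family_nodal t n (Y + 1) Hrange n (le_n n)). }
  set (F := Lap (Lap (psi (S N)))).
  assert (HF : exp_bounded r F).
  { apply exp_bounded_Laplace. now apply exp_bounded_Laplace. }
  destruct (exp_bounded_bound _ _ HF) as [KF [HKF BF]].
  (* The fourth power of the nodal product costs rate [4 n] and the interpolant [n]; the factor
     [exp (- kappa * y)] brings the total to [- Rabs r], which is at most [r]. *)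
  set (kappa := 5 * INR n + Rabs r).
  assert (Pk : 0 <= kappa).
  { unfold kappa. assert (P1 := pos_INR n). assert (P2 := Rabs_pos r). lra. }
  (* The value that makes [24 Theta'^4 B] equal to [- F] at the node, multiplied by
     [exp (kappa * t)] to undo the damping built into [B]. *)
  set (v := fun nu i => (- (F (t nu i) * RtoC (exp (kappa * t nu i)))
     * / (RtoC 24 * fpow (Cderive (Theta nu)) 4 (t nu i)))%C).
  assert (P24 : RtoC 24 <> RtoC 0). { intros E. apply RtoC_inj in E. lra. }
  assert (Hlow : forall nu i, 0 < nu <= 1 -> (i < n)%nat ->
    0 < (rho ^ n) ^ 4 <= Cmod (fpow (Cderive (Theta nu)) 4 (t nu i))).
  { intros nu i Hnu Hi. rewrite Cmod_fpow.
    assert (Q := nodal_derive_lower t n (Y + 1) rho Hrho Hrange Hsep n nu i Hnu (le_n n) Hi).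
    assert (Q0 : 0 < rho ^ n) by (apply pow_lt; lra).
    split. now apply pow_lt. apply pow_incr. split; [lra|exact Q]. }
  assert (Hne : forall nu i, 0 < nu <= 1 -> (i < n)%nat ->
    fpow (Cderive (Theta nu)) 4 (t nu i) <> RtoC 0).
  { intros nu i Hnu Hi E. specialize (Hlow nu i Hnu Hi). rewrite E, Cmod_0 in Hlow. lra. }
  assert (Hv : forall nu i, 0 < nu <= 1 -> (i < n)%nat -> Cmod (v nu i) <=
    (KF * exp (Rabs r * (Y + 1)) * exp (kappa * (Y + 1))) * / (rho ^ n) ^ 4).
  { intros nu i Hnu Hi. unfold v. specialize (Hlow nu i Hnu Hi). specialize (Hne nu i Hnu Hi).
    destruct (Hrange nu i Hnu Hi) as [Ht0 Ht1].
    rewrite Cmod_mult, Cmod_inv, Cmod_opp, !Cmod_mult, !Cmod_R by (now apply Cmult_neq_0).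
    rewrite (Rabs_pos_eq 24) by lra. rewrite (Rabs_pos_eq (exp _)) by (left; apply exp_pos).
    apply Rmult_le_compat.
    - apply Rmult_le_pos. apply Cmod_ge_0. left; apply exp_pos.
    - left. apply Rinv_0_lt_compat. lra.
    - apply Rmult_le_compat. apply Cmod_ge_0. left; apply exp_pos.
      + eapply Rle_trans. now apply BF. apply Rmult_le_compat_l. lra. apply exp_rate_bound. lra.
      + apply exp_le. now apply Rmult_le_compat_l.
    - apply Rinv_le_contravar; lra. }
  destruct (interpolation t n (Y + 1) rho Hrho Hrange Hsep v _ Hv n (le_n n)) as [L [HL EL]].
  set (B := fun nu y => (L nu y * RtoC (exp (- kappa * y)))%C).
  assert (HB : bounded_family (INR n + - kappa) B).
  { apply (family_mult (INR n) (- kappa) L (fun _ y => RtoC (exp (- kappa * y)))); auto.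
    apply family_exp. }
  set (X := fun nu y => (fpow (Theta nu) 4 y * B nu y)%C).
  assert (HX : bounded_family r X).
  { apply (family_weaken (INR 4 * INR n + (INR n + - kappa))).
    - unfold kappa. simpl INR. assert (Q := Rle_abs (- r)). rewrite Rabs_Ropp in Q. lra.
    - apply (family_mult _ _ (fun nu => fpow (Theta nu) 4) B); auto. now apply family_fpow. }
  exists X. split; auto. intros nu i Hnu Hi.
  set (y := t nu i). assert (Hy : 0 <= y) by now apply Hrange.
  assert (TX : tame (X nu)). { exists r. now apply family_exp_bounded. }
  destruct (quartic_zero (Theta nu) (B nu) y) as [E0 [E1 [E2 E4]]].
  { exists (INR n). now apply family_exp_bounded. }
  { exists (INR n + - kappa). now apply family_exp_bounded. }
  { exact Hy. }
  { now apply nodal_at_node. }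
  change (X nu y = RtoC 0) in E0. change (dyC 1 (X nu) y = RtoC 0) in E1.
  change (dyC 2 (X nu) y = RtoC 0) in E2.
  change (dyC 4 (X nu) y = (RtoC 24 * fpow (Cderive (Theta nu)) 4 y * B nu y)%C) in E4.
  split. exact E0.
  unfold residual. rewrite (Laplace_Laplace alpha (X nu)) by assumption.
  unfold Laplace at 1. rewrite E0, E2, E4.
  change (Cderive (X nu) y) with (dyC 1 (X nu) y). rewrite E1. fold F.
  assert (EB : (RtoC 24 * fpow (Cderive (Theta nu)) 4 y * B nu y)%C = (- F y)%C).
  { unfold B. unfold y at 2. rewrite EL by assumption. unfold v. fold y.
    assert (Eexp : (RtoC (exp (kappa * y)) * RtoC (exp (- kappa * y)))%C = RtoC 1).
    { rewrite <- RtoC_mult, <- exp_plus. replace (kappa * y + - kappa * y) with 0 by ring.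
      now rewrite exp_0. }
    specialize (Hne nu i Hnu Hi). fold y in Hne.
    transitivity (- F y * (RtoC (exp (kappa * y)) * RtoC (exp (- kappa * y))))%C.
    - field. auto.
    - rewrite Eexp. ring. }
  rewrite EB. ring.
Qed.

(** Two regimes. Away from the zeros the solution is comparable to [exp (r * y)], which dominates
    the residual. Within [rho] of a zero both sides are compared with the distance to the node,
    where the residual vanishes. *)
Lemma approximate_family : exists X nu0 D,
  bounded_family r X /\ 0 < nu0 <= 1 /\ 0 < D /\
  forall nu, 0 < nu <= nu0 ->
    approximate_solution Us alpha c nu N D
      (fun y => truncated nu y + RtoC (nu ^ (N + 1)) * X nu y)%C.
Proof.
  destruct nodes_exist as [t [nu1 [Hnu1 Ht]]].
  destruct (correction_exists t) as [X [HX EX]]. { intros nu i Hi. now split; apply Ht. }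
  assert (Hrho := zs_rho _ _ _ _ _ _ _ _ hz). assert (Hd := zs_d _ _ _ _ _ _ _ _ hz).
  assert (Hc1 := zs_c1 _ _ _ _ _ _ _ _ hz). assert (HY := zs_Y _ _ _ _ _ _ _ _ hz).
  destruct (family_bound _ _ (family_corrector r psi (S N) hpsi)) as [K1 [HK1 B1]].
  destruct (family_bound_C1 _ _ HX) as [KX [HKX BX]].
  destruct (family_bound_C1 _ _ (family_residual X HX)) as [KR [HKR BR]].
  set (E := exp (Rabs r * (Y + 1))). assert (HE : 0 < E) by apply exp_pos.
  assert (HXE : 0 < KX * E) by now apply Rmult_lt_0_compat.
  (* Away from the zeros the corrector and [X] each use a quarter of [c1], leaving [c1 / 2]; near a
     node [X] uses [d / 8] of the available [d / 4]. *)
  set (nu0 := Rmin nu1 (Rmin (c1 / 4 / K1) (Rmin (c1 / 4 / KX) (d / 8 / (KX * E))))).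
  assert (Hnu0 : 0 < nu0).
  { repeat apply Rmin_glb_lt; try lra; apply Rdiv_lt_0_compat; lra. }
  assert (Hle : nu0 <= nu1 /\ nu0 * K1 <= c1 / 4 /\ nu0 * KX <= c1 / 4 /\ nu0 * (KX * E) <= d / 8).
  { assert (Hq : forall a b, 0 < a -> nu0 <= b / a -> nu0 * a <= b).
    { intros a b Ha Hb. apply Rle_trans with (b / a * a). apply Rmult_le_compat_r; lra.
      right; field; lra. }
    repeat split; try (apply Hq; auto).
    - apply Rmin_l.
    - eapply Rle_trans. apply Rmin_r. apply Rmin_l.
    - eapply Rle_trans. apply Rmin_r. eapply Rle_trans. apply Rmin_r. apply Rmin_l.
    - eapply Rle_trans. apply Rmin_r. eapply Rle_trans. apply Rmin_r. apply Rmin_r. }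
  destruct Hle as [L1 [L2 [L3 L4]]].
  (* The first summand is the constant of the far regime, the second that of the near regime. *)
  exists X, nu0, (2 * KR / c1 + 8 * (KR * E) / d).
  assert (HD1 : 0 < 2 * KR / c1) by (apply Rdiv_lt_0_compat; lra).
  assert (HRE : 0 < KR * E) by now apply Rmult_lt_0_compat.
  assert (HD2 : 0 < 8 * (KR * E) / d) by (apply Rdiv_lt_0_compat; lra).
  split; [exact HX|]. split; [lra|]. split; [lra|].
  intros nu Hnu y Hy. assert (Hnu' : 0 < nu <= 1) by lra.
  rewrite Orr_adj_residual by assumption.
  set (phi := (truncated nu y + RtoC (nu ^ (N + 1)) * X nu y)%C).
  assert (Hp : 0 < nu ^ (N + 1)) by (apply pow_lt; lra).
  assert (Hp1 : nu ^ (N + 1) <= nu).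
  { rewrite Nat.add_1_r. simpl. assert (Q : nu ^ N <= 1) by (rewrite <- (pow1 N); apply pow_incr; lra). nra. }
  rewrite Cmod_mult, Cmod_R, Rabs_pos_eq by lra.
  rewrite (Rmult_comm _ (nu ^ (N + 1))), Rmult_assoc. apply Rmult_le_compat_l. lra.
  assert (Pphi := Cmod_ge_0 phi).
  assert (Tphi : Cmod (truncated nu y) - nu * Cmod (X nu y) <= Cmod phi).
  { assert (T := Cmod_triangle phi (- (RtoC (nu ^ (N + 1)) * X nu y))).
    replace (phi + - (RtoC (nu ^ (N + 1)) * X nu y))%C with (truncated nu y) in T
      by (unfold phi; ring).
    rewrite Cmod_opp, Cmod_mult, Cmod_R, Rabs_pos_eq in T by lra.
    assert (nu ^ (N + 1) * Cmod (X nu y) <= nu * Cmod (X nu y)).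
    { apply Rmult_le_compat_r; auto. apply Cmod_ge_0. }
    lra. }
  destruct (BX nu y Hnu' Hy) as [BX0 BX1]. destruct (BR nu y Hnu' Hy) as [BR0 BR1].
  destruct (classic (forall i, (i < n)%nat -> rho < Rabs (y - z i))) as [Hfar | Hnear].
  - assert (Hl := zs_far _ _ _ _ _ _ _ _ hz y Hy Hfar).
    assert (P := exp_pos (r * y)). set (e := exp (r * y)) in *.
    assert (T := Cmod_triangle (truncated nu y) (- (RtoC nu * corrector psi (S N) nu y))).
    replace (truncated nu y + - (RtoC nu * corrector psi (S N) nu y))%C with (psi 0%nat y) in T
      by (unfold truncated; ring).
    rewrite Cmod_opp, Cmod_mult, Cmod_R, Rabs_pos_eq in T by lra.
    specialize (B1 nu y Hnu' Hy). fold e in B1.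
    assert (Q1 : nu * Cmod (corrector psi (S N) nu y) <= c1 / 4 * e).
    { apply Rle_trans with (nu0 * (K1 * e)).
      - apply Rmult_le_compat; try lra. apply Cmod_ge_0.
      - rewrite <- Rmult_assoc. apply Rmult_le_compat_r; lra. }
    assert (Q2 : nu * Cmod (X nu y) <= c1 / 4 * e).
    { apply Rle_trans with (nu0 * (KX * e)).
      - apply Rmult_le_compat; try lra. apply Cmod_ge_0.
      - rewrite <- Rmult_assoc. apply Rmult_le_compat_r; lra. }
    assert (Q3 : c1 / 2 * e <= Cmod phi) by lra.
    apply Rle_trans with (2 * KR / c1 * Cmod phi).
    + apply Rle_trans with (2 * KR / c1 * (c1 / 2 * e)).
      * eapply Rle_trans; [exact BR0|]. right. field. lra.
      * apply Rmult_le_compat_l; lra.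
    + apply Rmult_le_compat_r; lra.
  - apply not_all_ex_not in Hnear. destruct Hnear as [i Hi].
    apply imply_to_and in Hi. destruct Hi as [Hi Hyi]. apply Rnot_lt_le in Hyi.
    destruct (Ht nu i Hi) as [Ht0 [Htz Hlow]].
    specialize (Hlow ltac:(lra) y Hy Hyi).
    destruct (zs_range _ _ _ _ _ _ _ _ hz i Hi) as [Hz0 HzY].
    assert (Hy1 : 0 <= y <= Y + 1). { assert (Q := Rle_abs (y - z i)). lra. }
    assert (Ht1 : 0 <= t nu i <= Y + 1). { assert (Q := Rle_abs (t nu i - z i)). lra. }
    destruct (EX nu i Hnu' Hi) as [EX0 ER0].
    assert (Q1 := family_lipschitz_at_zero r X KX _ y nu (Y + 1) HX Hnu' HKX Ht1 Hy1
      (fun x Hx => proj2 (BX nu x Hnu' Hx)) EX0).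
    assert (Q2 := family_lipschitz_at_zero r (residual X) KR _ y nu (Y + 1)
      (family_residual X HX) Hnu' HKR Ht1 Hy1 (fun x Hx => proj2 (BR nu x Hnu' Hx)) ER0).
    fold E in Q1, Q2. set (h := Rabs (y - t nu i)) in *. assert (Ph : 0 <= h) by apply Rabs_pos.
    assert (Q3 : nu * Cmod (X nu y) <= d / 8 * h).
    { apply Rle_trans with (nu0 * (KX * E * h)).
      - apply Rmult_le_compat; try lra. apply Cmod_ge_0.
      - rewrite <- Rmult_assoc. apply Rmult_le_compat_r; lra. }
    assert (Q4 : d / 8 * h <= Cmod phi) by lra.
    apply Rle_trans with (8 * (KR * E) / d * Cmod phi).
    + apply Rle_trans with (8 * (KR * E) / d * (d / 8 * h)).
      * eapply Rle_trans; [exact Q2|]. right. field. lra.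
      * apply Rmult_le_compat_l; lra.
    + apply Rmult_le_compat_r; lra.
Qed.

End Approximation.

(** * The expansion for both branches *)

Lemma rate_opposite alpha s : rate alpha (opposite s) = - rate alpha s.
Proof. destruct s; simpl; ring. Qed.

Lemma expansion_exists Us alpha c N phi_c (halpha : alpha <> 0%Z) (hc : 0 < Im c)
    (hUs : shear_profile Us) (hphi : rayleigh_fundamental Us alpha c phi_c) (s : branch) :
  exists psi X nu0 D,
    psi 0%nat = phi_c s /\ (forall k, exp_bounded (rate alpha s) (psi k)) /\
    bounded_family (rate alpha s) X /\ 0 < nu0 <= 1 /\ 0 < D /\
    forall nu, 0 < nu <= nu0 ->
      approximate_solution Us alpha c nu N D
        (fun y => truncated psi N nu y + RtoC (nu ^ (N + 1)) * X nu y)%C.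
Proof.
  destruct (shear_profile_facts Us c hUs) as [eta pf].
  destruct hphi as [Hs HR Ha _].
  assert (Hb : forall s, exp_bounded (rate alpha s) (phi_c s)).
  { intros s'. apply exp_bounded_of_asymptotic; auto. }
  assert (Hlow : forall s, exists m Y, 0 < m /\ 0 <= Y /\
    forall y, Y <= y -> m * exp (rate alpha s * y) <= Cmod (phi_c s y)).
  { intros s'. destruct (Ha s' 0%nat) as [K [HK HL]].
    destruct (asymptotic_bounds _ _ K HK HL) as [m [M [Y [Hm [_ [HY H]]]]]].
    exists m, Y. split; [|split]; auto. intros y Hy. now apply H. }
  assert (Hr : rate alpha s <> 0).
  { assert (H : IZR alpha <> 0) by (intros E; apply halpha; now apply eq_IZR).
    destruct s; simpl; lra. }
  (* [alpha] may have either sign, so the growing branch is identified by its rate and not by its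
     name; antisymmetry then covers the decaying branch. *)
  assert (HW0 : forall s, 0 < rate alpha s -> exists W, W <> RtoC 0 /\
    forall y, 0 <= y -> wronskian Us c (phi_c s) (phi_c (opposite s)) y = W).
  { intros s' Hr'. destruct (Hlow s') as [m [Y [Hm [HY HL]]]].
    destruct (Hlow (opposite s')) as [m' [Y' [Hm' [HY' HL']]]].
    apply (exists_wronskian Us alpha c eta pf hc (rate alpha s') m (Rmax Y Y')); auto.
    - apply Rle_trans with Y; auto. apply Rmax_l.
    - rewrite <- rate_opposite. apply Hb.
    - intros y Hy. apply HL. eapply Rle_trans; [apply Rmax_l|exact Hy].
    - intros y Hy E. specialize (HL' y (Rle_trans _ _ _ (Rmax_r _ _) Hy)).
      rewrite E, Cmod_0 in HL'. assert (P := exp_pos (rate alpha (opposite s') * y)). nra. }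
  assert (HW : exists W, W <> RtoC 0 /\
    forall y, 0 <= y -> wronskian Us c (phi_c s) (phi_c (opposite s)) y = W).
  { destruct (Rlt_dec 0 (rate alpha s)) as [h | h]. now apply HW0.
    destruct (HW0 (opposite s)) as [W [H1 H2]].
    { rewrite rate_opposite. lra. }
    exists (- W)%C. split.
    - intros E. apply H1. replace W with (- - W)%C by ring. rewrite E. ring.
    - intros y Hy. rewrite wronskian_swap, <- (H2 y Hy). now destruct s. }
  destruct HW as [W [HW1 HW2]].
  assert (Hopp := Hb (opposite s)). rewrite rate_opposite in Hopp.
  destruct (expansion_coefficients Us alpha c eta pf hc (rate alpha s) (phi_c s))
    as [psi [E0 [Hpsi HRS]]]; auto.
  { intros h Hh.
    apply (Ray_adj_solve Us alpha c pf hc (rate alpha s) (phi_c s) (phi_c (opposite s)) W); auto. }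
  destruct (Hlow s) as [m [Y [Hm [HY HL]]]].
  destruct (zero_structure_exists (phi_c s) (rate alpha s) m Y) as [n [z [rho [c1 [d Hz]]]]]; auto.
  { intros y Hy. apply (Ray_adj_simple_zeros Us c pf (rate alpha s) (phi_c s)
      (phi_c (opposite s)) W); auto. }
  rewrite <- E0 in Hz.
  assert (HR0 : forall y, 0 <= y -> Ray_adj Us alpha c (psi 0%nat) y = RtoC 0).
  { intros y Hy. rewrite E0. now apply HR. }
  destruct (approximate_family Us alpha c eta pf (rate alpha s) psi N Hpsi HR0 HRS
    n z rho c1 d Y Hz) as [X [nu0 [D [H1 [H2 [H3 H4]]]]]].
  exists psi, X, nu0, D. repeat split; auto; apply H2.
Qed.

(** * Derivatives of finite sums and weighted norms *)

Lemma dyC_plus f g j y : tame f -> tame g -> 0 <= y ->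
  dyC j (fun z => f z + g z)%C y = (dyC j f y + dyC j g y)%C.
Proof.
  revert f g. induction j; intros f g Hf Hg Hy. reflexivity.
  rewrite !dyC_S. rewrite <- IHj; auto using tame_derive.
  apply dyC_ext; [|apply tame_derive; now apply tame_plus|exact Hy].
  intros u Hu. apply CDer_eq; [exact Hu|]. apply CDer_plus; [exact Hu| |]; now apply tame_CDer.
Qed.

Lemma dyC_scal a f j y : tame f -> 0 <= y -> dyC j (fun z => a * f z)%C y = (a * dyC j f y)%C.
Proof.
  revert f. induction j; intros f Hf Hy. reflexivity.
  rewrite !dyC_S. rewrite <- IHj; auto using tame_derive.
  apply dyC_ext; [|apply tame_derive; now apply tame_scal|exact Hy].
  intros u Hu. apply CDer_eq; [exact Hu|]. apply CDer_scal; [exact Hu|]. now apply tame_CDer.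
Qed.

Lemma tame_zero : tame (fun _ => RtoC 0).
Proof. exists 0. apply family_zero. Qed.

Lemma dyC_zero j y : 0 <= y -> dyC j (fun _ => RtoC 0) y = RtoC 0.
Proof.
  intros Hy. induction j as [|j IH]. reflexivity.
  rewrite dyC_S. transitivity (dyC j (fun _ => RtoC 0) y); [|exact IH].
  symmetry. apply dyC_ext; [|exact tame_zero|exact Hy].
  intros z Hz. symmetry. apply CDer_eq; [exact Hz|]. now apply CDer_const.
Qed.

Lemma dyC_sum (f : nat -> R -> C) (a : nat -> C) M : (forall k, (k <= M)%nat -> tame (f k)) ->
  tame (fun z => sum_n_m (fun k => f k z * a k)%C 1 M) /\
  forall j y, 0 <= y -> dyC j (fun z => sum_n_m (fun k => f k z * a k)%C 1 M) y
    = sum_n_m (fun k => dyC j (f k) y * a k)%C 1 M.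
Proof.
  induction M; intros Hf.
  - assert (E : forall h : nat -> C, sum_n_m h 1 0 = RtoC 0)
      by (intros h; exact (sum_n_m_zero h 1 0 (Nat.lt_0_succ 0))).
    replace (fun z => sum_n_m (fun k => f k z * a k)%C 1 0) with (fun _ : R => RtoC 0)
      by (apply functional_extensionality; intros; now rewrite E).
    split. apply tame_zero. intros j y Hy. rewrite E. now apply dyC_zero.
  - destruct IHM as [H1 H2]. { intros; apply Hf; lia. }
    set (S0 := fun z => sum_n_m (fun k => f k z * a k)%C 1 M) in *.
    assert (HS : tame (f (S M))) by (apply Hf; lia).
    replace (fun z => sum_n_m (fun k => f k z * a k)%C 1 (S M)) with
      (fun z => S0 z + a (S M) * f (S M) z)%C.
    + split. { apply tame_plus; auto. now apply tame_scal. }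
      intros j y Hy. rewrite dyC_plus, dyC_scal, H2 by (auto; now apply tame_scal).
      rewrite sum_n_Sm by lia. rewrite Cmult_comm. reflexivity.
    + apply functional_extensionality; intros z. rewrite sum_n_Sm by lia.
      unfold S0. rewrite Cmult_comm. reflexivity.
Qed.

Lemma weighted_norm_le (eta K : R) (f : R -> C) :
  (forall y, 0 <= y -> Cmod (f y) <= K * exp (eta * y)) ->
  Rbar_le (weighted_norm (- eta) f) K.
Proof.
  intros H. apply Lub_Rbar_correct. intros x [y [Hy ->]]. simpl.
  apply Rle_trans with (exp (- eta * y) * (K * exp (eta * y))).
  - apply Rmult_le_compat_l; auto. left; apply exp_pos.
  - right. replace (exp (- eta * y) * (K * exp (eta * y)))
      with (K * (exp (- eta * y) * exp (eta * y))) by ring.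
    rewrite <- exp_plus. replace (- eta * y + eta * y) with 0 by ring. rewrite exp_0. ring.
Qed.

(** Only finitely many [k] occur, so adding their individual constants yields one independent of
    [k]. *)
Lemma exp_bounded_dyC_uniform r (psi : nat -> R -> C) M j :
  (forall k, exp_bounded r (psi k)) ->
  exists K, 0 < K /\ forall k y, (k <= M)%nat -> 0 <= y ->
    Cmod (dyC j (psi k) y) <= K * exp (r * y).
Proof.
  intros H.
  assert (H1 : forall k, exists K, 0 < K /\ forall y, 0 <= y ->
    Cmod (dyC j (psi k) y) <= K * exp (r * y)).
  { intros k. apply exp_bounded_bound. apply (family_dyC r (fun _ => psi k)). apply H. }
  induction M as [|M [K [HK IH]]].
  - destruct (H1 0%nat) as [K [HK Hb]]. exists K. split; auto. intros k y Hk Hy.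
    replace k with 0%nat by lia. auto.
  - destruct (H1 (S M)) as [K' [HK' Hb]]. exists (K + K'). split. lra.
    intros k y Hk Hy. assert (P := exp_pos (r * y)).
    destruct (Nat.eq_dec k (S M)) as [-> | Hne].
    + specialize (Hb y Hy). nra.
    + specialize (IH k y ltac:(lia) Hy). nra.
Qed.

(** * Regrouping into exactly [N] coefficients *)

Section Assembly.

Variables (r : R) (psi : nat -> R -> C) (X : R -> R -> C) (N : nat).
Hypothesis hpsi : forall k, exp_bounded r (psi k).
Hypothesis hX : bounded_family r X.
Hypothesis hN : (1 <= N)%nat.

Definition tail_term (nu y : R) : C := (psi (S N) y + X nu y)%C.

(* Everything beyond order [N] is absorbed in the last coefficient. *)
Definition coefficient (nu : R) (k : nat) (y : R) : C :=
  if Nat.eq_dec k N then (psi N y + RtoC nu * tail_term nu y)%C else psi k y.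

Definition assembled (nu y : R) : C :=
  (psi 0%nat y + sum_n_m (fun k => coefficient nu k y * RtoC (nu ^ k))%C 1 N)%C.

Lemma corrector_sum M nu y :
  (RtoC nu * corrector psi M nu y)%C = sum_n_m (fun k => psi k y * RtoC (nu ^ k))%C 1 M.
Proof.
  induction M.
  - rewrite sum_n_m_zero by lia. simpl. change (@zero C_AbelianMonoid) with (RtoC 0). ring.
  - rewrite sum_n_Sm by lia. rewrite <- IHM.
    change (RtoC nu * corrector psi (S M) nu y = RtoC nu * corrector psi M nu y
      + psi (S M) y * RtoC (nu ^ S M))%C.
    simpl. rewrite RtoC_mult. ring.
Qed.

Lemma assembled_eq nu y :
  assembled nu y = (truncated psi N nu y + RtoC (nu ^ (N + 1)) * X nu y)%C.
Proof.
  unfold assembled, truncated. rewrite corrector_sum.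
  destruct N as [|M] eqn:EN. lia.
  rewrite !sum_n_Sm by lia.
  rewrite (sum_n_m_ext_loc (fun k => coefficient nu k y * RtoC (nu ^ k))%C
    (fun k => psi k y * RtoC (nu ^ k))%C).
  - unfold coefficient, tail_term. rewrite EN. destruct (Nat.eq_dec (S M) (S M)); [|congruence].
    set (q := sum_n_m (fun k => psi k y * RtoC (nu ^ k))%C 1 M).
    change (psi 0%nat y + (q + (psi (S M) y + RtoC nu * (psi (S (S M)) y + X nu y)) * RtoC (nu ^ S M))
      = psi 0%nat y + (q + psi (S M) y * RtoC (nu ^ S M) + psi (S (S M)) y * RtoC (nu ^ S (S M)))
        + RtoC (nu ^ (S M + 1)) * X nu y)%C.
    rewrite Nat.add_1_r. change (nu ^ S (S M)) with (nu * nu ^ S M). rewrite !RtoC_mult. ring.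
  - intros k Hk. unfold coefficient. rewrite EN. destruct (Nat.eq_dec k (S M)); [lia|reflexivity].
Qed.

Lemma family_tail_term : bounded_family r tail_term.
Proof. apply (family_plus r (fun _ => psi (S N)) X); auto. apply hpsi. Qed.

Lemma family_coefficient k : bounded_family r (fun nu => coefficient nu k).
Proof.
  unfold coefficient. destruct (Nat.eq_dec k N).
  - apply (family_plus r (fun _ => psi N) (fun nu y => RtoC nu * tail_term nu y)%C).
    apply hpsi.
    rewrite <- (Rplus_0_l r). apply (family_mult 0 r (fun nu _ => RtoC nu)).
    apply family_nu. apply family_tail_term.
  - apply hpsi.
Qed.

Lemma family_assembled : bounded_family r assembled.
Proof.
  apply (family_ext r (fun nu y => truncated psi N nu y + RtoC (nu ^ (N + 1)) * X nu y)%C).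
  - intros. now rewrite assembled_eq.
  - apply (family_plus r (truncated psi N) (fun nu y => RtoC (nu ^ (N + 1)) * X nu y)%C).
    + now apply family_truncated.
    + apply (family_scal r X (fun nu => RtoC (nu ^ (N + 1))) 1); auto.
      intros nu. apply Cmod_pow_le_1.
Qed.

Lemma dyC_assembled j nu y : 0 < nu <= 1 -> 0 <= y ->
  dyC j (assembled nu) y = (dyC j (psi 0%nat) y
    + sum_n_m (fun k => dyC j (coefficient nu k) y * RtoC (nu ^ k)) 1 N)%C.
Proof.
  intros Hnu Hy.
  destruct (dyC_sum (coefficient nu) (fun k => RtoC (nu ^ k)) N) as [HT HD].
  { intros k _. exists r. exact (family_exp_bounded r _ nu (family_coefficient k) Hnu). }
  unfold assembled. rewrite dyC_plus; auto.
  - now rewrite HD.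
  - exists r. apply hpsi.
Qed.

(** Only the coefficient of index [N] differs from its formal counterpart, by [nu * tail_term], and
    there the exponent [N + 1 - k] is 1. For smaller [k] the difference is zero, so any power of
    [nu] is allowed. *)
Lemma coefficient_bounds j : exists K, 0 < K /\
  forall nu k y, 0 < nu <= 1 -> (1 <= k <= N)%nat -> 0 <= y ->
    Cmod (dyC j (coefficient nu k) y) <= K * exp (r * y) /\
    Cmod (dyC j (fun z => coefficient nu k z - psi k z)%C y)
      <= K * nu ^ (N + 1 - k) * exp (r * y).
Proof.
  destruct (exp_bounded_dyC_uniform r psi N j hpsi) as [K1 [HK1 B1]].
  destruct (family_bound _ _ (family_dyC r _ j (family_coefficient N))) as [K2 [HK2 B2]].
  destruct (family_bound _ _ (family_dyC r _ j family_tail_term)) as [K3 [HK3 B3]].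
  exists (K1 + K2 + K3). split. lra. intros nu k y Hnu Hk Hy.
  assert (P := exp_pos (r * y)).
  assert (Hp : 0 <= nu ^ (N + 1 - k)) by (apply pow_le; lra).
  destruct (Nat.eq_dec k N) as [-> | Hne].
  - split.
    + specialize (B2 nu y Hnu Hy). simpl in B2. nra.
    + replace (N + 1 - N)%nat with 1%nat by lia. rewrite pow_1.
      replace (fun z => coefficient nu N z - psi N z)%C with (fun z => RtoC nu * tail_term nu z)%C.
      * rewrite dyC_scal; auto.
        -- rewrite Cmod_mult, Cmod_R, Rabs_pos_eq by lra.
           specialize (B3 nu y Hnu Hy). simpl in B3.
           apply Rle_trans with (nu * (K3 * exp (r * y))).
           ++ apply Rmult_le_compat_l; lra.
           ++ assert (0 <= nu * exp (r * y)) by (apply Rmult_le_pos; lra). nra.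
        -- exists r. apply family_exp_bounded; auto. apply family_tail_term.
      * apply functional_extensionality; intros z. unfold coefficient.
        destruct (Nat.eq_dec N N); [ring|congruence].
  - assert (E : coefficient nu k = psi k).
    { apply functional_extensionality; intros z. unfold coefficient.
      destruct (Nat.eq_dec k N); [congruence|reflexivity]. }
    rewrite E. split.
    + specialize (B1 k y ltac:(lia) Hy). nra.
    + replace (fun z => psi k z - psi k z)%C with (fun _ : R => RtoC 0)
        by (apply functional_extensionality; intros; ring).
      rewrite dyC_zero, Cmod_0 by exact Hy.
      repeat apply Rmult_le_pos; lra.
Qed.

End Assembly.

Lemma family_W_infty r F nu n : bounded_family r F -> 0 < nu <= 1 -> W_infty n (- r) (F nu).
Proof.
  intros HF Hnu. split.
  - exact (family_smooth r F nu HF Hnu n).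
  - intros j _. destruct (family_bound _ _ (family_dyC r F j HF)) as [K [_ Hb]].
    eapply Rbar_le_lt_trans; [|exact (I : Rbar_lt (Finite K) p_infty)].
    apply weighted_norm_le. auto.
Qed.

(** A nonzero integer has modulus at least 1, so smallness of [|alpha| sqrt nu] forces smallness of
    [nu]. This turns the scaling [|alpha| << nu^(-1/2)] into the threshold below which the
    construction is valid. *)
Lemma viscosity_small alpha nu nu0 : alpha <> 0%Z -> 0 < nu -> 0 < nu0 ->
  Rabs (IZR alpha) <= sqrt nu0 / sqrt nu -> nu <= nu0.
Proof.
  intros Ha Hnu Hnu0 H.
  assert (H1 : 1 <= Rabs (IZR alpha)).
  { rewrite <- abs_IZR. apply IZR_le. lia. }
  assert (Hs : 0 < sqrt nu) by now apply sqrt_lt_R0.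
  apply sqrt_le_0; try lra.
  apply Rmult_le_reg_r with (/ sqrt nu). now apply Rinv_0_lt_compat.
  rewrite Rinv_r by lra. unfold Rdiv in H. lra.
Qed.

(** The coefficients [psi] may depend on [nu], and boundedness alone would then assert no more than
    [phi_N = phi_c + O(nu)]. The [nu]-free [psi0] with the last estimate makes it a genuine
    expansion: replacing each [psi] by [psi0] changes the sum by [O(nu^(N+1))] in the weighted
    norms. *)
Theorem proposition3p4 (alpha : Z) (c : C) (N : nat) (Us : R -> R)
    (phi_c : branch -> R -> C)
    (halpha : alpha <> 0%Z) (hc : 0 < Im c) (hN : (1 <= N)%nat)
    (hUs : shear_profile Us)
    (hphi : rayleigh_fundamental Us alpha c phi_c) :
  exists (delta D : R) (K : nat -> R)
         (phi_N : R -> branch -> R -> C)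
         (psi : R -> branch -> nat -> R -> C)
         (psi0 : branch -> nat -> R -> C),
    0 < delta /\ 0 < D /\ (forall j, 0 < K j) /\
    (forall s k, (1 <= k <= N)%nat -> smoothC (psi0 s k)) /\
    forall nu : R, 0 < nu -> Rabs (IZR alpha) <= delta / sqrt nu ->
    forall s : branch,
      smoothC (phi_N nu s) /\
      (forall n, W_infty n (- rate alpha s) (phi_N nu s)) /\
      approximate_solution Us alpha c nu N D (phi_N nu s) /\
      (forall k, (1 <= k <= N)%nat -> smoothC (psi nu s k)) /\
      (forall j y, 0 <= y ->
         dyC j (phi_N nu s) y =
           (dyC j (phi_c s) y
            + sum_n_m (fun k => dyC j (psi nu s k) y * RtoC (nu ^ k)) 1 N)%C) /\
      (forall j k, (1 <= k <= N)%nat ->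
         Rbar_le (weighted_norm (- rate alpha s) (dyC j (psi nu s k))) (K j)) /\
      (forall j k, (1 <= k <= N)%nat ->
         Rbar_le
           (weighted_norm (- rate alpha s)
              (dyC j (fun y => (psi nu s k y - psi0 s k y)%C)))
           (K j * nu ^ (N + 1 - k))).
Proof.
  assert (H := expansion_exists Us alpha c N phi_c halpha hc hUs hphi).
  assert (HK : exists (psi0 : branch -> nat -> R -> C) (X : branch -> R -> R -> C)
      (nu0 D : branch -> R), forall s,
    psi0 s 0%nat = phi_c s /\ (forall k, exp_bounded (rate alpha s) (psi0 s k)) /\
    bounded_family (rate alpha s) (X s) /\ 0 < nu0 s <= 1 /\ 0 < D s /\
    forall nu, 0 < nu <= nu0 s ->
      approximate_solution Us alpha c nu N (D s)
        (fun y => truncated (psi0 s) N nu y + RtoC (nu ^ (N + 1)) * X s nu y)%C).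
  { destruct (H Plus) as [p1 [X1 [n1 [D1 H1]]]]. destruct (H Minus) as [p2 [X2 [n2 [D2 H2]]]].
    exists (fun s => match s with Plus => p1 | Minus => p2 end),
      (fun s => match s with Plus => X1 | Minus => X2 end),
      (fun s => match s with Plus => n1 | Minus => n2 end),
      (fun s => match s with Plus => D1 | Minus => D2 end).
    intros [|]; assumption. }
  destruct HK as [psi0 [X [nu0 [D HK]]]].
  assert (HB : forall j s, exists K, 0 < K /\
    forall nu k y, 0 < nu <= 1 -> (1 <= k <= N)%nat -> 0 <= y ->
      Cmod (dyC j (coefficient (psi0 s) (X s) N nu k) y) <= K * exp (rate alpha s * y) /\
      Cmod (dyC j (fun z => coefficient (psi0 s) (X s) N nu k z - psi0 s k z)%C y)
        <= K * nu ^ (N + 1 - k) * exp (rate alpha s * y)).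
  { intros j s. destruct (HK s) as [_ [H1 [H2 _]]]. now apply coefficient_bounds. }
  (* The constants have to be fixed as functions of [j] before [nu] appears, hence the choice;
     summing over the two branches below removes the dependence on [s]. *)
  set (Kb := fun j s => proj1_sig (constructive_indefinite_description _ (HB j s))).
  assert (HKb : forall j s, 0 < Kb j s /\
    forall nu k y, 0 < nu <= 1 -> (1 <= k <= N)%nat -> 0 <= y ->
      Cmod (dyC j (coefficient (psi0 s) (X s) N nu k) y) <= Kb j s * exp (rate alpha s * y) /\
      Cmod (dyC j (fun z => coefficient (psi0 s) (X s) N nu k z - psi0 s k z)%C y)
        <= Kb j s * nu ^ (N + 1 - k) * exp (rate alpha s * y)).
  { intros j s. exact (proj2_sig (constructive_indefinite_description _ (HB j s))). }
  clearbody Kb. clear HB.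
  set (K := fun j => Kb j Plus + Kb j Minus).
  assert (HKle : forall j s, Kb j s <= K j).
  { intros j s. unfold K. destruct (HKb j Plus), (HKb j Minus). destruct s; lra. }
  set (nu00 := Rmin (nu0 Plus) (nu0 Minus)).
  assert (Hnu00 : 0 < nu00 /\ forall s, nu00 <= nu0 s <= 1).
  { destruct (HK Plus) as [_ [_ [_ [[P1 P2] _]]]]. destruct (HK Minus) as [_ [_ [_ [[M1 M2] _]]]].
    split. now apply Rmin_glb_lt. intros [|]; split; auto. apply Rmin_l. apply Rmin_r. }
  destruct Hnu00 as [Hnu00 Hnule].
  assert (HDpos : forall s, 0 < D s) by (intros s; apply (HK s)).
  (* The square root is what [viscosity_small] converts back into [nu <= nu00]. *)
  exists (sqrt nu00), (D Plus + D Minus), K,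
    (fun nu s => assembled (psi0 s) (X s) N nu),
    (fun nu s => coefficient (psi0 s) (X s) N nu), psi0.
  split. { now apply sqrt_lt_R0. }
  split. { assert (H1 := HDpos Plus). assert (H2 := HDpos Minus). lra. }
  split. { intros j. eapply Rlt_le_trans; [|apply (HKle j Plus)]. apply HKb. }
  split.
  { intros s k _. destruct (HK s) as [_ [H1 _]].
    exact (family_smooth _ _ 1 (H1 k) unit_parameter). }
  intros nu Hnu Hsmall s.
  assert (Hle : nu <= nu00) by now apply (viscosity_small alpha nu nu00).
  specialize (Hnule s). assert (Hnu1 : 0 < nu <= 1) by lra.
  destruct (HK s) as [E0 [Hpsi [HX [_ [_ HA]]]]].
  assert (HF := family_assembled (rate alpha s) (psi0 s) (X s) N Hpsi HX hN).
  split. { exact (family_smooth _ _ nu HF Hnu1). }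
  split. { intros n. exact (family_W_infty _ _ nu n HF Hnu1). }
  split.
  { specialize (HA nu ltac:(lra)). intros y Hy. specialize (HA y Hy).
    replace (assembled (psi0 s) (X s) N nu) with
      (fun y => truncated (psi0 s) N nu y + RtoC (nu ^ (N + 1)) * X s nu y)%C
      by (apply functional_extensionality; intros u; symmetry; now apply assembled_eq).
    eapply Rle_trans; [exact HA|]. apply Rmult_le_compat_r. apply Cmod_ge_0.
    apply Rmult_le_compat_r. apply pow_le; lra.
    assert (H1 := HDpos Plus). assert (H2 := HDpos Minus). destruct s; lra. }
  split.
  { intros k _. exact (family_smooth _ _ nu (family_coefficient _ _ _ N Hpsi HX k) Hnu1). }
  split.
  { intros j y Hy. rewrite <- E0. now apply (dyC_assembled (rate alpha s)). }
  split; intros j k Hk; apply weighted_norm_le; intros y Hy;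
    destruct (HKb j s) as [_ Hb]; destruct (Hb nu k y Hnu1 Hk Hy) as [Hb1 Hb2];
    assert (P := exp_pos (rate alpha s * y)); specialize (HKle j s).
  - eapply Rle_trans; [exact Hb1|]. apply Rmult_le_compat_r; lra.
  - eapply Rle_trans; [exact Hb2|]. apply Rmult_le_compat_r. lra.
    apply Rmult_le_compat_r; auto. apply pow_le; lra.
Qed.
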